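(* Let $d\ge 1$ be an integer, let $0<\alpha<1$ and $0<\beta\le 2$ be constants, let $a\in L^1(\mathbb{R}^d)\cap L^2(\mathbb{R}^d)$, and let $p\in L^\infty(\mathbb{R}^d)$ be real-valued with $p(x)<-\delta_0$ in $\mathbb{R}^d$ for some constant $\delta_0>0$. Let $u$ be the (mild) solution of the Cauchy problem $$\partial_t^\alpha u(x,t) = -(-\Delta)^{\beta/2}u(x,t)+p(x)u(x,t),\quad x\in\mathbb{R}^d,\ t>0,\qquad u(x,0)=a(x),\quad x\in\mathbb{R}^d.$$ Suppose moreover that $$\|u(\cdot,t)\|_{H^{\beta/2}(\mathbb{R}^d)}=o(t^{-\alpha})\quad\text{as } t\to\infty.$$ Then $u(x,t)=0$ for all $x\in\mathbb{R}^d$ and $t>0$ (i.e. $u(\cdot,t)=0$ as an element of $L^2(\mathbb{R}^d)$ for every $t>0$).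
   Context: Fourier transform: $\widehat f(\xi)=\int_{\mathbb{R}^d} f(x)e^{-2\pi i\xi\cdot x}\,dx$. The Riesz derivative $(-\Delta)^{\beta/2}$ is the Fourier multiplier with symbol $|\xi|^\beta$. The Caputo derivative is $\partial_t^\alpha u(x,t)=\frac{1}{\Gamma(1-\alpha)}\int_0^t(t-\tau)^{-\alpha}\frac{\partial u}{\partial\tau}(x,\tau)\,d\tau$. The norm of $H^\gamma(\mathbb{R}^d)$ is $\|f\|_{H^\gamma(\mathbb{R}^d)}=\|(1+|\xi|^2)^{\gamma/2}\widehat f(\xi)\|_{L^2(\mathbb{R}^d)}$. Mittag-Leffler function: $E_{\alpha,\rho}(z)=\sum_{k=0}^\infty \frac{z^k}{\Gamma(\alpha k+\rho)}$. For $t>0$ and $f\in L^2(\mathbb{R}^d)$ define $S(t)f$ and $K(t)f$ by $$\widehat{S(t)f}(\xi)=E_{\alpha,1}(-|\xi|^\beta t^\alpha)\widehat f(\xi),\qquad \widehat{K(t)f}(\xi)=t^{\alpha-1}E_{\alpha,\alpha}(-|\xi|^\beta t^\alpha)\widehat f(\xi),$$ so that $K(t)=-(-\Delta)^{-\beta/2}S'(t)$. ''Solution of the Cauchy problem'' means mild solution: the function $u:(0,\infty)\to L^2(\mathbb{R}^d)$, (Bochner) integrable on $(0,T)$ for every $T>0$, that satisfies $$u(t)=S(t)a+\int_0^t K(t-\tau)\big(p\,u(\tau)\big)\,d\tau,\qquad t>0.$$ This mild solution exists, is unique, and takes values in $H^\gamma(\mathbb{R}^d)$ for every $0\le\gamma<\beta$.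 *)

(* Defs.v *)
From HB Require Import structures.
From mathcomp Require Import all_boot all_order all_algebra.
From mathcomp Require Import all_classical all_reals all_analysis.
From mathcomp Require Import complex.

Set Implicit Arguments.
Unset Strict Implicit.
Unset Printing Implicit Defensive.
Import Order.TTheory GRing.Theory Num.Theory.
Import numFieldNormedType.Exports.

Local Open Scope classical_set_scope.
Local Open Scope ring_scope.

(* The space R^d, with the product sigma-algebra that the library puts on
   tuples. *)
Notation Rd R d := (d.-tuple (measurableTypeR R)).

Section lebesgue_measure_on_tuples.
Context {R : realType}.

Definition cons_pair (n : nat) (z : measurableTypeR R * Rd R n) : Rd R n.+1 :=
  [the n.+1.-tuple _ of z.1 :: z.2].

Lemma measurable_cons_pair n : measurable_fun [set: _] (@cons_pair n).
Proof. exact: measurable_cons. Qed.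

Section successor.
Variables (n : nat) (mu : {sigma_finite_measure set (Rd R n) -> \bar R}).

Definition lebesgue_succ : set (Rd R n.+1) -> \bar R :=
  pushforward (lebesgue_measure \x mu)%E (@cons_pair n).

Let measurable_preimage A : measurable A -> measurable (@cons_pair n @^-1` A).
Proof. by move=> mA; rewrite -[X in measurable X]setTI; apply: measurable_cons_pair. Qed.

Let succ0 : lebesgue_succ set0 = 0%E.
Proof. by rewrite /lebesgue_succ /pushforward preimage_set0 measure0. Qed.

Let succ_ge0 A : (0 <= lebesgue_succ A)%E.
Proof. by rewrite /lebesgue_succ /pushforward measure_ge0. Qed.

Let succ_sigma_additive : semi_sigma_additive lebesgue_succ.
Proof.
move=> F mF tF mUF; rewrite /lebesgue_succ /pushforward preimage_bigcup.
apply: measure_semi_sigma_additive.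
- by move=> k; exact: measurable_preimage.
- apply/trivIsetP => /= i j _ _ ij; rewrite -preimage_setI.
  by move/trivIsetP : tF => /(_ _ _ _ _ ij) ->//; rewrite preimage_set0.
- by rewrite -preimage_bigcup; exact: measurable_preimage.
Qed.

HB.instance Definition _ :=
  isMeasure.Build _ _ _ lebesgue_succ succ0 succ_ge0 succ_sigma_additive.

Lemma lebesgue_succ_sigma_finite : sigma_finite setT lebesgue_succ.
Proof.
have /sigma_finiteP[F [TF ndF Foo]] :=
  sigma_finiteT (@lebesgue_measure R : {sigma_finite_measure set _ -> \bar R}).
have /sigma_finiteP[G [TG ndG Goo]] := sigma_finiteT mu.
pose uncons (v : Rd R n.+1) : measurableTypeR R * Rd R n :=
  (thead v, [tuple of behead v]).
have consK : cancel (@cons_pair n) uncons.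
  by move=> [x v]; congr pair; apply/val_inj.
have unconsK : cancel uncons (@cons_pair n).
  by move=> v; rewrite [RHS]tuple_eta; apply/val_inj.
have muncons : measurable_fun setT uncons.
  apply/measurable_fun_pairP; split; first exact: measurable_tnth.
  exact: measurable_behead.
exists (fun k => uncons @^-1` (F k `*` G k)).
  rewrite predeqE => v; split => // _.
  have [j _ Fj] : (\bigcup_n F n) (uncons v).1 by rewrite -TF.
  have [k _ Gk] : (\bigcup_n G n) (uncons v).2 by rewrite -TG.
  exists (maxn j k) => //; split.
    by move: Fj; exact/subsetPset/ndF/leq_maxl.
  by move: Gk; exact/subsetPset/ndG/leq_maxr.
move=> k; have [mF Fk] := Foo k; have [mG Gk] := Goo k.
have mFG : measurable (F k `*` G k) by exact: measurableX.
split; first by rewrite -[X in measurable X]setTI; exact: muncons.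
rewrite /lebesgue_succ /pushforward -comp_preimage.
rewrite (_ : uncons \o _ = id); last by apply/funext => z; exact: consK.
by rewrite preimage_id product_measure1E// lte_mul_pinfty// ge0_fin_numE.
Qed.

HB.instance Definition _ :=
  Measure_isSigmaFinite.Build _ _ _ lebesgue_succ lebesgue_succ_sigma_finite.

End successor.

(* Lebesgue measure on R^n, as the n-fold product of the measure on R. *)
Fixpoint lebesgue_Rd (n : nat) :
    {sigma_finite_measure set (Rd R n) -> \bar R} :=
  match n with
  | 0 => \d_([tuple] : Rd R 0)
  | n.+1 => lebesgue_succ (lebesgue_Rd n)
  end.

Lemma lebesgue_Rd_box n (A : 'I_n -> set (measurableTypeR R)) :
  (forall i, measurable (A i)) ->
  lebesgue_Rd n [set v | forall i, A i (tnth v i)] =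
    (\prod_(i < n) lebesgue_measure (A i))%E.
Proof.
elim: n A => [|n ih] A mA.
  by rewrite big_ord0 /= diracE mem_set// => -[].
rewrite big_ord_recl -(ih (fun i => A (lift ord0 i)))//= /lebesgue_succ.
rewrite /pushforward -product_measure1E//; last first.
  rewrite (_ : [set v | _] = \bigcap_(i in [set: 'I_n])
      ((fun v : Rd R n => tnth v i) @^-1` A (lift ord0 i))).
    apply: fin_bigcap_measurable => [|i _]; first exact: finite_finset.
    by rewrite -[X in measurable X]setTI; exact: measurable_tnth.
  by apply/seteqP; split=> v /= vA i; [move=> _|]; exact: vA.
congr product_measure1; apply/seteqP; split=> -[x v] /=.
  by move=> Av; split=> [|i]; [exact: (Av ord0)|
    have := Av (lift ord0 i); rewrite tnthS].
move=> [Ax Av] i; case: (unliftP ord0 i) => [j|] -> //.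
by rewrite tnthS; exact: Av.
Qed.

End lebesgue_measure_on_tuples.

Section L2.
Context {R : realType} {d : nat}.
Local Notation mu := (lebesgue_Rd d).
Local Notation fct := (Rd R d -> R[i]).
Implicit Types (f g : fct) (q : \bar R).

Definition cLnorm q f : \bar R :=
  Lnorm mu q (fun x => (ComplexField.Normc.normc (f x))%:E).

(* Elements of the complex space L^q(R^d) are handled through Borel
   representatives; equality in L^q is equality almost everywhere. *)
Definition cLfun q f : Prop :=
  [/\ measurable_fun setT (fun x => complex.Re (f x)),
      measurable_fun setT (fun x => complex.Im (f x)) &
      (cLnorm q f < +oo)%E].

Definition ae_eqc f g : Prop := {ae mu, forall x, f x = g x}.

Definition cvg_L2 (F : nat -> fct) f : Prop :=
  cLnorm 2%:E (F n \- f) @[n --> \oo] --> 0%E.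

End L2.

Section fourier.
Context {R : realType} {d : nat}.
Local Notation mu := (lebesgue_Rd d).
Local Notation fct := (Rd R d -> R[i]).

Definition dotRd (x y : Rd R d) : R := \sum_(i < d) tnth x i * tnth y i.

Definition normRd (x : Rd R d) : R := Num.sqrt (dotRd x x).

Definition expci (theta : R) : R[i] := Complex (cos theta) (sin theta).

Definition cintegral (f : fct) : R[i] :=
  Complex (\int[mu]_x complex.Re (f x)) (\int[mu]_x complex.Im (f x)).

Definition fourier_L1 (f : fct) : fct := fun xi =>
  cintegral (fun x => f x * expci (- (2 * pi * dotRd xi x))).

(* On L^2 the Fourier transform is the continuous extension of the integral
   formula from the dense subspace of integrable functions. *)
Definition is_fourier (f g : fct) : Prop :=
  [/\ cLfun 2%:E f, cLfun 2%:E g &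
    exists F : nat -> fct,
      [/\ forall n, cLfun 1%:E (F n) /\ cLfun 2%:E (F n),
          cvg_L2 F f &
          cvg_L2 (fun n => fourier_L1 (F n)) g]].

(* Here and below, xget selects a representative of a class that is determined
   almost everywhere; the value 0 is only taken when there is no such class. *)
Definition fourier (f : fct) : fct := xget (fun=> 0) [set g | is_fourier f g].

Definition fourier_multiplier (m : Rd R d -> R) (f : fct) : fct :=
  xget (fun=> 0) [set g | cLfun 2%:E g /\
    ae_eqc (fourier g) (fun xi => (m xi)%:C%C * fourier f xi)].

Definition sobolev_norm (gamma : R) (f : fct) : \bar R :=
  cLnorm 2%:E (fun xi =>
    ((1 + normRd xi ^+ 2) `^ (gamma / 2))%:C%C * fourier f xi).

End fourier.

Section mittag_leffler.
Context {R : realType}.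

(* Only used for x > 0, where the integral converges. *)
Definition Gamma (x : R) : R :=
  \int[lebesgue_measure]_(t in `]0, +oo[) (t `^ (x - 1) * expR (- t)).

Definition mittag_leffler (alpha rho z : R) : R :=
  limn (series (fun k : nat => z ^+ k / Gamma (alpha * k%:R + rho))).

End mittag_leffler.

Section bochner.
Context {R : realType} {d : nat}.
Local Notation fct := (Rd R d -> R[i]).
Local Notation leb := (@lebesgue_measure R).

Record L2_simple := L2Simple {
  ls_size : nat;
  ls_set : 'I_ls_size -> set (measurableTypeR R);
  ls_val : 'I_ls_size -> fct;
  ls_measurable : forall i, measurable (ls_set i);
  ls_finite : forall i, (leb (ls_set i) < +oo)%E;
  ls_L2 : forall i, cLfun 2%:E (ls_val i)
}.

Definition L2_simple_fun (s : L2_simple) (tau : R) : fct := fun x =>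
  \sum_(i < ls_size s) (\1_(ls_set i) tau : R)%:C%C * ls_val i x.

Definition L2_simple_integral (D : set R) (s : L2_simple) : fct := fun x =>
  \sum_(i < ls_size s) (fine (leb (ls_set i `&` D)))%:C%C * ls_val i x.

(* The almost everywhere convergence is strong measurability of F. *)
Definition bochner_approx (D : set R) (F : R -> fct) (s : nat -> L2_simple) :=
  [/\ forall tau, D tau -> cLfun 2%:E (F tau),
      {ae leb, forall tau, D tau ->
        cvg_L2 (fun n => L2_simple_fun (s n) tau) (F tau)} &
      (\int[leb]_(tau in D)
          cLnorm 2%:E (L2_simple_fun (s n) tau \- F tau)%R)%E
        @[n --> \oo] --> 0%E].

Definition bochner_integrable (D : set R) (F : R -> fct) : Prop :=
  exists s, bochner_approx D F s.

Definition bochner_integral (D : set R) (F : R -> fct) : fct :=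
  xget (fun=> 0) [set v | cLfun 2%:E v /\
    exists2 s, bochner_approx D F s &
      cvg_L2 (fun n => L2_simple_integral D (s n)) v].

End bochner.

Section mild_solution.
Context {R : realType} {d : nat}.
Variables (alpha beta : R).
Local Notation fct := (Rd R d -> R[i]).

Definition Sop (t : R) : fct -> fct := fourier_multiplier (fun xi =>
  mittag_leffler alpha 1 (- (normRd xi `^ beta * t `^ alpha))).

Definition Kop (t : R) : fct -> fct := fourier_multiplier (fun xi =>
  t `^ (alpha - 1) *
  mittag_leffler alpha alpha (- (normRd xi `^ beta * t `^ alpha))).

Definition mild_integrand (p : Rd R d -> R) (u : R -> fct) (t tau : R) : fct :=
  Kop (t - tau) (fun x => (p x)%:C%C * u tau x).

(* Only the values of u at positive times matter. *)
Definition mild_solution (p : Rd R d -> R) (a : fct) (u : R -> fct) : Prop :=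
  [/\ forall t, 0 < t -> cLfun 2%:E (u t),
      forall T, 0 < T -> bochner_integrable `]0, T[ u,
      forall t, 0 < t -> bochner_integrable `]0, t[ (mild_integrand p u t) &
      forall t, 0 < t ->
        ae_eqc (u t)
          (Sop t a \+ bochner_integral `]0, t[ (mild_integrand p u t))].

End mild_solution.

(* Main.v *)
Require Import Defs.
From mathcomp Require Import all_boot all_order all_algebra.
From mathcomp Require Import all_classical all_reals all_analysis.
From mathcomp Require Import complex.
From mathcomp Require Import measurable_realfun ring lra.
Set Implicit Arguments.
Unset Strict Implicit.
Unset Printing Implicit Defensive.
Import Order.TTheory GRing.Theory Num.Theory.
Import numFieldNormedType.Exports.
Local Open Scope classical_set_scope.
Local Open Scope ring_scope.

(* Let lam = |xi|^beta, and let e(t, xi) and f(t, xi) be the Fourier multipliers of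
   S(t) and K(t). As a function of t, f is the resolvent of the kernel
   t^(alpha-1), and f >= 0: at a first zero the strict decrease of
   (1 - s/t)^(alpha-1) in t would beat the Lipschitz decay of f. From f >= 0 and
   e = 1 - lam \int_0^t f one gets lam \int_0^oo f <= 1 and
   e >= 1 / (1 + Gamma(1-alpha) lam t^alpha).

   Pair the mild equation with phi, where phi^ = min(lam, 1) a^, and integrate over
   0 < t < T. The term with S is at least c T^(1-alpha), where c > 0 unless a = 0. In
   the convolution term, the time integral of the multiplier min(lam, 1) f is at most
   1, so that the whole right-hand side is at most a multiple of
   \int_0^T ||u(t)|| dt, which is o(T^(1-alpha)) by the decay assumption. Hence
   a = 0, and u = 0 follows from Gronwall's inequality with the singular kernel
   t^(alpha-1). *)

(** * The Hilbert space L^2 *)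

(** Estimates on [u] are scalar, obtained by pairing with a test function. Each [K(t-s)] is
    self-adjoint and is moved onto phi; integrating over t then lets Tonelli separate the time
    integral of [K] from that of [u], so that only the total time mass of [K] enters.

    The cut-off min(lam, 1) answers two constraints. The factor lam keeps the integral of f over (0,
    T) bounded uniformly in T: at lam = 0 that integral grows like T^alpha. The minimum with 1 keeps
    phi in L^2, since [a] has no regularity.

    Nonnegativity of f is classically read off from complete monotonicity. The comparison at a first
    zero replaces this by elementary means: the resolvent equation, a local Lipschitz bound and
    convexity of a power.

    The L^2 Fourier transform is a selected representative of a limit, hence unusable before
    Plancherel's theorem. Damping by the product of the factors exp(-e|xi_i|) turns the question
    into one about Poisson kernels, which can be integrated over boxes in closed form; the isometry
    then spreads from boxes by Dynkin's lemma, linearity and limits. *)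

Section complex_dot.
Context {R : rcfType}.
Implicit Types z w : R[i].

(** This is Re (z * conj w). A real scalar product suffices because all the multipliers that occur
    are real-valued. *)
Definition cdot z w : R :=
  complex.Re z * complex.Re w + complex.Im z * complex.Im w.

Lemma cdotC z w : cdot z w = cdot w z.
Proof. by rewrite /cdot mulrC [X in _ + X]mulrC. Qed.

Lemma cdotDl z1 z2 w : cdot (z1 + z2) w = cdot z1 w + cdot z2 w.
Proof. by case: z1 z2 => [a b] [c d]; rewrite /cdot /=; ring. Qed.

Lemma cdotBl z1 z2 w : cdot (z1 - z2) w = cdot z1 w - cdot z2 w.
Proof. by case: z1 z2 => [a b] [c d]; rewrite /cdot /=; ring. Qed.

Lemma cdotZl (a : R) z w : cdot (a%:C%C * z) w = a * cdot z w.
Proof. by case: z => [x y]; rewrite /cdot /=; ring. Qed.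

Lemma cdot_ge0 z : 0 <= cdot z z.
Proof. by rewrite /cdot -!expr2 addr_ge0// sqr_ge0. Qed.

Lemma cdot_eq0 z : cdot z z = 0 -> z = 0.
Proof.
case: z => a b /eqP; rewrite /cdot /= -!expr2 paddr_eq0 ?sqr_ge0// !sqrf_eq0.
by move=> /andP[/eqP-> /eqP->].
Qed.

Lemma cdot_normc z : ComplexField.Normc.normc z ^+ 2 = cdot z z.
Proof. by case: z => a b; rewrite /cdot /= sqr_sqrtr ?addr_ge0 ?sqr_ge0// !expr2. Qed.

Lemma ler_cdot z w : `|cdot z w| <= cdot z z + cdot w w.
Proof.
case: z w => [a b] [c d]; rewrite /cdot /= ler_norml; apply/andP; split;
  have := sqr_ge0 (a + c); have := sqr_ge0 (b + d); have := sqr_ge0 (a - c);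
  have := sqr_ge0 (b - d); have := sqr_ge0 a; have := sqr_ge0 b;
  have := sqr_ge0 c; have := sqr_ge0 d; nra.
Qed.

Lemma cdotDD z w : cdot (z + w) (z + w) <= 2 * (cdot z z + cdot w w).
Proof.
case: z w => [a b] [c d]; rewrite /cdot /=.
by have := sqr_ge0 (a - c); have := sqr_ge0 (b - d); nra.
Qed.

End complex_dot.

(** Evaluate at the minimiser [- B / C]; if [C = 0] and [B] is nonzero, the value chosen for [t]
    makes the expression equal to -1. Stated without inner products since it serves both
    Cauchy-Schwarz and the semidefinite form whose null space is [isom]. *)
Lemma psd_quadratic {R : realFieldType} (A B C : R) : 0 <= A -> 0 <= C ->
  (forall t, 0 <= A + 2 * t * B + t ^+ 2 * C) -> B ^+ 2 <= A * C.
Proof.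
move=> A0; rewrite le_eqVlt => /predU1P[<-|C0] h.
  have [->|B0] := eqVneq B 0; first by rewrite expr0n/= mulr0.
  have := h (- (A + 1) / (2 * B)).
  rewrite mulr0 addr0 (_ : 2 * _ * B = - (A + 1)); last by field; lra.
  lra.
have := h (- B / C).
rewrite (_ : A + _ + _ = (A * C - B ^+ 2) / C); last by field; lra.
by rewrite pmulr_lge0 ?invr_gt0// subr_ge0.
Qed.

Section complex_measurable.
Context d {T : measurableType d} {R : realType}.
Implicit Types f g : T -> R[i].

Definition cmeas f := measurable_fun setT (fun x => complex.Re (f x)) /\
  measurable_fun setT (fun x => complex.Im (f x)).

Lemma cmeasD f g : cmeas f -> cmeas g -> cmeas (f \+ g).
Proof.
move=> [f1 f2] [g1 g2]; split.
  rewrite (_ : (fun _ => _) = (fun x => complex.Re (f x)) \+ (fun x => complex.Re (g x))).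
    exact: measurable_funD.
  by apply/funext => x /=; case: (f x) (g x) => [? ?] [].
rewrite (_ : (fun _ => _) = (fun x => complex.Im (f x)) \+ (fun x => complex.Im (g x))).
  exact: measurable_funD.
by apply/funext => x /=; case: (f x) (g x) => [? ?] [].
Qed.

Lemma cmeasZ (m : T -> R) f : measurable_fun setT m -> cmeas f ->
  cmeas (fun x => (m x)%:C%C * f x).
Proof.
move=> mm [f1 f2]; split.
  rewrite (_ : (fun _ => _) = m \* (fun x => complex.Re (f x))).
    exact: measurable_funM.
  by apply/funext => x /=; case: (f x) => [? ?] /=; rewrite mul0r subr0.
rewrite (_ : (fun _ => _) = m \* (fun x => complex.Im (f x))).
  exact: measurable_funM.
by apply/funext => x /=; case: (f x) => [? ?] /=; rewrite mul0r addr0.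
Qed.

Lemma cmeasB f g : cmeas f -> cmeas g -> cmeas (f \- g).
Proof.
move=> mf mg; rewrite (_ : f \- g = f \+ (fun x => (-1)%:C%C * g x)).
  by apply: cmeasD => //; apply: cmeasZ.
by apply/funext => x /=; rewrite rmorphN rmorph1 mulN1r.
Qed.

Lemma measurable_cdot f g : cmeas f -> cmeas g ->
  measurable_fun setT (fun x => cdot (f x) (g x)).
Proof.
by move=> [f1 f2] [g1 g2]; apply: measurable_funD; apply: measurable_funM.
Qed.

End complex_measurable.

Section L2.
Context {R : realType} {d : nat}.
Local Notation mu := (lebesgue_Rd d : {sigma_finite_measure set (Rd R d) -> \bar R}).
Local Notation fct := (Rd R d -> R[i]).
Implicit Types f g h : fct.

(** The real-valued integral returns 0 in place of an infinite value, so [ip] and [nrm] carry no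
    integrability information; this is why [L2] accompanies them as a hypothesis. *)
Definition ip f g : R := \int[mu]_x cdot (f x) (g x).
Definition nrm f : R := Num.sqrt (ip f f).
Notation L2 := (cLfun 2%:E).

Lemma cLnorm2E f : (cLnorm 2%:E f = (\int[mu]_x (cdot (f x) (f x))%:E) `^ 2^-1)%E.
Proof.
rewrite /cLnorm unlock; congr (_ `^ _)%E; apply: eq_integral => x _ /=.
by rewrite ger0_norm ?powR_mulrn ?cdot_normc//; case: (f x) => a b; exact: sqrtr_ge0.
Qed.

Lemma L2P f : L2 f <-> cmeas f /\ (\int[mu]_x (cdot (f x) (f x))%:E < +oo)%E.
Proof.
split=> [[f1 f2]|[[f1 f2] fo]].
  rewrite cLnorm2E => fo; split; first by split.
  have : (0 <= \int[mu]_x (cdot (f x) (f x))%:E)%E.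
    by apply: integral_ge0 => x _; rewrite lee_fin cdot_ge0.
  by case: (\int[mu]_x _)%E fo => //= [r _ _|]; rewrite ?ltry// invr_eq0 pnatr_eq0.
split=> //; rewrite cLnorm2E; move: fo.
have : (0 <= \int[mu]_x (cdot (f x) (f x))%:E)%E.
  by apply: integral_ge0 => x _; rewrite lee_fin cdot_ge0.
by case: (\int[mu]_x _)%E => //= r _ _; rewrite ltry.
Qed.

Lemma L2_cmeas f : L2 f -> cmeas f. Proof. by move=> /L2P[]. Qed.

Lemma L2_integrable f g : L2 f -> L2 g ->
  mu.-integrable setT (fun x => (cdot (f x) (g x))%:E).
Proof.
move=> /L2P[mf fo] /L2P[mg go].
apply: (@le_integrable _ _ _ _ setT _ _ (fun x => (cdot (f x) (f x))%:E + (cdot (g x) (g x))%:E)%E) => //.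
- by apply/measurable_EFinP; exact: measurable_cdot.
- move=> x _; rewrite /= lee_fin [leRHS]ger0_norm; first exact: ler_cdot.
  by rewrite addr_ge0// cdot_ge0.
apply: integrableD => //; apply/integrableP; split.
- by apply/measurable_EFinP; exact: measurable_cdot.
- by under eq_integral do rewrite /= ger0_norm ?cdot_ge0//.
- by apply/measurable_EFinP; exact: measurable_cdot.
- by under eq_integral do rewrite /= ger0_norm ?cdot_ge0//.
Qed.

Lemma ipE f g : L2 f -> L2 g -> ((ip f g)%:E = \int[mu]_x (cdot (f x) (g x))%:E)%E.
Proof.
by move=> f2 g2; rewrite /ip /Rintegral fineK//; apply: integrable_fin_num => //;
  exact: L2_integrable.
Qed.

Lemma ip_ge0 f : 0 <= ip f f.
Proof. by apply: Rintegral_ge0 => x _; exact: cdot_ge0. Qed.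

Lemma cLnorm_nrm f : L2 f -> cLnorm 2%:E f = (nrm f)%:E.
Proof.
by move=> f2; rewrite cLnorm2E -ipE//= /nrm powR12_sqrt// ip_ge0.
Qed.

Lemma nrm_ge0 f : 0 <= nrm f. Proof. exact: sqrtr_ge0. Qed.

Lemma nrm_sq f : nrm f ^+ 2 = ip f f.
Proof. by rewrite sqr_sqrtr// ip_ge0. Qed.

Lemma ipC f g : ip f g = ip g f.
Proof. by apply: eq_Rintegral => x _; rewrite cdotC. Qed.

Lemma L2_bounded (m : Rd R d -> R) (M : R) f : measurable_fun setT m ->
  (forall x, `|m x| <= M) -> L2 f -> L2 (fun x => (m x)%:C%C * f x).
Proof.
move=> mm mM f2; have [mf fo] := (L2P f).1 f2; apply/L2P; split.
  exact: cmeasZ.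
apply: (@le_lt_trans _ _ (\int[mu]_x ((M ^+ 2)%:E * (cdot (f x) (f x))%:E))%E).
  apply: ge0_le_integral => //.
  - by move=> x _; rewrite lee_fin cdot_ge0.
  - by apply/measurable_EFinP/measurable_cdot; apply: cmeasZ.
  - by apply/measurable_EFinP; apply: measurable_funM => //; exact: measurable_cdot.
  - move=> x _; rewrite -EFinM lee_fin cdotZl cdotC cdotZl mulrA -expr2.
    apply: ler_wpM2r; first exact: cdot_ge0.
    rewrite -real_normK ?num_real// lerXn2r// nnegrE//.
    exact: le_trans (mM x).
rewrite ge0_integralZl//; last 3 first.
  by apply/measurable_EFinP; exact: measurable_cdot.
  by move=> x _; rewrite lee_fin cdot_ge0.
  by rewrite lee_fin sqr_ge0.
by rewrite -ipE// -EFinM ltry.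
Qed.

Lemma L2Z (a : R) f : L2 f -> L2 (fun x => a%:C%C * f x).
Proof. by move=> f2; apply: (@L2_bounded (cst a) `|a|). Qed.

Lemma L2D f g : L2 f -> L2 g -> L2 (f \+ g).
Proof.
move=> f2 g2; have [mf fo] := (L2P f).1 f2; have [mg go] := (L2P g).1 g2.
apply/L2P; split; first exact: cmeasD.
apply: (@le_lt_trans _ _ (\int[mu]_x (2%:E * ((cdot (f x) (f x))%:E + (cdot (g x) (g x))%:E)))%E).
  apply: ge0_le_integral => //.
  - by move=> x _; rewrite lee_fin cdot_ge0.
  - by apply/measurable_EFinP/measurable_cdot; exact: cmeasD.
  - apply/measurable_EFinP; apply: measurable_funM => //.
    by apply: measurable_funD; exact: measurable_cdot.
  - by move=> x _; rewrite -EFinD -EFinM lee_fin cdotDD.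
rewrite ge0_integralZl//; last 2 first.
  by apply/measurable_EFinP; apply: measurable_funD; exact: measurable_cdot.
  by move=> x _; rewrite -EFinD lee_fin addr_ge0// cdot_ge0.
rewrite ge0_integralD//; last 4 first.
  by move=> x _; rewrite lee_fin cdot_ge0.
  by apply/measurable_EFinP; exact: measurable_cdot.
  by move=> x _; rewrite lee_fin cdot_ge0.
  by apply/measurable_EFinP; exact: measurable_cdot.
by rewrite -!ipE// -EFinD -EFinM ltry.
Qed.

Lemma subZE f g : f \- g = f \+ (fun x => (-1)%:C%C * g x).
Proof. by apply/funext => x /=; rewrite rmorphN rmorph1 mulN1r. Qed.

Lemma L2B f g : L2 f -> L2 g -> L2 (f \- g).
Proof. by move=> f2 g2; rewrite subZE; apply: L2D => //; apply: L2Z. Qed.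

Lemma L20 : L2 (cst 0 : fct).
Proof.
apply/L2P; split; first by split; exact: measurable_cst.
by under eq_integral do rewrite /cdot /= !mulr0 addr0; rewrite integral0.
Qed.

Lemma ipDl f g h : L2 f -> L2 g -> L2 h -> ip (f \+ g) h = ip f h + ip g h.
Proof.
move=> f2 g2 h2; rewrite /ip -RintegralD//; [|exact: L2_integrable..].
by apply: eq_Rintegral => x _; rewrite cdotDl.
Qed.

Lemma ipZl (a : R) f h : L2 f -> L2 h -> ip (fun x => a%:C%C * f x) h = a * ip f h.
Proof.
move=> f2 h2; rewrite /ip -RintegralZl//; last exact: L2_integrable.
by apply: eq_Rintegral => x _; rewrite cdotZl.
Qed.

Lemma ipMl (m : Rd R d -> R) f h : ip (fun x => (m x)%:C%C * f x) h = ip f (fun x => (m x)%:C%C * h x).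
Proof.
by apply: eq_Rintegral => x _; rewrite cdotZl [RHS]cdotC cdotZl cdotC.
Qed.

Lemma ipBl f g h : L2 f -> L2 g -> L2 h -> ip (f \- g) h = ip f h - ip g h.
Proof.
by move=> f2 g2 h2; rewrite subZE ipDl//; [rewrite ipZl// mulN1r|exact: L2Z].
Qed.

Lemma ipDr f g h : L2 f -> L2 g -> L2 h -> ip h (f \+ g) = ip h f + ip h g.
Proof. by move=> *; rewrite ipC ipDl// ipC [X in _ + X]ipC. Qed.

Lemma ipBr f g h : L2 f -> L2 g -> L2 h -> ip h (f \- g) = ip h f - ip h g.
Proof. by move=> *; rewrite ipC ipBl// ipC [X in _ - X]ipC. Qed.

Lemma ipZr (a : R) f h : L2 f -> L2 h -> ip h (fun x => a%:C%C * f x) = a * ip h f.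
Proof. by move=> *; rewrite ipC ipZl// ipC. Qed.

Lemma ip_suml n (F : 'I_n -> fct) h : (forall i, L2 (F i)) -> L2 h ->
  L2 (fun x => \sum_(i < n) F i x) /\
  ip (fun x => \sum_(i < n) F i x) h = \sum_(i < n) ip (F i) h.
Proof.
elim: n F => [|n ih] F F2 h2.
  rewrite big_ord0 (_ : (fun _ => _) = cst 0); last first.
    by apply/funext => x; rewrite big_ord0.
  split; first exact: L20.
  transitivity (\int[mu]_x (0 : R)); last by rewrite /Rintegral integral0.
  by apply: eq_Rintegral => x _; rewrite /cdot /= !mul0r addr0.
have [ih1 ih2] := ih (fun i => F (lift ord0 i)) (fun i => F2 _) h2.
rewrite (_ : (fun _ => _) = F ord0 \+ (fun x => \sum_(i < n) F (lift ord0 i) x)).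
  by split; [exact: L2D|rewrite ipDl// ih2 big_ord_recl].
by apply/funext => x; rewrite big_ord_recl.
Qed.

Lemma ip_DD f g : L2 f -> L2 g ->
  ip (f \+ g) (f \+ g) = ip f f + 2 * ip f g + ip g g.
Proof.
move=> f2 g2; have fg2 := L2D f2 g2; rewrite ipDl// !ipDr// (ipC g f); ring.
Qed.

Lemma ip_BB f g : L2 f -> L2 g ->
  ip (f \- g) (f \- g) = ip f f - 2 * ip f g + ip g g.
Proof.
move=> f2 g2; have fg2 := L2B f2 g2; rewrite ipBl// !ipBr// (ipC g f); ring.
Qed.

Lemma ip_CS f g : L2 f -> L2 g -> `|ip f g| <= nrm f * nrm g.
Proof.
move=> f2 g2; rewrite -ler_sqr ?nnegrE ?mulr_ge0 ?nrm_ge0//.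
rewrite exprMn !nrm_sq real_normK ?num_real//.
apply: psd_quadratic => [||t]; [exact: ip_ge0..|].
have := ip_ge0 (f \+ (fun x => t%:C%C * g x)).
have tg2 := L2Z t g2.
rewrite ip_DD// ipZr// ipZl// ipZr//; lra.
Qed.

Lemma nrmD f g : L2 f -> L2 g -> nrm (f \+ g) <= nrm f + nrm g.
Proof.
move=> f2 g2; rewrite -ler_sqr ?nnegrE ?addr_ge0 ?nrm_ge0//.
rewrite nrm_sq ip_DD// sqrrD !nrm_sq.
have : ip f g <= nrm f * nrm g by rewrite (le_trans (ler_norm _))// ip_CS.
lra.
Qed.

Lemma nrmZ (a : R) f : L2 f -> nrm (fun x => a%:C%C * f x) = `|a| * nrm f.
Proof.
move=> f2; rewrite /nrm ipZl ?ipZr//; [|exact: L2Z].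
by rewrite mulrA -expr2 sqrtrM ?sqr_ge0// sqrtr_sqr.
Qed.

Lemma nrm_subC f g : nrm (f \- g) = nrm (g \- f).
Proof.
congr Num.sqrt; apply: eq_Rintegral => x _; rewrite /cdot /=.
by case: (f x) (g x) => [? ?] [? ?] /=; ring.
Qed.

Lemma nrmB_le f g h : L2 f -> L2 g -> L2 h ->
  nrm (f \- h) <= nrm (f \- g) + nrm (g \- h).
Proof.
move=> f2 g2 h2; rewrite (_ : f \- h = (f \- g) \+ (g \- h)).
  by apply: nrmD; exact: L2B.
by apply/funext => x /=; rewrite addrA subrK.
Qed.

Lemma nrm_bounded (m : Rd R d -> R) (M : R) f : measurable_fun setT m ->
  (forall x, `|m x| <= M) -> L2 f -> nrm (fun x => (m x)%:C%C * f x) <= M * nrm f.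
Proof.
move=> mm mM f2; have mf2 := L2_bounded mm mM f2.
(* Nonnegativity of [M] comes from the bound at one point, here the origin. *)
have M0 : 0 <= M by exact: le_trans (mM (nseq_tuple d 0)).
rewrite -ler_sqr ?nnegrE ?mulr_ge0 ?nrm_ge0// exprMn !nrm_sq.
rewrite /ip -RintegralZl//; last exact: L2_integrable.
apply: le_Rintegral => //.
- exact: L2_integrable.
- under [X in _.-integrable _ X]eq_fun do rewrite /= EFinM.
  apply: integrableZl => //; exact: L2_integrable.
move=> x _; rewrite cdotZl cdotC cdotZl mulrA -expr2.
apply: ler_wpM2r; first exact: cdot_ge0.
rewrite -real_normK ?num_real// lerXn2r// nnegrE//.
Qed.

End L2.
Notation L2 := (cLfun 2%:E).

(** Fatou's lemma in the form used for limits of bounds: a uniform bound on the integrals survives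
    pointwise convergence, without monotonicity or domination. *)
Lemma ge0_fatou_le d (T : measurableType d) (R : realType)
    (mu : {measure set T -> \bar R}) (D : set T) (g : nat -> T -> R) (f : T -> R)
    (c : \bar R) : measurable D ->
  (forall n, measurable_fun D (g n)) -> (forall n x, D x -> 0 <= g n x) ->
  (forall x, D x -> g n x @[n --> \oo] --> f x) ->
  (forall n, (\int[mu]_(x in D) (g n x)%:E <= c)%E) ->
  (\int[mu]_(x in D) (f x)%:E <= c)%E.
Proof.
move=> mD mg g0 gf gc.
have -> : (\int[mu]_(x in D) (f x)%:E =
    \int[mu]_(x in D) limn_einf (fun n => (g n x)%:E))%E.
  apply: eq_integral => x; rewrite inE => Dx.
  have fx : (g n x)%:E @[n --> \oo] --> (f x)%:E by apply: cvg_EFin; [exact: nearW|exact: gf].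
  by have [-> _] := cvg_limn_einf_sup fx.
apply: le_trans.
  apply: fatou => // n; first by apply/measurable_EFinP.
rewrite limn_einf_lim; apply: lime_le; first exact: is_cvg_einfs.
apply: nearW => n; apply: le_trans (gc n).
by apply: ereal_inf_lbound; exists n => //=.
Qed.

Section L2_ae.
Context {R : realType} {d : nat}.
Local Notation mu := (lebesgue_Rd d : {sigma_finite_measure set (Rd R d) -> \bar R}).
Local Notation fct := (Rd R d -> R[i]).
Implicit Types f g h : fct.

Lemma ip0_ae f : L2 f -> ip f f = 0 -> {ae mu, forall x, f x = 0}.
Proof.
move=> f2 f0.
have : (\int[mu]_x `|(cdot (f x) (f x))%:E| = 0)%E.
  under eq_integral do rewrite /= ger0_norm ?cdot_ge0//.
  by rewrite -ipE// f0.
move/(ae_eq_integral_abs mu measurableT).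
move=> /(_ _)[|N [mN N0 Nsub]].
  by apply/measurable_EFinP; apply: measurable_cdot; exact: L2_cmeas.
exists N; split => // x /= fx; apply: Nsub => /= h; apply: fx.
by apply: cdot_eq0; have := h I; case.
Qed.

Lemma ae_ip f f' g : cmeas f -> cmeas f' -> cmeas g ->
  {ae mu, forall x, f x = f' x} -> ip f g = ip f' g.
Proof.
move=> mf mf' mg ff'; rewrite /ip /Rintegral; congr fine.
apply: ae_eq_integral => //.
- by apply/measurable_EFinP; exact: measurable_cdot.
- by apply/measurable_EFinP; exact: measurable_cdot.
by apply: filterS ff' => x + _ => ->.
Qed.

Lemma nrm0_ae f g : L2 f -> L2 g -> nrm (f \- g) = 0 -> {ae mu, forall x, f x = g x}.
Proof.
move=> f2 g2 fg; have := ip0_ae (L2B f2 g2).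
rewrite -nrm_sq fg expr0n => /(_ erefl).
by apply: filterS => x /= /subr0_eq.
Qed.

Lemma ae_nrm f g : cmeas f -> cmeas g -> {ae mu, forall x, f x = g x} ->
  nrm f = nrm g.
Proof.
move=> mf mg fg; rewrite /nrm (ae_ip mf mg mf fg) ipC (ae_ip mf mg mg fg)//.
Qed.

Lemma ae_L2 f g : L2 f -> cmeas g -> {ae mu, forall x, f x = g x} -> L2 g.
Proof.
move=> /L2P[mf fo] mg fg; apply/L2P; split => //.
rewrite (_ : (\int[mu]_x _ = \int[mu]_x (cdot (f x) (f x))%:E)%E)//.
apply: ae_eq_integral => //.
- by apply/measurable_EFinP; exact: measurable_cdot.
- by apply/measurable_EFinP; exact: measurable_cdot.
by apply: filterS fg => x + _ => ->.
Qed.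

Lemma cvg_L2P (F : nat -> fct) f : (forall n, L2 (F n)) -> L2 f ->
  cvg_L2 F f <-> nrm (F n \- f) @[n --> \oo] --> (0:R).
Proof.
move=> F2 f2; rewrite /cvg_L2.
have -> : (fun n => cLnorm 2%:E (F n \- f)) = (fun n => (nrm (F n \- f))%:E).
  by apply/funext => n; rewrite cLnorm_nrm//; exact: L2B.
split; first by move/fine_cvg.
by move=> h; apply: cvg_EFin => //; exact: nearW.
Qed.

Lemma cvg_ip (F : nat -> fct) f g : (forall n, L2 (F n)) -> L2 f -> L2 g ->
  nrm (F n \- f) @[n --> \oo] --> (0:R) -> ip (F n) g @[n --> \oo] --> ip f g.
Proof.
move=> F2 f2 g2 Ff; apply/cvgrPdist_le => e e0.
have : nrm (F n \- f) * nrm g @[n --> \oo] --> (0 : R).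
  by rewrite -(mul0r (nrm g)); apply: cvgMl.
move/cvgrPdist_le => /(_ e e0); apply: filterS => n.
rewrite sub0r normrN ger0_norm ?mulr_ge0 ?nrm_ge0//; apply: le_trans.
by rewrite -ipBl// nrm_subC ip_CS//; exact: L2B.
Qed.

Lemma cvg_nrm (F : nat -> fct) f : (forall n, L2 (F n)) -> L2 f ->
  nrm (F n \- f) @[n --> \oo] --> (0:R) -> nrm (F n) @[n --> \oo] --> nrm f.
Proof.
move=> F2 f2 Ff; apply/cvgrPdist_le => e e0.
move/cvgrPdist_le : Ff => /(_ e e0); apply: filterS => n.
rewrite sub0r normrN ger0_norm ?nrm_ge0//; apply: le_trans.
have t1 : nrm (F n) <= nrm (F n \- f) + nrm f.
  rewrite [in leLHS](_ : F n = (F n \- f) \+ f); last by apply/funext => x /=; rewrite subrK.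
  by apply: nrmD => //; exact: L2B.
have t2 : nrm f <= nrm (F n \- f) + nrm (F n).
  rewrite nrm_subC [in leLHS](_ : f = (f \- F n) \+ F n); last by apply/funext => x /=; rewrite subrK.
  by apply: nrmD => //; exact: L2B.
by rewrite ler_norml; apply/andP; split; lra.
Qed.

Lemma cvgn_summable_telescope (u : nat -> R) (C : R) : 0 <= C ->
  (forall k, `|u k.+1 - u k| <= C * 2^-1 ^+ k) -> cvgn u.
Proof.
move=> C0 uC.
have -> : u = (fun n => u 0%N + series (telescope u) n).
  by apply/funext => n; exact: eq_sum_telescope.
apply: is_cvgD; first exact: is_cvg_cst.
apply: normed_cvg; apply: (@series_le_cvg _ _ (geometric C 2^-1)) => //.
- by move=> n /=; rewrite normr_ge0.
- by move=> n /=; rewrite mulr_ge0// exprn_ge0.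
by apply: is_cvg_geometric_series; rewrite ger0_norm//; lra.
Qed.

(** Riesz-Fischer. A fast subsequence converges almost everywhere, and Fatou's lemma along it turns
    the Cauchy property into convergence in norm. *)
Lemma L2_complete (F : nat -> fct) : (forall n, L2 (F n)) ->
  (forall e : R, 0 < e -> exists N, forall m n, (N <= m)%N -> (N <= n)%N ->
     nrm (F m \- F n) <= e) ->
  exists2 f, L2 f & nrm (F n \- f) @[n --> \oo] --> (0:R).
Proof.
move=> F2 cF.
have /choice[N NP] : forall k : nat, exists N, forall m n, (N <= m)%N -> (N <= n)%N ->
    nrm (F m \- F n) <= 4^-1 ^+ k.
  by move=> k; apply: cF; rewrite exprn_gt0.
(* Summing the thresholds makes the index sequence monotone while dominating both [N k] and [k]. *)
pose phi k := (\sum_(j < k.+1) (N j).+1)%N.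
have phiN k : (N k <= phi k)%N.
  by rewrite /phi big_ord_recr /= (leq_trans (leqnSn _))// leq_addl.
have phiS k : (phi k <= phi k.+1)%N by rewrite {2}/phi big_ord_recr leq_addr.
have phik k : (k <= phi k)%N.
  elim: k => // k ih; rewrite /phi big_ord_recr /= addnS ltnS.
  by rewrite (leq_trans ih)// leq_addr.
pose D k := F (phi k.+1) \- F (phi k).
have D2 k : L2 (D k) by exact: L2B.
have Dle k : ip (D k) (D k) <= 16^-1 ^+ k.
  rewrite -nrm_sq (_ : 16^-1 = 4^-1 ^+ 2); last by field.
  rewrite exprAC lerXn2r ?nnegrE ?nrm_ge0 ?exprn_ge0//.
  by apply: NP; [rewrite (leq_trans (phiN k))|exact: phiN].
(* The weight [4 ^+ k] splits the decay 16^-k of the squared increments: the integrals still sum to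
   a finite value, and finiteness of the sum [S x] still forces |D_k x| <= sqrt(S x) 2^-k. *)
pose h k x : R := 4 ^+ k * cdot (D k x) (D k x).
have h0 k x : 0 <= h k x by rewrite mulr_ge0 ?cdot_ge0 ?exprn_ge0.
have mh k : measurable_fun setT (h k).
  by apply: measurable_funM => //; apply: measurable_cdot; exact: L2_cmeas.
pose S x := (\sum_(0 <= k <oo) (h k x)%:E)%E.
have mS : measurable_fun setT S.
  apply: ge0_emeasurable_sum => [k x _ _|k _]; first by rewrite lee_fin.
  by apply/measurable_EFinP.
have S0 x : (0 <= S x)%E by apply: nneseries_ge0 => k _ _; rewrite lee_fin.
have Soo : (\int[mu]_x S x < +oo)%E.
  rewrite integral_nneseries//; last 2 first.
    by move=> k; apply/measurable_EFinP.
    by move=> k x _; rewrite lee_fin.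
  have le1 k : (\int[mu]_x (h k x)%:E <= (4^-1 ^+ k)%:E)%E.
    under eq_integral do rewrite EFinM.
    rewrite ge0_integralZl//; last 2 first.
      by apply/measurable_EFinP; apply: measurable_cdot; exact: L2_cmeas.
      by move=> x _; rewrite lee_fin cdot_ge0.
    rewrite -ipE// -EFinM lee_fin.
    apply: (@le_trans _ _ (4 ^+ k * 16^-1 ^+ k)); first by rewrite ler_wpM2l ?exprn_ge0.
    by rewrite -exprMn (_ : 4 * 16^-1 = 4^-1 :> R)//; field.
  apply: (@le_lt_trans _ _ (\sum_(0 <= k <oo) (4^-1 ^+ k)%:E)%E).
    apply: lee_nneseries => k _; last exact: le1.
    by move=> _; apply: integral_ge0 => x _; rewrite lee_fin.
  have -> : (fun n => (\sum_(0 <= k < n) (4^-1 ^+ k)%:E)%E) = EFin \o series (geometric 1 (4^-1 : R)).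
    apply/funext => n; rewrite /= /series /= -sumEFin; apply: eq_bigr => k _.
    by rewrite /= mul1r.
  rewrite EFin_lim ?ltry//.
  by apply: is_cvg_geometric_series; rewrite ger0_norm//; lra.
pose A := [set x | (S x < +oo)%E].
have mA : measurable A.
  by rewrite -[A]setTI; exact: measurable_lte.
have AE : {ae mu, forall x, A x}.
  have iS : mu.-integrable setT S.
    apply/integrableP; split => //.
    by under eq_integral do rewrite gee0_abs//.
  apply: filterS (integrable_ae measurableT iS) => x /(_ I).
  by rewrite /A /= ge0_fin_numE.
(* Setting the subsequence to 0 where [S] is infinite makes it converge at every point, so that its
   limit is measurable. *)
pose G k x : R[i] := ((\1_A x : R)%:C)%C * F (phi k) x.
have G2 k : L2 (G k).
  apply: (@L2_bounded _ _ (\1_A) 1) => //.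
  by move=> x; rewrite indicE; case: (x \in A); rewrite ?normr1 ?normr0.
have GF k : {ae mu, forall x, F (phi k) x = G k x}.
  by apply: filterS AE => x Ax; rewrite /G indicE mem_set// rmorph1 mul1r.
have hS x k : A x -> cdot (D k x) (D k x) <= fine (S x) * 4^-1 ^+ k.
  move=> Ax; have : ((h k x)%:E <= S x)%E.
    apply: le_trans (nneseries_lim_ge k.+1 _); last first.
      by move=> n _ _; rewrite lee_fin.
    rewrite big_nat_recr//= leeDr//; apply: sume_ge0 => n _.
    by rewrite lee_fin.
  rewrite -[in X in (_ <= X)%E](@fineK _ (S x)) ?ge0_fin_numE// lee_fin /h => hk.
  by rewrite exprVn -ler_pdivrMr ?invr_gt0 ?exprn_gt0// invrK mulrC.
have cG (p : R[i] -> R) : (forall z w, p (z - w) = p z - p w) -> p 0 = 0 ->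
    (forall z, p z ^+ 2 <= cdot z z) -> forall x, cvgn (fun k => p (G k x)).
  move=> pB p0 pc x; apply: (@cvgn_summable_telescope _ (Num.sqrt (fine (S x)))).
    exact: sqrtr_ge0.
  move=> k; rewrite -pB /G; have [Ax|Ax] := pselect (A x); last first.
    by rewrite indicE memNset// !mul0r subr0 p0 normr0 mulr_ge0 ?exprn_ge0 ?sqrtr_ge0.
  rewrite indicE mem_set// !mul1r -ler_sqr ?nnegrE ?mulr_ge0 ?exprn_ge0 ?sqrtr_ge0//.
  rewrite real_normK ?num_real// (le_trans (pc _))//.
  rewrite exprMn sqr_sqrtr ?fine_ge0// exprAC (_ : 2^-1 ^+ 2 = 4^-1); last by field.
  exact: hS.
have cRe x : cvgn (fun k => complex.Re (G k x)).
  apply: cG => [[? ?] [? ?]||[a b]] //; rewrite /cdot /= -!expr2 lerDl sqr_ge0//.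
have cIm x : cvgn (fun k => complex.Im (G k x)).
  apply: cG => [[? ?] [? ?]||[a b]] //; rewrite /cdot /= -!expr2 lerDr sqr_ge0//.
pose f x : R[i] := Complex (limn (fun k => complex.Re (G k x))) (limn (fun k => complex.Im (G k x))).
have mf : cmeas f.
  split.
    by apply: (@measurable_fun_cvg _ _ _ _ (fun k x => complex.Re (G k x))) => [k|x _];
      [have [] := L2_cmeas (G2 k)|exact: cRe].
  by apply: (@measurable_fun_cvg _ _ _ _ (fun k x => complex.Im (G k x))) => [k|x _];
      [have [] := L2_cmeas (G2 k)|exact: cIm].
(* Fatou's lemma with [n] fixed, while the other index runs along the subsequence. The shift by [K]
   keeps that index beyond the Cauchy threshold. *)
have key e K : 0 <= e -> (forall m n, (K <= m)%N -> (K <= n)%N -> nrm (F m \- F n) <= e) ->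
    forall n, (K <= n)%N -> (\int[mu]_x (cdot (F n x - f x) (F n x - f x))%:E <= (e ^+ 2)%:E)%E.
  move=> e0 Ke n Kn.
  apply: (@ge0_fatou_le _ _ _ _ _ (fun k x => cdot (F n x - G (k + K)%N x) (F n x - G (k + K)%N x))) => //.
  - by move=> k; apply: measurable_cdot; apply: L2_cmeas; exact: L2B.
  - by move=> k x _; exact: cdot_ge0.
  - move=> x _; apply: (cvg_comp (addn^~ K) (fun k => cdot (F n x - G k x) (F n x - G k x))).
      exact: cvg_addnr.
    have cR : complex.Re (F n x - G k x) @[k --> \oo] --> complex.Re (F n x - f x).
      rewrite (_ : (fun k => complex.Re (F n x - G k x)) = (fun k => complex.Re (F n x) - complex.Re (G k x))).
        rewrite (_ : complex.Re (F n x - f x) = complex.Re (F n x) - limn (fun k => complex.Re (G k x))).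
          by apply: cvgB; [exact: cvg_cst|exact: cRe].
        by rewrite /f; case: (F n x).
      by apply/funext => k; case: (F n x) (G k x) => [? ?] [].
    have cI : complex.Im (F n x - G k x) @[k --> \oo] --> complex.Im (F n x - f x).
      rewrite (_ : (fun k => complex.Im (F n x - G k x)) = (fun k => complex.Im (F n x) - complex.Im (G k x))).
        rewrite (_ : complex.Im (F n x - f x) = complex.Im (F n x) - limn (fun k => complex.Im (G k x))).
          by apply: cvgB; [exact: cvg_cst|exact: cIm].
        by rewrite /f; case: (F n x).
      by apply/funext => k; case: (F n x) (G k x) => [? ?] [].
    by apply: cvgD; apply: cvgM.
  move=> k; rewrite -ipE; [|exact: L2B..]; rewrite lee_fin -nrm_sq lerXn2r ?nnegrE ?nrm_ge0//.
  rewrite -(@ae_nrm (F n \- F (phi (k + K)%N))).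
  - by apply: Ke => //; rewrite (leq_trans _ (phik _))// leq_addl.
  - by apply: L2_cmeas; exact: L2B.
  - by apply: L2_cmeas; exact: L2B.
  - by apply: filterS (GF (k + K)%N) => x /= ->.
have f2 : L2 f.
  have [K KP] := cF 1 ltr01.
  have : L2 (F K \- f).
    apply/L2P; split; first by apply: cmeasB => //; exact: L2_cmeas.
    by apply: le_lt_trans (key 1 K _ KP K _) _ => //; rewrite ltry.
  move=> /(L2B (F2 K)); rewrite (_ : F K \- _ = f)//.
  by apply/funext => x /=; rewrite opprB addrC subrK.
exists f => //; apply/cvgrPdist_le => e e0.
have [K KP] := cF e e0.
exists K => // n /= Kn; rewrite sub0r normrN ger0_norm ?nrm_ge0//.
have := key e K (ltW e0) KP n Kn.
have -> : (\int[mu]_x (cdot (F n x - f x) (F n x - f x))%:E = (ip (F n \- f) (F n \- f))%:E)%E.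
  by rewrite ipE//; exact: L2B.
by rewrite lee_fin -nrm_sq ler_sqr ?nnegrE ?nrm_ge0 ?(ltW e0).
Qed.

End L2_ae.

(** * Integrals over R and R^d *)

Section lebesgue_affine.
Context {R : realType}.
Local Notation leb := (@lebesgue_measure R).

Lemma ge0_integral_shift (f : R -> \bar R) (a : R) :
  measurable_fun setT f -> (forall x, 0 <= f x)%E ->
  (\int[leb]_x f (x + a)%R = \int[leb]_x f x)%E.
Proof.
move=> mf f0; pose T (x : measurableTypeR R) : measurableTypeR R := x + a.
have mT : measurable_fun setT T by apply: measurable_funD.
transitivity (\int[pushforward leb T]_x f x)%E.
  by rewrite ge0_integral_pushforward.
apply: eq_measure_integral => //= A mA _.
apply/esym/lebesgue_measure_unique => //= _ [[u v]] _ <-.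
rewrite /pushforward /= (_ : T @^-1` _ = `]u - a, v - a]%classic); last first.
  by apply/seteqP; split=> x /=; rewrite /T !in_itv/= ltrBlDr lerBrDr.
rewrite !lebesgue_measure_itv/= !lte_fin ltrBlDr subrK.
by case: ifPn => // _; rewrite -!EFinB; congr EFin; ring.
Qed.

(** The pushforward under the dilation, multiplied by [c], gives half-open intervals their length,
    hence is Lebesgue measure by uniqueness. *)
Lemma ge0_integral_scale (f : R -> \bar R) (c : R) : 0 < c ->
  measurable_fun setT f -> (forall x, 0 <= f x)%E ->
  (\int[leb]_x f (c * x)%R = (c^-1)%:E * \int[leb]_x f x)%E.
Proof.
move=> c0 mf f0; pose T (x : measurableTypeR R) : measurableTypeR R := c * x.
have mT : measurable_fun setT T by apply: measurable_funM.
have ci : 0 <= c^-1 by rewrite invr_ge0 ltW.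
transitivity (\int[pushforward leb T]_x f x)%E.
  by rewrite ge0_integral_pushforward.
pose m : {measure set (measurableTypeR R) -> \bar R} := mscale (NngNum ci) leb.
transitivity (\int[m]_x f x)%E; last by rewrite ge0_integral_mscale.
apply: eq_measure_integral => //= A mA _.
rewrite -[LHS]mul1e -[in LHS](@mulVf _ c) ?gt_eqF// EFinM -muleA; congr (_ * _)%E.
pose n : {measure set (measurableTypeR R) -> \bar R} :=
  mscale (NngNum (ltW c0)) (pushforward leb T).
apply/esym/(@lebesgue_measure_unique _ (n mT)) => //= _ [[u v]] _ <-.
rewrite /n /= /mscale /= /pushforward /= (_ : T @^-1` _ = `]u / c, v / c]%classic); last first.
  by apply/seteqP; split=> x /=; rewrite /T !in_itv/= ltr_pdivrMr// ler_pdivlMr// mulrC.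
rewrite !lebesgue_measure_itv/= !lte_fin ltr_pM2r ?invr_gt0//.
case: ifPn => _; last by rewrite mule0.
by rewrite -!EFinB -EFinM; congr EFin; field; rewrite gt_eqF.
Qed.

Lemma ge0_integral_reflect (f : R -> \bar R) :
  measurable_fun setT f -> (forall x, 0 <= f x)%E ->
  (\int[leb]_x f (- x)%R = \int[leb]_x f x)%E.
Proof.
move=> mf f0; pose T (x : measurableTypeR R) : measurableTypeR R := - x.
have mT : measurable_fun setT T by apply: measurable_funN.
transitivity (\int[pushforward leb T]_x f x)%E.
  by rewrite ge0_integral_pushforward.
apply: eq_measure_integral => //= A mA _; exact: lebesgue_measureN.
Qed.

End lebesgue_affine.

Lemma cvg_scale_pinfty {R : realType} (c : R) : 0 < c ->
  c * x @[x --> +oo] --> +oo.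
Proof. by move=> c0; apply: (gt0_cvgMry c0); exact: cvg_id. Qed.

(** * The Poisson kernel on the line *)

Section poissonk_kernel.
Context {R : realType}.
Local Notation leb := (@lebesgue_measure R).

(** The Fourier transform of exp(-e|x|) under the normalisation exp(-2 i pi x z). *)
Definition poissonk (e z : R) : R := 2 * e / (e ^+ 2 + (2 * pi * z) ^+ 2).

Lemma poissonk_ge0 e z : 0 < e -> 0 <= poissonk e z.
Proof.
by move=> e0; rewrite divr_ge0 ?mulr_ge0 ?(ltW e0)// addr_ge0 ?sqr_ge0.
Qed.

Lemma poissonkN e z : poissonk e (- z) = poissonk e z.
Proof. by rewrite /poissonk mulrN sqrrN. Qed.

Lemma poissonk_den_gt0 (e z : R) : 0 < e -> 0 < e ^+ 2 + (2 * pi * z) ^+ 2.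
Proof. by move=> e0; rewrite ltr_pwDl ?exprn_gt0 ?sqr_ge0. Qed.

Lemma continuous_poissonk e : 0 < e -> continuous (poissonk e).
Proof.
move=> e0 z; apply: cvgM; first exact: cvg_cst.
apply: cvgV; first by rewrite gt_eqF// poissonk_den_gt0.
apply: cvgD; first exact: cvg_cst.
apply: (@continuous_comp _ _ _ (fun z : R => 2 * pi * z) (fun x => x ^+ 2)); last exact: exprn_continuous.
by apply: cvgM; [exact: cvg_cst|exact: cvg_id].
Qed.

Lemma is_derive_atan_poissonk (e a z : R) : 0 < e ->
  is_derive z 1 (fun y => pi^-1 * atan (2 * pi / e * (y - a))) (poissonk e (z - a)).
Proof.
move=> e0.
have d1 : is_derive z (1 : R) (fun y : R => 2 * pi / e * (y - a)) (2 * pi / e).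
  by apply: is_derive_eq; rewrite ?scaler0 ?subr0 ?addr0 /GRing.scale /=; ring.
have d2 := @is_derive1_comp _ atan (fun y : R => 2 * pi / e * (y - a)) z _ _ (is_derive1_atan _) d1.
apply: is_derive_eq; rewrite /poissonk /GRing.scale /=.
have := poissonk_den_gt0 (z - a) e0; move: (pi_gt0 R).
generalize (pi : R) => q q0 h.
have h' : 0 < (e ^+ 2 + (2 * q * (z - a)) ^+ 2) by [].
by field; rewrite !gt_eqF//=.
Qed.

(** The primitive is atan(2 pi y / e) / pi, which tends to 1/2 at infinity; evenness accounts for
    the other half. *)
Lemma integral_poissonk e z : 0 < e -> (\int[leb]_y (poissonk e (z - y))%:E = 1)%E.
Proof.
move=> e0.
have mc : measurable_fun setT (EFin \o poissonk e).
  by apply/measurable_EFinP; apply: continuous_measurable_fun; exact: continuous_poissonk.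
have c0 x : (0 <= (EFin \o poissonk e) x)%E by rewrite lee_fin poissonk_ge0.
transitivity (\int[leb]_y (poissonk e y)%:E)%E.
  rewrite -(ge0_integral_shift (- z) mc c0)/=.
  by apply: eq_integral => x _; rewrite -poissonkN opprB.
rewrite ge0_symfun_integralT; [|by move=> x; exact: poissonk_ge0|exact: continuous_poissonk|
  by move=> x; rewrite /= poissonkN].
rewrite -set_itvcy.
rewrite (@ge0_continuous_FTC2y _ _ (fun y => pi^-1 * atan (2 * pi / e * (y - 0))) 0 (2^-1)).
- by rewrite subr0 mulr0 atan0 mulr0 sube0 -EFinM divff.
- by move=> x _; exact: poissonk_ge0.
- by apply: continuous_subspaceT => x; exact: continuous_poissonk.
- rewrite (_ : 2^-1 = pi^-1 * (pi / 2)); last by rewrite mulrA mulVf ?mul1r// gt_eqF// pi_gt0.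
  apply: cvgM; first exact: cvg_cst.
  apply: (@cvg_comp _ _ _ (fun y => 2 * pi / e * (y - 0)) atan _ +oo); last exact: cvgy_atan.
  under eq_fun do rewrite subr0.
  have c1 : 0 < 2 * pi / e by rewrite divr_gt0// mulr_gt0// pi_gt0.
  exact: cvg_scale_pinfty.
- by move=> x _; have [] := is_derive_atan_poissonk 0 x e0.
- apply: cvg_at_right_filter.
  have [D _] := is_derive_atan_poissonk 0 0 e0.
  by have /derivable1_diffP/differentiable_continuous := D.
- move=> x _; rewrite derive1E.
  by have /@derive_val -> := is_derive_atan_poissonk 0 x e0; rewrite subr0.
Qed.

(** The closed form matters: the limit as [e] tends to 0, needed for boxes, is read off from the
    arctangents. *)
Lemma integral_poissonk_itv e z a b : 0 < e -> a < b ->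
  (\int[leb]_(y in `]a, b]) (poissonk e (z - y))%:E =
   (pi^-1 * atan (2 * pi / e * (b - z)) - pi^-1 * atan (2 * pi / e * (a - z)))%:E)%E.
Proof.
move=> e0 ab.
have cc : continuous (fun y => poissonk e (y - z)).
  move=> y; apply: (@continuous_comp _ _ _ (fun y => y - z) (poissonk e)); last exact: continuous_poissonk.
  by apply: cvgB; [exact: cvg_id|exact: cvg_cst].
transitivity (\int[leb]_(y in `[a, b]) (poissonk e (y - z))%:E)%E.
  rewrite -integral_itv_obnd_cbnd; last first.
    by apply/measurable_EFinP/measurable_funTS; exact: continuous_measurable_fun.
  by apply: eq_integral => x _; rewrite -poissonkN opprB.
rewrite (@continuous_FTC2 _ _ (fun y => pi^-1 * atan (2 * pi / e * (y - z))))//.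
- by apply: continuous_subspaceT => x; exact: cc.
- have D x : derivable (fun y => pi^-1 * atan (2 * pi / e * (y - z))) x 1.
    by have [] := is_derive_atan_poissonk z x e0.
  split => [x _|//|//]; [exact: D| |].
    by apply: cvg_at_right_filter; have /derivable1_diffP/differentiable_continuous := D a.
  by apply: cvg_at_left_filter; have /derivable1_diffP/differentiable_continuous := D b.
- move=> x _; rewrite derive1E.
  by have /@derive_val -> := is_derive_atan_poissonk z x e0.
Qed.

End poissonk_kernel.

(** * The Fourier transform of exp(-e|x|) on the line *)

Section laplace_kernel.
Context {R : realType}.
Local Notation leb := (@lebesgue_measure R).

Definition expabs (e x : R) : R := expR (- (e * `|x|)).

Lemma expabs_ge0 e x : 0 <= expabs e x. Proof. exact: expR_ge0. Qed.

Lemma continuous_expabs e : continuous (expabs e).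
Proof.
move=> x; apply: (@continuous_comp _ _ _ (fun x => - (e * `|x|)) expR); last exact: continuous_expR.
apply: cvgN; apply: cvgM; first exact: cvg_cst.
exact: norm_continuous.
Qed.

Lemma continuous_sin_scale (c : R) : continuous (fun x : R => sin (c * x)).
Proof.
move=> x; apply: (@continuous_comp _ _ _ (fun x => c * x) sin); last exact: continuous_sin.
by apply: cvgM; [exact: cvg_cst|exact: cvg_id].
Qed.

Lemma continuous_cos_scale (c : R) : continuous (fun x : R => cos (c * x)).
Proof.
move=> x; apply: (@continuous_comp _ _ _ (fun x => c * x) cos); last exact: continuous_cos.
by apply: cvgM; [exact: cvg_cst|exact: cvg_id].
Qed.

(** A primitive of exp(-e x) (1 + cos(c x)). Adding 1 to the cosine makes the integrand nonnegative,
    as the fundamental theorem on a half-line requires; the contribution of the 1 is subtracted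
    afterwards. *)
Let prim (e c x : R) := expR (- e * x) *
  (c / (e ^+ 2 + c ^+ 2) * sin (c * x) - e / (e ^+ 2 + c ^+ 2) * cos (c * x) - e^-1).

Let is_derive_prim (e c x : R) : 0 < e ->
  is_derive x 1 (prim e c) (expR (- e * x) * (1 + cos (c * x))).
Proof.
move=> e0.
have dl (a : R) : is_derive x (1 : R) (fun y : R => a * y) a.
  by apply: is_derive_eq; rewrite ?scaler0 ?addr0 /GRing.scale /= ?mulr1.
have de := @is_derive1_comp _ expR (fun y : R => - e * y) x _ _ (is_derive_expR _) (dl (- e)).
have ds := @is_derive1_comp _ sin (fun y : R => c * y) x _ _ (is_derive_sin _) (dl c).
have dc := @is_derive1_comp _ cos (fun y : R => c * y) x _ _ (is_derive_cos _) (dl c).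
rewrite /comp in de ds dc.
rewrite /prim; apply: is_derive_eq.
rewrite /GRing.scale /= ?mulr0 ?add0r ?addr0 ?subr0.
have h : 0 < e ^+ 2 + c ^+ 2 by rewrite ltr_pwDl ?exprn_gt0 ?sqr_ge0.
by field; rewrite !gt_eqF//=.
Qed.

Let prim_cvg (e c : R) : 0 < e -> prim e c x @[x --> +oo] --> (0 : R).
Proof.
move=> e0; pose C := `|c / (e ^+ 2 + c ^+ 2)| + `|e / (e ^+ 2 + c ^+ 2)| + e^-1.
have ce : expR (- e * x) @[x --> +oo] --> (0:R).
  have H := cvg_scale_pinfty e0.
  under eq_fun do rewrite mulNr.
  apply: (@cvg_comp _ _ _ (fun x : R => e * x) (fun x : R => expR (- x)) _ _ _ H).
  exact: cvgr_expR.
have h1 : expR (- e * x) * C @[x --> +oo] --> (0:R).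
  by rewrite -(mul0r C); apply: cvgM; [exact: ce|exact: cvg_cst].
have h2 : - (expR (- e * x) * C) @[x --> +oo] --> (0:R).
  by rewrite -oppr0; exact: cvgN.
apply: (squeeze_cvgr _ h2 h1).
apply: nearW => x; rewrite -ler_norml /prim normrM ger0_norm ?expR_ge0// ler_wpM2l ?expR_ge0//.
rewrite (le_trans (ler_normB _ _))// lerD//; last by rewrite ger0_norm// invr_ge0 ltW.
rewrite (le_trans (ler_normB _ _))// lerD// normrM ler_piMr//.
  by rewrite ler_norml sin_geN1 sin_le1.
by rewrite ler_norml cos_geN1 cos_le1.
Qed.

Let integral_prim (e c : R) : 0 < e ->
  (\int[leb]_x (expabs e x * (1 + cos (c * x)))%:E =
   (2 * (e^-1 + e / (e ^+ 2 + c ^+ 2)))%:E)%E.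
Proof.
move=> e0.
have c0 x : 0 <= expabs e x * (1 + cos (c * x)).
  by rewrite mulr_ge0 ?expabs_ge0// -lerBlDl sub0r cos_geN1.
have cc : continuous (fun x => expabs e x * (1 + cos (c * x))).
  move=> x; apply: cvgM; first exact: continuous_expabs.
  by apply: cvgD; [exact: cvg_cst|exact: continuous_cos_scale].
rewrite ge0_symfun_integralT//; last first.
  by move=> x; rewrite /= /expabs normrN mulrN cosN.
rewrite -set_itvcy EFinM; congr (_ * _)%E.
transitivity (\int[leb]_(x in `[0%R, +oo[) (expR (- e * x) * (1 + cos (c * x)))%:E)%E.
  apply: eq_integral => x; rewrite inE /= in_itv /= andbT => x0.
  by rewrite /expabs ger0_norm// mulNr.
rewrite (@ge0_continuous_FTC2y _ _ (prim e c) 0 0).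
- rewrite sub0e -EFinN; congr EFin; rewrite /prim !mulr0 expR0 sin0 cos0; ring.
- by move=> x _; rewrite mulr_ge0 ?expR_ge0// -lerBlDl sub0r cos_geN1.
- apply: continuous_subspaceT => x; apply: cvgM.
    apply: (@continuous_comp _ _ _ (fun x => - e * x) expR); last exact: continuous_expR.
    by apply: cvgM; [exact: cvg_cst|exact: cvg_id].
  by apply: cvgD; [exact: cvg_cst|exact: continuous_cos_scale].
- exact: prim_cvg.
- by move=> x _; have [] := is_derive_prim c x e0.
- apply: cvg_at_right_filter; have [D _] := is_derive_prim c 0 e0.
  by have /derivable1_diffP/differentiable_continuous := D.
- by move=> x _; rewrite derive1E; have /@derive_val -> := is_derive_prim c x e0.
Qed.

Lemma measurable_expabs e : measurable_fun setT (expabs e).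
Proof. by apply: continuous_measurable_fun; exact: continuous_expabs. Qed.

Lemma integral_expabs e : 0 < e -> (\int[leb]_x (expabs e x)%:E = (2 / e)%:E)%E.
Proof.
(* At frequency 0 the factor [1 + cos] equals 2. *)
move=> e0; have := @integral_prim e 0 e0.
under eq_integral do rewrite mul0r cos0 EFinM muleC.
rewrite ge0_integralZl//; last 2 first.
  by apply/measurable_EFinP; exact: measurable_expabs.
  by move=> x _; rewrite lee_fin expabs_ge0.
move=> /(congr1 (fun z => (2^-1)%:E * z)%E).
rewrite muleA -!EFinM (_ : 2^-1 * (1 + 1) = 1) ?mul1e => [->|]; last by field.
by congr EFin; field; rewrite gt_eqF.
Qed.

Lemma integrable_expabs e : 0 < e -> leb.-integrable setT (EFin \o expabs e).
Proof.
move=> e0; apply/integrableP; split.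
  by apply/measurable_EFinP; exact: measurable_expabs.
under eq_integral do rewrite /= ger0_norm ?expabs_ge0//.
by rewrite integral_expabs// ltry.
Qed.

Lemma integrable_expabs_bounded e (g : R -> R) : 0 < e -> measurable_fun setT g ->
  (forall x, `|g x| <= 1) -> leb.-integrable setT (fun x => (expabs e x * g x)%:E).
Proof.
move=> e0 mg g1; apply: le_integrable (integrable_expabs e0) => //.
  by apply/measurable_EFinP; apply: measurable_funM => //; exact: measurable_expabs.
move=> x _; rewrite /= lee_fin normrM [leRHS]ger0_norm ?expabs_ge0//.
by rewrite ger0_norm ?expabs_ge0// ler_piMr// expabs_ge0.
Qed.

Lemma Rintegral_expabs_cos e z : 0 < e ->
  \int[leb]_x (expabs e x * cos (2 * pi * z * x)) = poissonk e z.
Proof.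
move=> e0.
have ic : leb.-integrable setT (fun x => (expabs e x * cos (2 * pi * z * x))%:E).
  apply: integrable_expabs_bounded => //.
    by apply: continuous_measurable_fun; exact: continuous_cos_scale.
  by move=> x; rewrite ler_norml cos_geN1 cos_le1.
have := integral_prim (2 * pi * z) e0.
under eq_integral do rewrite mulrDr mulr1 EFinD.
rewrite integralD//; last exact: integrable_expabs.
rewrite integral_expabs// /Rintegral -[in X in X -> _](@fineK _ (\int[leb]_x (expabs e x * cos (2 * pi * z * x))%:E)%E).
  rewrite -EFinD => -[h]; apply: (addrI (2 / e)); rewrite h /poissonk.
  by rewrite mulrDr mulrA.
exact: integrable_fin_num.
Qed.

(** Reflection exchanges the positive and negative parts of an odd integrand. *)
Lemma Rintegral_expabs_sin e z : 0 < e ->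
  \int[leb]_x (expabs e x * sin (2 * pi * z * x)) = 0.
Proof.
move=> e0; set g := fun x => _.
have mg : measurable_fun setT g.
  apply: measurable_funM; first exact: measurable_expabs.
  by apply: continuous_measurable_fun; exact: continuous_sin_scale.
have gN x : g (- x) = - g x.
  by rewrite /g /expabs normrN mulrN sinN mulrN.
have pn : (\int[leb]_x (EFin \o g)^\+ x = \int[leb]_x (EFin \o g)^\- x)%E.
  rewrite -[LHS]ge0_integral_reflect//; last exact/measurable_funepos/measurable_EFinP.
  by apply: eq_integral => x _; rewrite funeposE funenegE /= gN.
rewrite /Rintegral integralE pn subee//.
apply: integrable_neg_fin_num => //; apply: integrable_expabs_bounded => //.
  by apply: continuous_measurable_fun; exact: continuous_sin_scale.
by move=> x; rewrite ler_norml sin_geN1 sin_le1.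
Qed.

End laplace_kernel.

(** * Product measures and integrals depending on a parameter *)

Section prod_integral.
Context d1 d2 (T1 : measurableType d1) (T2 : measurableType d2) (R : realType).
Variables (m1 : {sigma_finite_measure set T1 -> \bar R})
          (m2 : {sigma_finite_measure set T2 -> \bar R}).

Lemma measurable_fun_fst (f : T1 -> R) : measurable_fun setT f ->
  measurable_fun setT (fun z : T1 * T2 => f z.1).
Proof. by move=> mf; apply: measurableT_comp => //; exact: measurable_fst. Qed.

Lemma measurable_fun_snd (f : T2 -> R) : measurable_fun setT f ->
  measurable_fun setT (fun z : T1 * T2 => f z.2).
Proof. by move=> mf; apply: measurableT_comp => //; exact: measurable_snd. Qed.

Lemma integrable_prod (p : T1 -> R) (q : T2 -> R) :
  m1.-integrable setT (EFin \o p) -> m2.-integrable setT (EFin \o q) ->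
  (m1 \x m2)%E.-integrable setT (fun z => (p z.1 * q z.2)%:E).
Proof.
move=> ip iq; have /integrableP[/measurable_EFinP mp poo] := ip.
have /integrableP[/measurable_EFinP mq qoo] := iq.
have mpq : measurable_fun setT (fun z : T1 * T2 => (p z.1 * q z.2)%:E).
  apply/measurable_EFinP; apply: measurable_funM.
    exact: measurable_fun_fst.
  exact: measurable_fun_snd.
apply: (integrable12ltyP m1 m2 mpq).2.
have -> : (fun x => \int[m2]_y `|(p x * q y)%:E|)%E = (fun x => `|(p x)%:E| * \int[m2]_y `|(q y)%:E|)%E.
  apply/funext => x; rewrite -ge0_integralZl//; last exact/measurableT_comp/measurable_EFinP.
  by apply: eq_integral => y _; rewrite EFinM abseM.
rewrite ge0_integralZr//; [|exact/measurableT_comp/measurable_EFinP|exact: integral_ge0].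
rewrite lte_mul_pinfty//; first exact: integral_ge0.
by rewrite ge0_fin_numE//; exact: integral_ge0.
Qed.

Lemma integral_prod (p : T1 -> R) (q : T2 -> R) :
  m1.-integrable setT (EFin \o p) -> m2.-integrable setT (EFin \o q) ->
  (\int[m1 \x m2]_z (p z.1 * q z.2)%:E =
   (\int[m1]_x p x * \int[m2]_y q y)%:E)%E.
Proof.
move=> ip iq; rewrite -integral12_prod_meas1; last exact: integrable_prod.
rewrite /fubini_F /=.
transitivity (\int[m1]_x ((p x)%:E * (\int[m2]_y q y)%:E))%E.
  apply: eq_integral => x _.
  under eq_integral do rewrite EFinM.
  by rewrite integralZl// /Rintegral fineK//; exact: integrable_fin_num.
by rewrite integralZr// EFinM /Rintegral !fineK//; exact: integrable_fin_num.
Qed.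

(** Tonelli gives measurability for the positive and the negative part separately, so no
    integrability has to be checked before the integral is known to be measurable. *)
Lemma measurable_param_integral (g : T1 * T2 -> \bar R) : measurable_fun setT g ->
  measurable_fun setT (fun x => \int[m2]_y g (x, y))%E.
Proof.
move=> mg; under eq_fun do rewrite integralE.
apply: emeasurable_funB.
  rewrite (_ : (fun _ => _) = fubini_F m2 g^\+%E).
    by apply: measurable_fun_fubini_tonelli_F => //; exact: measurable_funepos.
  by apply/funext => x; apply: eq_integral => y _; rewrite !funeposE.
rewrite (_ : (fun _ => _) = fubini_F m2 g^\-%E).
  by apply: measurable_fun_fubini_tonelli_F => //; exact: measurable_funeneg.
by apply/funext => x; apply: eq_integral => y _; rewrite !funenegE.
Qed.

End prod_integral.

(** * Integration over tuples, one coordinate at a time *)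

Section tuple_integral.
Context {R : realType}.
Local Notation leb := (@lebesgue_measure R).

(** [lebesgue_Rd n.+1] is by construction the pushforward of a product measure, so a change of
    variables followed by Tonelli peels off the first coordinate. *)
Lemma ge0_integral_RdS n (f : Rd R n.+1 -> \bar R) : measurable_fun setT f ->
  (forall v, 0 <= f v)%E ->
  (\int[lebesgue_Rd n.+1]_v f v =
   \int[leb]_x \int[lebesgue_Rd n]_w f (cons_pair (x, w)))%E.
Proof.
move=> mf f0.
have mc := @measurable_cons_pair R n.
transitivity (\int[(leb \x lebesgue_Rd n)%E]_z f (cons_pair z))%E.
  transitivity (\int[pushforward (leb \x lebesgue_Rd n)%E (@cons_pair R n)]_v f v)%E.
    exact: eq_measure_integral.
  by rewrite ge0_integral_pushforward.
rewrite fubini_tonelli1//.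
exact: measurableT_comp.
Qed.

Lemma integral_RdS n (f : Rd R n.+1 -> \bar R) : measurable_fun setT f ->
  (leb \x lebesgue_Rd n)%E.-integrable setT (f \o @cons_pair R n) ->
  (\int[lebesgue_Rd n.+1]_v f v = \int[(leb \x lebesgue_Rd n)%E]_z f (cons_pair z))%E /\
  (lebesgue_Rd n.+1).-integrable setT f.
Proof.
move=> mf fi.
have mc := @measurable_cons_pair R n.
have e1 (g : Rd R n.+1 -> \bar R) : (\int[lebesgue_Rd n.+1]_v g v =
   \int[pushforward (leb \x lebesgue_Rd n)%E (@cons_pair R n)]_v g v)%E.
  exact: eq_measure_integral.
split; first by rewrite e1 integral_pushforward.
apply/integrableP; split=> //; rewrite e1 ge0_integral_pushforward//; last first.
  exact: measurableT_comp.
by have /integrableP[] := fi.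
Qed.

Lemma tnth_cons_pair0 n (x : R) (w : Rd R n) : tnth (cons_pair (x, w)) ord0 = x.
Proof. by []. Qed.

Lemma tnth_cons_pairS n (x : R) (w : Rd R n) i :
  tnth (cons_pair (x, w)) (lift ord0 i) = tnth w i.
Proof. by rewrite /cons_pair tnthS. Qed.

Lemma measurable_tuple_prod n (g : 'I_n -> R -> R) :
  (forall i, measurable_fun setT (g i)) ->
  measurable_fun setT (fun v : Rd R n => \prod_(i < n) g i (tnth v i)).
Proof.
move=> mg; apply: measurable_prod => i _.
by apply: (measurableT_comp (mg i)); exact: measurable_tnth.
Qed.

Lemma integral_tuple_prod n (g : 'I_n -> R -> R) (c : 'I_n -> R) :
  (forall i, measurable_fun setT (g i)) -> (forall i x, 0 <= g i x) ->
  (forall i, (\int[leb]_x (g i x)%:E = (c i)%:E)%E) ->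
  (\int[lebesgue_Rd n]_v (\prod_(i < n) g i (tnth v i))%:E =
   (\prod_(i < n) c i)%:E)%E.
Proof.
elim: n g c => [|n ih] g c mg g0 gc.
  rewrite (eq_integral (fun=> 1%E)); last by move=> v _; rewrite big_ord0.
  by rewrite big_ord0 integral_cst// mul1e /= diracT.
rewrite ge0_integral_RdS; last 2 first.
  by apply/measurable_EFinP; exact: measurable_tuple_prod.
  by move=> v; rewrite lee_fin prodr_ge0.
have c0 : 0 <= \prod_(i < n) c (lift ord0 i).
  by apply: prodr_ge0 => i _; rewrite -lee_fin -gc; apply: integral_ge0 => x _; rewrite lee_fin.
transitivity (\int[leb]_x ((g ord0 x)%:E * (\prod_(i < n) c (lift ord0 i))%:E))%E.
  apply: eq_integral => x _.
  rewrite -(ih (fun i => g (lift ord0 i)))// -ge0_integralZl//.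
  - apply: eq_integral => w _; rewrite -EFinM big_ord_recl tnth_cons_pair0.
    by congr (_ * _)%:E; apply: eq_bigr => i _; rewrite tnth_cons_pairS.
  - by apply/measurable_EFinP; apply: (@measurable_tuple_prod n (fun i => g (lift ord0 i))).
  - by move=> w _; rewrite lee_fin prodr_ge0.
  - by rewrite lee_fin.
rewrite ge0_integralZr//.
- by rewrite gc big_ord_recl EFinM.
- by apply/measurable_EFinP; exact: mg.
- by move=> x _; rewrite lee_fin.
Qed.

Definition dotf n (z : 'I_n -> R) (v : Rd R n) : R := \sum_(i < n) z i * tnth v i.

Lemma measurable_dotf n (z : 'I_n -> R) : measurable_fun setT (dotf z).
Proof.
apply: measurable_sum => i; apply: measurable_funM => //; exact: measurable_tnth.
Qed.

(** This is exp(-e |v|_1). The l^1 norm is preferred to the Euclidean one because the function, and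
    with it its Fourier transform, then factors over the coordinates. *)
Definition expabsn (e : R) n (v : Rd R n) : R := \prod_(i < n) expabs e (tnth v i).

Lemma expabsn_ge0 e n (v : Rd R n) : 0 <= expabsn e v.
Proof. by apply: prodr_ge0 => i _; exact: expabs_ge0. Qed.

Lemma measurable_expabsn e n : measurable_fun setT (@expabsn e n).
Proof. by apply: (@measurable_tuple_prod n (fun=> expabs e)) => i; exact: measurable_expabs. Qed.

Lemma integrable_expabsn e n : 0 < e ->
  (lebesgue_Rd n).-integrable setT (EFin \o @expabsn e n).
Proof.
move=> e0; apply/integrableP; split.
  by apply/measurable_EFinP; exact: measurable_expabsn.
under eq_integral do rewrite /= ger0_norm ?expabsn_ge0//.
rewrite (@integral_tuple_prod n (fun=> expabs e) (fun=> 2 / e)) ?ltry//.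
- by move=> i; exact: measurable_expabs.
- by move=> i x; exact: expabs_ge0.
- by move=> i; exact: integral_expabs.
Qed.

Lemma integrable_expabsn_bounded e n (g : Rd R n -> R) : 0 < e ->
  measurable_fun setT g -> (forall x, `|g x| <= 1) ->
  (lebesgue_Rd n).-integrable setT (fun x => (expabsn e x * g x)%:E).
Proof.
move=> e0 mg g1; apply: le_integrable (integrable_expabsn n e0) => //.
  by apply/measurable_EFinP; apply: measurable_funM => //; exact: measurable_expabsn.
move=> x _; rewrite /= lee_fin normrM [leRHS]ger0_norm ?expabsn_ge0//.
by rewrite ger0_norm ?expabsn_ge0// ler_piMr// expabsn_ge0.
Qed.

Lemma measurable_cosf d (X : measurableType d) (f : X -> R) :
  measurable_fun setT f -> measurable_fun setT (fun x => cos (f x)).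
Proof.
by move=> mf; apply: (measurableT_comp _ mf); apply: continuous_measurable_fun; exact: continuous_cos.
Qed.

Lemma measurable_sinf d (X : measurableType d) (f : X -> R) :
  measurable_fun setT f -> measurable_fun setT (fun x => sin (f x)).
Proof.
by move=> mf; apply: (measurableT_comp _ mf); apply: continuous_measurable_fun; exact: continuous_sin.
Qed.

Lemma normr_cos_le1 (x : R) : `|cos x| <= 1.
Proof. by rewrite ler_norml cos_geN1 cos_le1. Qed.

Lemma normr_sin_le1 (x : R) : `|sin x| <= 1.
Proof. by rewrite ler_norml sin_geN1 sin_le1. Qed.

(** Both integrals are treated in one induction, since the addition formulas for a split frequency
    mix them. The terms containing a sine integral vanish, which leaves the product of the cosine
    integrals. *)
Lemma Rintegral_expabsn_cos_sin e n (z : 'I_n -> R) : 0 < e ->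
  \int[lebesgue_Rd n]_v (expabsn e v * cos (2 * pi * dotf z v)) =
    \prod_(i < n) poissonk e (z i) /\
  \int[lebesgue_Rd n]_v (expabsn e v * sin (2 * pi * dotf z v)) = 0.
Proof.
move=> e0; elim: n z => [|n ih] z.
  rewrite /expabsn /dotf !big_ord0; split.
    transitivity (\int[lebesgue_Rd 0]_v (1 : R)).
      by apply: eq_Rintegral => v _; rewrite !big_ord0 mulr0 cos0 mulr1.
    by rewrite Rintegral_cst// mul1r -[RHS]/(fine 1%E); congr fine; exact: diracT.
  transitivity (\int[lebesgue_Rd 0]_v (0 : R)).
    by apply: eq_Rintegral => v _; rewrite !big_ord0 mulr0 sin0 mulr0.
  by rewrite Rintegral_cst// mul0r.
have [ihc ihs] := ih (fun i => z (lift ord0 i)).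
have dE x w : 2 * pi * dotf z (cons_pair (x, w)) =
    2 * pi * z ord0 * x + 2 * pi * dotf (fun i => z (lift ord0 i)) w.
  rewrite /dotf big_ord_recl tnth_cons_pair0 mulrDr mulrA; congr (_ + _ * _).
  by apply: eq_bigr => i _; rewrite tnth_cons_pairS.
have EE x w : expabsn e (cons_pair (x, w)) = expabs e x * expabsn e w.
  rewrite /expabsn big_ord_recl tnth_cons_pair0; congr (_ * _).
  by apply: eq_bigr => i _; rewrite tnth_cons_pairS.
pose p1 x : R := expabs e x * cos (2 * pi * z ord0 * x).
pose p2 x : R := expabs e x * sin (2 * pi * z ord0 * x).
pose q1 w := expabsn e w * cos (2 * pi * dotf (fun i => z (lift ord0 i)) w).
pose q2 w := expabsn e w * sin (2 * pi * dotf (fun i => z (lift ord0 i)) w).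
have ip1 : leb.-integrable setT (EFin \o p1).
  apply: integrable_expabs_bounded => //; last by move=> x; exact: normr_cos_le1.
  by apply: continuous_measurable_fun; exact: continuous_cos_scale.
have ip2 : leb.-integrable setT (EFin \o p2).
  apply: integrable_expabs_bounded => //; last by move=> x; exact: normr_sin_le1.
  by apply: continuous_measurable_fun; exact: continuous_sin_scale.
have md k (y : 'I_k -> R) : measurable_fun setT (fun v => 2 * pi * dotf y v).
  by apply: measurable_funM => //; exact: measurable_dotf.
have iq1 : (lebesgue_Rd n).-integrable setT (EFin \o q1).
  apply: integrable_expabsn_bounded => //; last by move=> x; exact: normr_cos_le1.
  by apply: measurable_cosf; exact: md.
have iq2 : (lebesgue_Rd n).-integrable setT (EFin \o q2).
  apply: integrable_expabsn_bounded => //; last by move=> x; exact: normr_sin_le1.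
  by apply: measurable_sinf; exact: md.
have cE : (fun y => (expabsn e (cons_pair y) * cos (2 * pi * dotf z (cons_pair y)))%:E) =
    (fun y => (p1 y.1 * q1 y.2)%:E - (p2 y.1 * q2 y.2)%:E)%E.
  by apply/funext => -[x w]; rewrite dE EE cosD -EFinB; congr EFin; rewrite /p1 /q1 /p2 /q2 /=; ring.
have sE : (fun y => (expabsn e (cons_pair y) * sin (2 * pi * dotf z (cons_pair y)))%:E) =
    (fun y => (p2 y.1 * q1 y.2)%:E + (p1 y.1 * q2 y.2)%:E)%E.
  by apply/funext => -[x w]; rewrite dE EE sinD -EFinD; congr EFin; rewrite /p1 /q1 /p2 /q2 /=; ring.
split; rewrite /Rintegral.
  rewrite (integral_RdS _ _).1; last 2 first.
  - apply/measurable_EFinP; apply: measurable_funM; first exact: measurable_expabsn.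
    by apply: measurable_cosf; exact: md.
  - rewrite [X in _.-integrable _ X]cE; apply: integrableB => //; exact: integrable_prod.
  rewrite cE integralB//; [|exact: integrable_prod..].
  rewrite !integral_prod// -EFinB /= ihc ihs mulr0 subr0 Rintegral_expabs_cos//.
  by rewrite big_ord_recl.
rewrite (integral_RdS _ _).1; last 2 first.
- apply/measurable_EFinP; apply: measurable_funM; first exact: measurable_expabsn.
  by apply: measurable_sinf; exact: md.
- rewrite [X in _.-integrable _ X]sE; apply: integrableD => //; exact: integrable_prod.
rewrite sE integralD//; [|exact: integrable_prod..].
by rewrite !integral_prod// -EFinD /= ihc ihs mulr0 Rintegral_expabs_sin// mul0r addr0.
Qed.

End tuple_integral.

(** * The Fourier transform of integrable functions *)

Section complex_extra.
Context {R : rcfType}.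
Implicit Types z w : R[i].

Lemma cdot_conj z w : cdot z (conjc w) = cdot w (conjc z).
Proof. by case: z w => [a b] [c d]; rewrite /cdot /=; ring. Qed.

Lemma cdot_conj_mul z w v : cdot (z * w) (conjc v) = cdot (v * w) (conjc z).
Proof. by case: z w v => [a b] [c d] [x y]; rewrite /cdot /=; ring. Qed.

(** The factors 1/2 matter here, unlike in [ler_cdot]: they produce the constant 1 in [damped_le],
    hence a contraction. *)
Lemma ler_cdot_half z w : `|cdot z w| <= 2^-1 * cdot z z + 2^-1 * cdot w w.
Proof.
case: z w => [a b] [c d]; rewrite /cdot /= ler_norml; apply/andP; split;
  have := sqr_ge0 (a + c); have := sqr_ge0 (b + d); have := sqr_ge0 (a - c);
  have := sqr_ge0 (b - d); nra.
Qed.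

Lemma ler_cdot_abs z w : `|cdot z w| <=
  (`|complex.Re z| + `|complex.Im z|) * (`|complex.Re w| + `|complex.Im w|).
Proof.
rewrite /cdot (le_trans (ler_normD _ _))// !normrM mulrDl !mulrDr.
by rewrite addrA lerD// -addrA lerDl addr_ge0// mulr_ge0.
Qed.

End complex_extra.

Lemma integrable_scale d (T : measurableType d) (R : realType)
    (m : {measure set T -> \bar R}) (D : set T) (p : T -> R) (c : R) : measurable D ->
  m.-integrable D (EFin \o p) -> m.-integrable D (EFin \o (fun x => c * p x)).
Proof.
move=> mD ip; rewrite (_ : EFin \o _ = (fun x => c%:E * (p x)%:E)%E)//.
exact: integrableZl.
Qed.

Section L1.
Context {R : realType} {d : nat}.
Local Notation mu := (lebesgue_Rd d : {sigma_finite_measure set (Rd R d) -> \bar R}).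
Local Notation fct := (Rd R d -> R[i]).
Implicit Types f g h : fct.
Notation L1 := (cLfun 1%:E).

Definition cint d' (T : measurableType d') (m : {measure set T -> \bar R}) (f : T -> R[i]) :=
  m.-integrable setT (fun x => (complex.Re (f x))%:E) /\
  m.-integrable setT (fun x => (complex.Im (f x))%:E).

Lemma cint_cmeas f : cint mu f -> cmeas f.
Proof.
by move=> [/measurable_int/measurable_EFinP f1 /measurable_int/measurable_EFinP f2].
Qed.

(** The l^1 norm on the complex plane is equivalent to the modulus and avoids square roots; it is
    used for domination only, where constants are immaterial. *)
Definition cabs1 f x : R := `|complex.Re (f x)| + `|complex.Im (f x)|.

Lemma cint_cabs1 f : cint mu f -> mu.-integrable setT (EFin \o cabs1 f).
Proof.
move=> [f1 f2]; rewrite (_ : EFin \o cabs1 f =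
  (fun x => `|(complex.Re (f x))%:E| + `|(complex.Im (f x))%:E|))%E//.
by apply: integrableD => //; exact: integrable_abse.
Qed.

Lemma measurable_cabs1 f : cmeas f -> measurable_fun setT (cabs1 f).
Proof. by move=> [f1 f2]; apply: measurable_funD; exact: measurableT_comp. Qed.

Lemma cabs1_ge0 f x : 0 <= cabs1 f x. Proof. by rewrite addr_ge0. Qed.

Lemma le_cint f (b : Rd R d -> R) : cmeas f -> mu.-integrable setT (EFin \o b) ->
  (forall x, cabs1 f x <= b x) -> cint mu f.
Proof.
move=> [f1 f2] ib fb; split; apply: le_integrable ib => //.
- by apply/measurable_EFinP.
- move=> x _; rewrite /= lee_fin (le_trans _ (ler_norm _))//.
  by rewrite (le_trans _ (fb x))// lerDl.
- by apply/measurable_EFinP.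
- move=> x _; rewrite /= lee_fin (le_trans _ (ler_norm _))//.
  by rewrite (le_trans _ (fb x))// lerDr.
Qed.

Lemma normc_bounds (z : R[i]) : `|complex.Re z| <= ComplexField.Normc.normc z /\
  `|complex.Im z| <= ComplexField.Normc.normc z /\
  ComplexField.Normc.normc z <= `|complex.Re z| + `|complex.Im z|.
Proof.
case: z => a b /=; split; [|split].
- by rewrite -sqrtr_sqr ler_wsqrtr// lerDl sqr_ge0.
- by rewrite -[leLHS]sqrtr_sqr ler_wsqrtr// lerDr sqr_ge0.
rewrite -[leRHS]ger0_norm ?addr_ge0// -sqrtr_sqr ler_wsqrtr//.
rewrite sqrrD !real_normK ?num_real//; have : 0 <= `|a| * `|b| by rewrite mulr_ge0.
lra.
Qed.

Lemma L1P f : L1 f <-> cint mu f.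
Proof.
have nE : cLnorm 1%:E f = (\int[mu]_x (ComplexField.Normc.normc (f x))%:E)%E.
  rewrite /cLnorm Lnorm1; apply: eq_integral => x _ /=.
  by rewrite ger0_norm//; case: (f x) => a b; exact: sqrtr_ge0.
have mn : cmeas f -> measurable_fun setT (fun x => ComplexField.Normc.normc (f x)).
  move=> [f1 f2]; rewrite (_ : (fun _ => _) = (fun x => Num.sqrt (cdot (f x) (f x)))).
    apply: (measurableT_comp _ (measurable_cdot (conj f1 f2) (conj f1 f2))).
    by apply: continuous_measurable_fun; exact: sqrt_continuous.
  by apply/funext => x; case: (f x) => a b; rewrite /cdot /= -!expr2.
split=> [[f1 f2]|fi].
  rewrite nE => fo; split.
    apply/integrableP; split; first by apply/measurable_EFinP.
    apply: le_lt_trans fo; apply: ge0_le_integral => //.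
    - by apply: measurableT_comp => //; apply/measurable_EFinP.
    - by apply/measurable_EFinP; exact: mn.
    by move=> x _; rewrite /= lee_fin; have [] := normc_bounds (f x).
  apply/integrableP; split; first by apply/measurable_EFinP.
  apply: le_lt_trans fo; apply: ge0_le_integral => //.
  - by apply: measurableT_comp => //; apply/measurable_EFinP.
  - by apply/measurable_EFinP; exact: mn.
  by move=> x _; rewrite /= lee_fin; have [_ []] := normc_bounds (f x).
have [f1 f2] := cint_cmeas fi; split=> //; rewrite nE.
have /integrableP[_] := cint_cabs1 fi; apply: le_lt_trans.
apply: ge0_le_integral => //.
- by move=> x _; rewrite lee_fin; case: (f x) => a b; exact: sqrtr_ge0.
- by apply/measurable_EFinP; exact: mn.
- by apply: measurableT_comp => //; apply/measurable_EFinP; exact: measurable_cabs1.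
move=> x _; rewrite /= lee_fin ger0_norm ?cabs1_ge0//.
by have [_ []] := normc_bounds (f x).
Qed.

Lemma cdot_cintegral f w : cint mu f ->
  mu.-integrable setT (fun x => (cdot (f x) w)%:E) /\
  \int[mu]_x cdot (f x) w = cdot (cintegral f) w.
Proof.
move=> [f1 f2].
have i1 : mu.-integrable setT (fun x => (complex.Re (f x) * complex.Re w)%:E).
  by under eq_fun do rewrite EFinM; exact: integrableZr.
have i2 : mu.-integrable setT (fun x => (complex.Im (f x) * complex.Im w)%:E).
  by under eq_fun do rewrite EFinM; exact: integrableZr.
split; first by apply: (integrableD measurableT i1 i2).
by rewrite /cdot RintegralD// !RintegralZr.
Qed.

(** A rotation does not preserve the l^1 norm; the factor 2 is crude, but only integrability is at
    stake. *)
Lemma cabs1_expci z (t : R) : `|complex.Re (z * expci t)| + `|complex.Im (z * expci t)| <=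
  2 * (`|complex.Re z| + `|complex.Im z|).
Proof.
case: z => a b /=; have := normr_cos_le1 t; have := normr_sin_le1 t => s1 c1.
have ac : `|a * cos t| <= `|a| by rewrite normrM ler_piMr.
have as' : `|a * sin t| <= `|a| by rewrite normrM ler_piMr.
have bc : `|b * cos t| <= `|b| by rewrite normrM ler_piMr.
have bs : `|b * sin t| <= `|b| by rewrite normrM ler_piMr.
have := ler_normB (a * cos t) (b * sin t); have := ler_normD (a * sin t) (b * cos t).
lra.
Qed.

Lemma dotRdC (x y : Rd R d) : dotRd x y = dotRd y x.
Proof. by apply: eq_bigr => i _; rewrite mulrC. Qed.

Lemma measurable_dotRd2 : measurable_fun setT (fun z : Rd R d * Rd R d => dotRd z.1 z.2).
Proof.
apply: measurable_sum => i; apply: measurable_funM.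
  exact: (measurableT_comp (measurable_tnth i) measurable_fst).
exact: (measurableT_comp (measurable_tnth i) measurable_snd).
Qed.

Definition phase (x y : Rd R d) : R := - (2 * pi * dotRd x y).

Lemma phaseC x y : phase x y = phase y x. Proof. by rewrite /phase dotRdC. Qed.

Lemma measurable_phase2 : measurable_fun setT (fun z : Rd R d * Rd R d => phase z.1 z.2).
Proof. by apply: measurable_funN; apply: measurable_funM => //; exact: measurable_dotRd2. Qed.

Lemma cmeasM d' (T : measurableType d') (f g : T -> R[i]) : cmeas f -> cmeas g ->
  cmeas (fun x => f x * g x).
Proof.
move=> [f1 f2] [g1 g2]; split.
  rewrite (_ : (fun _ => _) = (fun x => complex.Re (f x) * complex.Re (g x) - complex.Im (f x) * complex.Im (g x))).
    by apply: measurable_funB; exact: measurable_funM.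
  by apply/funext => x; case: (f x) (g x) => [? ?] [].
rewrite (_ : (fun _ => _) = (fun x => complex.Re (f x) * complex.Im (g x) + complex.Im (f x) * complex.Re (g x))).
  by apply: measurable_funD; exact: measurable_funM.
by apply/funext => x; case: (f x) (g x) => [? ?] [].
Qed.

Lemma cmeas_conj d' (T : measurableType d') (f : T -> R[i]) : cmeas f ->
  cmeas (fun x => conjc (f x)).
Proof.
move=> [f1 f2]; split.
  rewrite (_ : (fun _ => _) = (fun x => complex.Re (f x)))//.
  by apply/funext => x; case: (f x).
rewrite (_ : (fun _ => _) = (fun x => - complex.Im (f x))); first exact: measurable_funN.
by apply/funext => x; case: (f x).
Qed.

Lemma cmeas_expci d' (T : measurableType d') (t : T -> R) : measurable_fun setT t ->
  cmeas (fun x => expci (t x)).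
Proof. by move=> mt; split; [exact: measurable_cosf|exact: measurable_sinf]. Qed.

Lemma cmeas_comp d' d'' (T : measurableType d') (U : measurableType d'') (f : U -> R[i]) (h : T -> U) :
  cmeas f -> measurable_fun setT h -> cmeas (f \o h).
Proof.
by move=> [f1 f2] mh; split; [exact: (measurableT_comp f1 mh)|exact: (measurableT_comp f2 mh)].
Qed.

Lemma measurable_phase x : measurable_fun setT (phase x).
Proof.
apply: measurable_funN; apply: measurable_funM => //.
apply: measurable_sum => i; apply: measurable_funM => //; exact: measurable_tnth.
Qed.

Lemma cint_expci f (t : Rd R d -> R) : measurable_fun setT t -> cint mu f ->
  cint mu (fun x => f x * expci (t x)).
Proof.
move=> mt fi; apply: (@le_cint _ (fun x => 2 * cabs1 f x)).
- by apply: cmeasM; [exact: cint_cmeas|exact: cmeas_expci].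
- by apply: integrable_scale => //; exact: cint_cabs1.
- by move=> x; exact: cabs1_expci.
Qed.

Lemma fourier_L1_cdot f xi w : cint mu f ->
  mu.-integrable setT (fun x => (cdot (f x * expci (phase xi x)) w)%:E) /\
  \int[mu]_x cdot (f x * expci (phase xi x)) w = cdot (fourier_L1 f xi) w.
Proof.
by move=> fi; apply: cdot_cintegral; apply: cint_expci => //; exact: measurable_phase.
Qed.

Lemma cmeas_fourier_L1 f : cint mu f -> cmeas (fourier_L1 f).
Proof.
move=> fi; have mf := cint_cmeas fi.
have [m1 m2] : cmeas (fun z : Rd R d * Rd R d => f z.2 * expci (phase z.1 z.2)).
  apply: cmeasM; first by apply: (cmeas_comp mf); exact: measurable_snd.
  by apply: cmeas_expci; exact: measurable_phase2.
split.
  apply: (measurableT_comp (f := fine)) => //.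
  by apply: (@measurable_param_integral _ _ _ _ _ (lebesgue_Rd d)
    (fun z => (_ (f z.2 * expci (phase z.1 z.2)))%:E)); apply/measurable_EFinP.
apply: (measurableT_comp (f := fine)) => //.
by apply: (@measurable_param_integral _ _ _ _ _ (lebesgue_Rd d)
    (fun z => (_ (f z.2 * expci (phase z.1 z.2)))%:E)); apply/measurable_EFinP.
Qed.

Lemma fourier_L1_bounded f : cint mu f -> exists C, forall xi, cabs1 (fourier_L1 f) xi <= C.
Proof.
move=> fi; exists (2 * \int[mu]_x (2 * cabs1 f x)) => xi.
have [i1 i2] := cint_expci (measurable_phase xi) fi.
have ib : mu.-integrable setT (EFin \o (fun x => 2 * cabs1 f x)).
  by apply: integrable_scale => //; exact: cint_cabs1.
have h (g : Rd R d -> R) : mu.-integrable setT (EFin \o g) ->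
    (forall x, `|g x| <= 2 * cabs1 f x) ->
    `|\int[mu]_x g x| <= \int[mu]_x (2 * cabs1 f x).
  move=> gi gb; rewrite (le_trans (le_normr_Rintegral _ _))//.
  apply: le_Rintegral => //.
  by rewrite (_ : EFin \o _ = abse \o (EFin \o g))//; exact: integrable_abse.
rewrite mulrDl !mul1r lerD//; apply: h => // x; apply: le_trans (cabs1_expci _ (phase xi x)).
  by rewrite lerDl.
by rewrite lerDr.
Qed.

(* Both sides are the double integral of Re (f x * g xi * exp (-2 i pi x.xi)). *)
Lemma fourier_L1_mult f g : cint mu f -> cint mu g ->
  ip (fourier_L1 f) (fun x => conjc (g x)) = ip f (fun x => conjc (fourier_L1 g x)).
Proof.
move=> fi gi; have mf := cint_cmeas fi; have mg := cint_cmeas gi.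
pose H (z : Rd R d * Rd R d) := cdot (f z.2 * expci (phase z.1 z.2)) (conjc (g z.1)).
have mH : measurable_fun setT H.
  apply: measurable_cdot.
    apply: cmeasM; first by apply: (cmeas_comp mf); exact: measurable_snd.
    by apply: cmeas_expci; exact: measurable_phase2.
  by apply: (cmeas_comp (cmeas_conj mg)); exact: measurable_fst.
have iH : (mu \x mu)%E.-integrable setT (EFin \o H).
  have := @integrable_prod _ _ _ _ _ mu mu (fun x => 2 * cabs1 g x) (cabs1 f).
  have ig : mu.-integrable setT (EFin \o (fun x => 2 * cabs1 g x)).
    by apply: integrable_scale => //; exact: cint_cabs1.
  move=> /(_ ig (cint_cabs1 fi)); apply: le_integrable => //.
    by apply/measurable_EFinP.
  move=> [xi x] _; rewrite /= lee_fin (le_trans _ (ler_norm _))//.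
  rewrite /H /= (le_trans (ler_cdot_abs _ _))//.
  rewrite [leRHS]mulrAC; apply: ler_pM; rewrite ?addr_ge0//; first exact: cabs1_expci.
  by rewrite /cabs1; case: (g xi) => a b /=; rewrite normrN.
transitivity (fine (\int[mu]_xi \int[mu]_x (H (xi, x))%:E)%E).
  congr fine; apply: eq_integral => xi _.
  have [i1 i2] := fourier_L1_cdot xi (conjc (g xi)) fi.
  by rewrite -i2 /Rintegral fineK//; exact: integrable_fin_num.
rewrite (@Fubini _ _ _ _ _ mu mu (EFin \o H) iH) /=.
congr fine; apply: eq_integral => x _.
have [i1 i2] := fourier_L1_cdot x (conjc (f x)) gi.
transitivity (cdot (fourier_L1 g x) (conjc (f x)))%:E; last by rewrite cdot_conj.
rewrite -i2 /Rintegral fineK//; last exact: integrable_fin_num.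
by apply: eq_integral => xi _; rewrite /H /= cdot_conj_mul phaseC.
Qed.

End L1.
Notation L1 := (cLfun 1%:E).

(** * Plancherel's theorem *)

Section plancherel.
Context {R : realType} {d : nat}.
Local Notation mu := (lebesgue_Rd d : {sigma_finite_measure set (Rd R d) -> \bar R}).
Local Notation fct := (Rd R d -> R[i]).
Implicit Types f g h : fct.

Definition poissonn (e : R) (x y : Rd R d) : R :=
  \prod_(i < d) poissonk e (tnth x i - tnth y i).

Lemma poissonn_ge0 e x y : 0 < e -> 0 <= poissonn e x y.
Proof. by move=> e0; apply: prodr_ge0 => i _; exact: poissonk_ge0. Qed.

Lemma poissonnC e x y : poissonn e x y = poissonn e y x.
Proof. by apply: eq_bigr => i _; rewrite -poissonkN opprB. Qed.

Lemma measurable_poissonk e : 0 < e -> measurable_fun setT (@poissonk R e).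
Proof. by move=> e0; apply: continuous_measurable_fun; exact: continuous_poissonk. Qed.

Lemma measurable_poissonn2 e : 0 < e ->
  measurable_fun setT (fun z : Rd R d * Rd R d => poissonn e z.1 z.2).
Proof.
move=> e0; apply: measurable_prod => i _.
apply: (measurableT_comp (measurable_poissonk e0)); apply: measurable_funB.
  exact: (measurableT_comp (measurable_tnth i) measurable_fst).
exact: (measurableT_comp (measurable_tnth i) measurable_snd).
Qed.

Lemma measurable_poissonn e x : 0 < e -> measurable_fun setT (poissonn e x).
Proof.
move=> e0; apply: (@measurable_tuple_prod _ _ (fun i y => poissonk e (tnth x i - y))) => i.
by apply: (measurableT_comp (measurable_poissonk e0)); apply: measurable_funB.
Qed.

Lemma integral_poissonn e x : 0 < e -> (\int[mu]_y (poissonn e x y)%:E = 1)%E.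
Proof.
move=> e0; rewrite (@integral_tuple_prod _ _ (fun i y => poissonk e (tnth x i - y)) (fun=> 1)).
- by rewrite big1.
- by move=> i; apply: (measurableT_comp (measurable_poissonk e0)); apply: measurable_funB.
- by move=> i y; exact: poissonk_ge0.
- by move=> i; rewrite integral_poissonk.
Qed.

Lemma cint_expabsn e (c : R[i]) (t : Rd R d -> R) : 0 < e -> measurable_fun setT t ->
  cint mu (fun xi => (expabsn e xi)%:C%C * (c * expci (t xi))).
Proof.
move=> e0 mt; apply: (@le_cint _ _ _ (fun xi => (2 * (`|complex.Re c| + `|complex.Im c|)) * expabsn e xi)).
- apply: cmeasZ; first exact: measurable_expabsn.
  by apply: cmeasM; [split; exact: measurable_cst|exact: cmeas_expci].
- by apply: integrable_scale => //; exact: integrable_expabsn.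
- move=> xi; rewrite /cabs1 mulrC; have := cabs1_expci c (t xi).
  case: (c * expci (t xi)) => a b /= h.
  rewrite !mulr0 subr0 add0r !normrM (ger0_norm (expabsn_ge0 _ _)) -mulrDl.
  by rewrite ler_wpM2r// expabsn_ge0.
Qed.

(** Modulating by a character translates the transform, so the damped character at [x] is sent to
    the Poisson kernel centred at [x]. The symmetry of [expabsn] makes the sine part vanish. *)
Lemma fourier_L1_expabsn e (c : R[i]) x y : 0 < e ->
  fourier_L1 (fun xi => (expabsn e xi)%:C%C * (c * expci (2 * pi * dotRd x xi))) y =
  (poissonn e x y)%:C%C * c.
Proof.
move=> e0.
pose z i := tnth x i - tnth y i.
have [hc hs] := @Rintegral_expabsn_cos_sin _ e d z e0.
have ic : mu.-integrable setT (EFin \o (fun v => expabsn e v * cos (2 * pi * dotf z v))).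
  apply: integrable_expabsn_bounded => //; last by move=> v; exact: normr_cos_le1.
  by apply: measurable_cosf; apply: measurable_funM => //; exact: measurable_dotf.
have is' : mu.-integrable setT (EFin \o (fun v => expabsn e v * sin (2 * pi * dotf z v))).
  apply: integrable_expabsn_bounded => //; last by move=> v; exact: normr_sin_le1.
  by apply: measurable_sinf; apply: measurable_funM => //; exact: measurable_dotf.
have E v : (expabsn e v)%:C%C * (c * expci (2 * pi * dotRd x v)) * expci (- (2 * pi * dotRd y v)) =
    (expabsn e v)%:C%C * (c * expci (2 * pi * dotf z v)).
  have -> : dotf z v = dotRd x v - dotRd y v.
    by rewrite /dotf /dotRd -sumrB; apply: eq_bigr => i _; rewrite mulrBl.
  have -> : expci (2 * pi * (dotRd x v - dotRd y v)) =
      expci (2 * pi * dotRd x v) * expci (- (2 * pi * dotRd y v)).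
    rewrite mulrBr /expci cosB sinB cosN sinN; apply/eqP; rewrite eq_complex /=.
    by apply/andP; split; apply/eqP; ring.
  by rewrite !mulrA.
transitivity (cintegral (fun v => (expabsn e v)%:C%C * (c * expci (2 * pi * dotf z v)))).
  by congr cintegral; apply/funext => v; exact: E.
rewrite /cintegral; case: c {E} => a b; apply/eqP; rewrite eq_complex /=.
apply/andP; split; apply/eqP.
  transitivity (\int[mu]_v (a * (expabsn e v * cos (2 * pi * dotf z v)) - b * (expabsn e v * sin (2 * pi * dotf z v)))).
    by apply: eq_Rintegral => v _; ring.
  rewrite RintegralB//; [|exact: integrable_scale..].
  by rewrite !RintegralZl// hc hs /poissonn /z; ring.
transitivity (\int[mu]_v (a * (expabsn e v * sin (2 * pi * dotf z v)) + b * (expabsn e v * cos (2 * pi * dotf z v)))).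
  by apply: eq_Rintegral => v _; ring.
rewrite RintegralD//; [|exact: integrable_scale..].
by rewrite !RintegralZl// hc hs /poissonn /z; ring.
Qed.

(** The transform of an integrable function is bounded but need not be integrable; damping restores
    integrability, so that the multiplication formula can be applied to it. *)
Lemma cint_damped e f : 0 < e -> cint mu f ->
  cint mu (fun xi => (expabsn e xi)%:C%C * conjc (fourier_L1 f xi)).
Proof.
move=> e0 fi; have [C CP] := fourier_L1_bounded fi.
apply: (@le_cint _ _ _ (fun xi => C * expabsn e xi)).
- apply: cmeasZ; first exact: measurable_expabsn.
  by apply: cmeas_conj; exact: cmeas_fourier_L1.
- by apply: integrable_scale => //; exact: integrable_expabsn.
- move=> xi; have := CP xi; rewrite /cabs1.
  case: (fourier_L1 f xi) => a b /= h.
  rewrite !mul0r subr0 addr0 !normrM (ger0_norm (expabsn_ge0 _ _)) -mulrDr normrN mulrC.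
  by rewrite ler_wpM2r// expabsn_ge0.
Qed.

(** The multiplication formula is applied to [f] and the damped character [k] at [x], whose
    transform is the Poisson kernel at [x] times conj (f x). *)
Lemma fourier_L1_damped e f x : 0 < e -> cint mu f ->
  cdot (f x) (conjc (fourier_L1 (fun xi => (expabsn e xi)%:C%C * conjc (fourier_L1 f xi)) x)) =
  \int[mu]_y (poissonn e x y * cdot (f y) (f x)).
Proof.
move=> e0 fi; set g := fun xi => _.
have gi : cint mu g by exact: cint_damped.
have [_ ge] := fourier_L1_cdot x (conjc (f x)) gi.
rewrite cdot_conj -ge.
pose k xi : R[i] := (expabsn e xi)%:C%C * (conjc (f x) * expci (2 * pi * dotRd x xi)).
have ki : cint mu k.
  apply: cint_expabsn => //; apply: measurable_funM => //.
  apply: measurable_sum => i; apply: measurable_funM => //; exact: measurable_tnth.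
have -> : \int[mu]_xi cdot (g xi * expci (phase x xi)) (conjc (f x)) =
    ip (fourier_L1 f) (fun xi => conjc (k xi)).
  apply: eq_Rintegral => xi _; rewrite /g /k /phase /expci cosN sinN.
  case: (fourier_L1 f xi) (f x) => [a b] [p q]; rewrite /cdot /=; ring.
rewrite fourier_L1_mult//; apply: eq_Rintegral => y _.
rewrite fourier_L1_expabsn//; case: (f x) (f y) => [a b] [p q]; rewrite /cdot /=; ring.
Qed.

(* Summability-kernel form of Plancherel: exp(-e|xi|) is the Fourier transform
   of the Poisson kernel. *)
Lemma damped_plancherel e f : 0 < e -> cint mu f ->
  \int[mu]_xi (expabsn e xi * cdot (fourier_L1 f xi) (fourier_L1 f xi)) =
  \int[mu]_x (\int[mu]_y (poissonn e x y * cdot (f y) (f x))).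
Proof.
move=> e0 fi.
transitivity (ip (fourier_L1 f) (fun xi => conjc ((expabsn e xi)%:C%C * conjc (fourier_L1 f xi)))).
  apply: eq_Rintegral => xi _.
  by case: (fourier_L1 f xi) => [a b]; rewrite /cdot /=; ring.
rewrite fourier_L1_mult//; last exact: cint_damped.
by apply: eq_Rintegral => x _; exact: fourier_L1_damped.
Qed.

Lemma cmeas_damped e f : 0 < e -> cint mu f ->
  measurable_fun setT (fun x => \int[mu]_y (poissonn e x y * cdot (f y) (f x))).
Proof.
move=> e0 fi; under eq_fun do rewrite -fourier_L1_damped//.
apply: measurable_cdot; first exact: cint_cmeas.
by apply: cmeas_conj; apply: cmeas_fourier_L1; exact: cint_damped.
Qed.

Lemma integrable_damped_fourier e f : 0 < e -> cint mu f ->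
  mu.-integrable setT (EFin \o (fun xi => expabsn e xi * cdot (fourier_L1 f xi) (fourier_L1 f xi))).
Proof.
move=> e0 fi; have [C CP] := fourier_L1_bounded fi.
apply: (@le_integrable _ _ _ _ setT measurableT _ (EFin \o (fun xi => (C * C) * expabsn e xi))).
- apply/measurable_EFinP; apply: measurable_funM; first exact: measurable_expabsn.
  by apply: measurable_cdot; exact: cmeas_fourier_L1.
- move=> xi _; rewrite /= lee_fin mulrC !normrM.
  rewrite ler_pM//; rewrite (le_trans (ler_cdot_abs _ _))//.
  have := CP xi; rewrite /cabs1 => h.
  by rewrite (ger0_norm (le_trans _ h))// ler_pM// addr_ge0.
- by apply: integrable_scale => //; exact: integrable_expabsn.
Qed.

(** Schur's test: the Poisson kernel is symmetric, nonnegative and of integral 1 in each variable,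
    so its quadratic form is bounded by the squared norm, uniformly in [e]. *)
Lemma damped_le e f : 0 < e -> cint mu f -> L2 f ->
  (\int[mu]_xi (expabsn e xi * cdot (fourier_L1 f xi) (fourier_L1 f xi))%:E <= (ip f f)%:E)%E.
Proof.
move=> e0 fi f2; have mf := L2_cmeas f2.
have c0 x : 0 <= cdot (f x) (f x) by exact: cdot_ge0.
have mc : measurable_fun setT (fun x => cdot (f x) (f x)) by exact: measurable_cdot.
have mP2 := measurable_poissonn2 e0.
rewrite -(fineK (integrable_fin_num measurableT (integrable_damped_fourier e0 fi))).
rewrite -[X in X%:E]/(\int[mu]_xi (expabsn e xi * cdot (fourier_L1 f xi) (fourier_L1 f xi))).
rewrite damped_plancherel//.
(* The two halves of the arithmetic-geometric bound on the integrand. The first is integrated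
   directly in [y]; the second has the same double integral by Tonelli and the symmetry of the
   kernel. *)
pose q1 (z : Rd R d * Rd R d) : R := 2^-1 * (poissonn e z.1 z.2 * cdot (f z.1) (f z.1)).
pose q2 (z : Rd R d * Rd R d) : R := 2^-1 * (poissonn e z.1 z.2 * cdot (f z.2) (f z.2)).
have q10 z : 0 <= q1 z by rewrite mulr_ge0// mulr_ge0// poissonn_ge0.
have q20 z : 0 <= q2 z by rewrite mulr_ge0// mulr_ge0// poissonn_ge0.
have mq1 : measurable_fun setT q1.
  by do 2 apply: measurable_funM => //; apply: (measurableT_comp mc measurable_fst).
have mq2 : measurable_fun setT q2.
  by do 2 apply: measurable_funM => //; apply: (measurableT_comp mc measurable_snd).
have ipE' := ipE f2 f2.
have I1 : (\int[mu]_x \int[mu]_y (q1 (x, y))%:E = 2^-1%:E * (ip f f)%:E)%E.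
  rewrite ipE' -ge0_integralZl//; last 2 first.
    by apply/measurable_EFinP.
    by move=> x _; rewrite lee_fin.
  apply: eq_integral => x _; rewrite /q1 /=.
  under eq_integral do rewrite mulrCA EFinM muleC.
  rewrite ge0_integralZl//; last 3 first.
    by apply/measurable_EFinP; exact: measurable_poissonn.
    by move=> y _; rewrite lee_fin poissonn_ge0.
    by rewrite lee_fin mulr_ge0.
  by rewrite integral_poissonn// mule1 EFinM.
have I2 : (\int[mu]_x \int[mu]_y (q2 (x, y))%:E = 2^-1%:E * (ip f f)%:E)%E.
  transitivity (\int[mu]_y \int[mu]_x (q2 (x, y))%:E)%E.
    apply: (@fubini_tonelli _ _ _ _ _ mu mu (EFin \o q2)).
      by apply/measurable_EFinP.
    by move=> z; rewrite lee_fin.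
  rewrite -I1; apply: eq_integral => x _; apply: eq_integral => y _.
  by rewrite /= /q1 /q2 /= poissonnC.
apply: (@le_trans _ _ (\int[mu]_x (\int[mu]_y (q1 (x, y))%:E + \int[mu]_y (q2 (x, y))%:E))%E); last first.
  rewrite ge0_integralD//; last 4 first.
  - by move=> x _; apply: integral_ge0 => y _; rewrite lee_fin.
  - by apply: (@measurable_fun_fubini_tonelli_F _ _ _ _ _ mu (EFin \o q1)) => //; exact/measurable_EFinP.
  - by move=> x _; apply: integral_ge0 => y _; rewrite lee_fin.
  - by apply: (@measurable_fun_fubini_tonelli_F _ _ _ _ _ mu (EFin \o q2)) => //; exact/measurable_EFinP.
  by rewrite I1 I2 -EFinM -EFinD lee_fin; lra.
apply: (@le_trans _ _ (\int[mu]_x `|(\int[mu]_y (poissonn e x y * cdot (f y) (f x)))%:E|)%E).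
  rewrite /Rintegral.
  (* If the outer integral is not finite, the real-valued integral is 0 by default and the bound is
     trivial. *)
  have [|] := boolP ((\int[mu]_x (\int[mu]_y (poissonn e x y * cdot (f y) (f x)))%:E)%E \is a fin_num).
    move=> /fineK ->; rewrite (le_trans (lee_abs _))// le_abse_integral//.
    by apply/measurable_EFinP; exact: cmeas_damped.
  move=> nf; rewrite /Rintegral in nf; have -> : fine (\int[mu]_x (fine (\int[mu]_y (poissonn e x y * cdot (f y) (f x))%:E))%:E)%E = 0.
    by case: (\int[mu]_x _)%E nf.
  by apply: integral_ge0.
apply: ge0_le_integral => //.
- by apply: measurableT_comp => //; apply/measurable_EFinP; exact: cmeas_damped.
- apply: emeasurable_funD.
    by apply: (@measurable_fun_fubini_tonelli_F _ _ _ _ _ mu (EFin \o q1)) => //; exact/measurable_EFinP.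
  by apply: (@measurable_fun_fubini_tonelli_F _ _ _ _ _ mu (EFin \o q2)) => //; exact/measurable_EFinP.
move=> x _.
have mq (q : Rd R d * Rd R d -> R) : measurable_fun setT q -> measurable_fun setT (fun y => (q (x, y))%:E).
  by move=> mq; apply/measurable_EFinP; exact: (measurableT_comp mq (measurable_pair1 x)).
rewrite -ge0_integralD//; last 4 first.
- by move=> y _; rewrite lee_fin.
- exact: mq.
- by move=> y _; rewrite lee_fin.
- exact: mq.
have mr : measurable_fun setT (fun y => (poissonn e x y * cdot (f y) (f x))%:E).
  apply/measurable_EFinP; apply: measurable_funM; first exact: measurable_poissonn.
  by apply: measurable_cdot => //; split; exact: measurable_cst.
apply: (@le_trans _ _ (\int[mu]_y `|(poissonn e x y * cdot (f y) (f x))%:E|)%E).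
  rewrite (le_trans _ (le_abse_integral _ _ mr))//.
  have aux (t : \bar R) : (`|(fine t)%:E| <= `|t|)%E by case: t => //=; rewrite normr0 leey.
  exact: aux.
apply: ge0_le_integral => //.
- by apply: measurableT_comp.
- by apply: emeasurable_funD; exact: mq.
move=> y _; rewrite -EFinD /= lee_fin /q1 /q2 /= normrM (ger0_norm (poissonn_ge0 _ _ e0)).
have := ler_cdot_half (f y) (f x); have := poissonn_ge0 x y e0; nra.
Qed.

End plancherel.

Lemma integral_indic_itv {R : realType} (a b : R) : a < b ->
  (\int[lebesgue_measure]_x (\1_(`]a, b]%classic) x)%:E = (b - a)%:E)%E.
Proof.
move=> ab; rewrite integral_indic// setIT.
transitivity (lebesgue_measure (`]a, b]%classic : set R)) => //.
by rewrite lebesgue_measure_itv/= lte_fin ab -EFinB.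
Qed.

(** * Boxes as a generating family closed under intersection *)

Section boxes.
Context {R : realType} {d : nat}.
Local Notation mu := (lebesgue_Rd d : {sigma_finite_measure set (Rd R d) -> \bar R}).

Definition box (a b : 'I_d -> R) : set (Rd R d) :=
  [set v | forall i, a i < tnth v i <= b i].

Definition boxes : set (set (Rd R d)) := [set B | exists a b, B = box a b].

Definition cube (n : nat) : set (Rd R d) := box (fun=> - n%:R) (fun=> n%:R).

Lemma measurable_box a b : measurable (box a b).
Proof.
rewrite (_ : box a b = \bigcap_(i in [set: 'I_d])
    ((fun v : Rd R d => tnth v i) @^-1` (`]a i, b i]%classic : set (measurableTypeR R)))).
  apply: fin_bigcap_measurable => [|i _]; first exact: finite_finset.
  by rewrite -[X in measurable X]setTI; exact: measurable_tnth.
apply/seteqP; split=> v /= vB i; first by move=> _; have := vB i; rewrite /= in_itv.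
by have := vB i I; rewrite /= in_itv.
Qed.

Lemma boxI a b a' b' : box a b `&` box a' b' =
  box (fun i => Num.max (a i) (a' i)) (fun i => Num.min (b i) (b' i)).
Proof.
apply/seteqP; split=> v /=.
  move=> [h h'] i; have /andP[h1 h2] := h i; have /andP[h3 h4] := h' i.
  by rewrite gt_max le_min h1 h2 h3 h4.
move=> h; split=> i; have := h i; rewrite gt_max le_min.
  by move=> /andP[/andP[-> _] /andP[-> _]].
by move=> /andP[/andP[_ ->] /andP[_ ->]].
Qed.

Lemma setI_closed_boxes : setI_closed boxes.
Proof. by move=> _ _ [a [b ->]] [a' [b' ->]]; rewrite boxI; eexists; eexists. Qed.

Lemma mem_cube (v : Rd R d) : exists N, forall n, (N <= n)%N -> cube n v.
Proof.
pose M := \sum_(i < d) `|tnth v i|.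
have M0 : 0 <= M by apply: sumr_ge0.
exists (Num.truncn M).+1 => n Nn i.
have : `|tnth v i| < n%:R.
  apply: (@le_lt_trans _ _ M).
    by rewrite /M (bigD1 i)//= lerDl sumr_ge0.
  by rewrite (lt_le_trans (truncnS_gt M))// ler_nat.
by rewrite ltr_norml => /andP[-> /ltW ->].
Qed.

(** The preimage of an interval under a coordinate is a slab, that is, the increasing union of the
    boxes whose other sides are ]-n, n]. *)
Lemma measurable_boxes : @measurable _ (Rd R d) = <<s boxes >>.
Proof.
apply/seteqP; split; last first.
  apply: smallest_sub; first exact: sigma_algebra_measurable.
  by move=> _ [a [b ->]]; exact: measurable_box.
apply: smallest_sub; first exact: smallest_sigma_algebra.
elim/big_ind: _ => [|X Y hX hY|k _ _ [B mB <-]]; [exact: sub0set|by rewrite subUset|].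
pose coor (v : g_sigma_algebraType boxes) : measurableTypeR R := @tnth d R v k.
have mcoor : measurable_fun setT coor.
  apply: (measurability (@ocitv R)) => //.
  move=> _ [_ [[p q] _ <-] <-]; rewrite setTI /=.
  rewrite (_ : coor @^-1` _ = \bigcup_n (box (fun j => if j == k then p else - n%:R)
      (fun j => if j == k then q else n%:R))).
    apply: bigcup_measurable => n _.
    by apply: sub_sigma_algebra; eexists; eexists.
  apply/seteqP; split=> v /=.
    rewrite in_itv /= => pq.
    have [N NP] := mem_cube v; exists N => // j.
    case: eqP => [->//|_]; exact: NP.
  by move=> [n _ /(_ k)]; rewrite eqxx in_itv.
by have := mcoor measurableT B mB.
Qed.

Definition boxind (a b : 'I_d -> R) (v : Rd R d) : R :=
  \prod_(i < d) \1_(`]a i, b i]%classic) (tnth v i).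

Lemma boxindE a b v : boxind a b v = \1_(box a b) v.
Proof.
rewrite /boxind indicE; case: (pselect (box a b v)) => [vB|vB].
  rewrite mem_set// big1// => i _; rewrite indicE mem_set//=.
  by rewrite in_itv; exact: vB.
rewrite memNset//; have /existsNP[i iP] := vB.
by rewrite (bigD1 i)//= indicE memNset ?mul0r//= in_itv.
Qed.

Lemma boxind_ge0 a b v : 0 <= boxind a b v.
Proof. by rewrite boxindE indicE. Qed.

Lemma measurable_indic_itv (a b : R) : measurable_fun setT (\1_(`]a, b]%classic) : R -> R).
Proof. exact: measurable_indic. Qed.

Lemma measurable_boxind a b : measurable_fun setT (boxind a b).
Proof.
by apply: (@measurable_tuple_prod _ _ (fun i => \1_(`]a i, b i]%classic))) => i; exact: measurable_indic_itv.
Qed.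

Lemma integral_boxind a b : (forall i, a i < b i) ->
  (\int[mu]_v (boxind a b v)%:E = (\prod_(i < d) (b i - a i))%:E)%E.
Proof.
move=> ab; rewrite (@integral_tuple_prod _ _ (fun i => \1_(`]a i, b i]%classic)) (fun i => b i - a i))//.
by move=> i; rewrite integral_indic_itv.
Qed.

End boxes.

(** * Poisson smoothing of the indicator of an interval *)

Section poisson_interval.
Context {R : realType}.
Local Notation leb := (@lebesgue_measure R).

(** The convolution of the indicator of ]a, b] with the Poisson kernel, evaluated at [x]. *)
Definition poisson_itv (e a b x : R) : R :=
  pi^-1 * atan (2 * pi / e * (b - x)) - pi^-1 * atan (2 * pi / e * (a - x)).

Lemma measurable_poisson_itv e a b : measurable_fun setT (poisson_itv e a b).
Proof.
have h c : measurable_fun setT (fun x : R => pi^-1 * atan (2 * pi / e * (c - x))).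
  apply: measurable_funM => //; apply: (measurableT_comp (f := atan)).
    by apply: continuous_measurable_fun => x; exact: continuous_atan.
  by apply: measurable_funM => //; apply: measurable_funB.
exact: measurable_funB.
Qed.

Lemma poisson_itv_bounds e a b x : 0 < e -> a < b -> 0 <= poisson_itv e a b x <= 1.
Proof.
move=> e0 ab; have h := integral_poissonk_itv x e0 ab.
rewrite -!lee_fin /poisson_itv -h; apply/andP; split.
  by apply: integral_ge0 => y _; rewrite lee_fin poissonk_ge0.
rewrite -(integral_poissonk x e0); apply: ge0_subset_integral => //.
- apply/measurable_EFinP; apply: (measurableT_comp (f := poissonk e)).
    by apply: continuous_measurable_fun; exact: continuous_poissonk.
  by apply: measurable_funB.
- by move=> y _; rewrite lee_fin poissonk_ge0.
Qed.

Lemma cvg_atan_scale (c : R) : 0 < c ->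
  pi^-1 * atan (2 * pi / n.+1%:R^-1 * c) @[n --> \oo] --> (2^-1 : R).
Proof.
move=> c0; rewrite (_ : 2^-1 = pi^-1 * (pi / 2)); last by rewrite mulrA mulVf ?mul1r// gt_eqF// pi_gt0.
apply: cvgM; first exact: cvg_cst.
have H : 2 * pi / n.+1%:R^-1 * c @[n --> \oo] --> +oo.
  rewrite (_ : (fun n : nat => _) = (fun n => 2 * pi * c * n.+1%:R)); last first.
    by apply/funext => n; rewrite invrK mulrAC.
  have p0 : 0 < 2 * pi * c by rewrite mulr_gt0// mulr_gt0// pi_gt0.
  apply: (@cvg_comp _ _ _ (fun n : nat => n.+1%:R) (fun x : R => 2 * pi * c * x) _ _ _ _ (cvg_scale_pinfty p0)).
  rewrite (_ : (fun n => n.+1%:R) = (fun n => (n + 1)%N%:R)); last first.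
    by apply/funext => n; rewrite addn1.
  have := @cvgr_idn R; rewrite -(cvg_shiftn 1).
  exact.
apply: (@cvg_comp _ _ _ (fun n : nat => 2 * pi / n.+1%:R^-1 * c) atan _ _ _ H).
exact: cvgy_atan.
Qed.

Lemma cvg_poisson_itv a b x : a < x < b ->
  poisson_itv n.+1%:R^-1 a b x @[n --> \oo] --> (1 : R).
Proof.
move=> /andP[ax xb]; 
suff : poisson_itv n.+1%:R^-1 a b x @[n --> \oo] --> (2^-1 - - 2^-1 : R).
  by rewrite (_ : 2^-1 - - 2^-1 = 1 :> R)//; field.
apply: cvgB; first by apply: cvg_atan_scale; rewrite subr_gt0.
under eq_fun do rewrite -opprB mulrN atanN mulrN.
by apply: cvgN; apply: cvg_atan_scale; rewrite subr_gt0.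
Qed.

(** The one-dimensional factor of the double Poisson integral of a box indicator; it should tend to
    the length of the side. *)
Definition poisson_itv2 (e a b : R) : R :=
  \int[leb]_x (\1_(`]a, b]%classic) x * poisson_itv e a b x).

Lemma poisson_itv2E e a b : 0 < e -> a < b ->
  (\int[leb]_x (\1_(`]a, b]%classic) x * poisson_itv e a b x)%:E = (poisson_itv2 e a b)%:E)%E.
Proof.
move=> e0 ab; rewrite /poisson_itv2 /Rintegral fineK// ge0_fin_numE; last first.
  by apply: integral_ge0 => x _; rewrite lee_fin mulr_ge0//; have /andP[] := poisson_itv_bounds x e0 ab.
apply: (@le_lt_trans _ _ (\int[leb]_x (\1_(`]a, b]%classic) x)%:E)%E).
  apply: ge0_le_integral => //.
  - by move=> x _; rewrite lee_fin mulr_ge0//; have /andP[] := poisson_itv_bounds x e0 ab.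
  - apply/measurable_EFinP; apply: measurable_funM; first exact: measurable_indic_itv.
    exact: measurable_poisson_itv.
  - by apply/measurable_EFinP; exact: measurable_indic_itv.
  - by move=> x _; rewrite lee_fin ler_piMr//; have /andP[] := poisson_itv_bounds x e0 ab.
by rewrite integral_indic_itv// ltry.
Qed.

Lemma cvg_poisson_itv2 a b : a < b ->
  poisson_itv2 n.+1%:R^-1 a b @[n --> \oo] --> b - a.
Proof.
move=> ab; apply: fine_cvg.
have -> : ((b - a)%:E = \int[leb]_x (\1_(`]a, b[%classic) x)%:E)%E.
  rewrite integral_indic// setIT.
  transitivity (lebesgue_measure (`]a, b[%classic : set R)) => //.
  by rewrite lebesgue_measure_itv/= lte_fin ab -EFinB.
have e0 n : 0 < (n.+1%:R^-1 : R) by rewrite invr_gt0.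
have H := @dominated_convergence _ _ _ leb setT measurableT
  (fun n x => (\1_(`]a, b]%classic) x * poisson_itv n.+1%:R^-1 a b x)%:E)
  (fun x => (\1_(`]a, b[%classic) x)%:E) (fun x => (\1_(`]a, b]%classic) x)%:E).
have [|||||_ _] := H; last exact.
- move=> n; apply/measurable_EFinP; apply: measurable_funM; first exact: measurable_indic_itv.
  exact: measurable_poisson_itv.
- by apply/measurable_EFinP; exact: measurable_indic.
(* At [b] the smoothed indicator tends to 1/2, so convergence to the indicator of the open interval
   fails there. At [a] the half-open indicator is already 0, hence one exceptional point. *)
- exists [set b]; split; [exact: measurable_set1|exact: lebesgue_measure_set1|].
  move=> x /= /not_implyP[_]; apply: contra_notP => /eqP xb.
  apply: cvg_EFin; first exact: nearW.
  rewrite !indicE; case: (pselect (a < x < b)) => [axb|axb].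
    rewrite !mem_set ?in_itv//=; last by rewrite in_itv/=; have /andP[-> /ltW] := axb.
    under eq_fun do rewrite mul1r; exact: cvg_poisson_itv.
  rewrite !memNset/= ?in_itv//=.
    by under eq_fun do rewrite mul0r; exact: cvg_cst.
  by move=> /andP[ax xb']; apply: axb; rewrite ax lt_neqAle xb.
- apply/integrableP; split; first by apply/measurable_EFinP; exact: measurable_indic_itv.
  under eq_integral do rewrite /= ger0_norm//.
  by rewrite integral_indic_itv// ltry.
- apply: aeW => x n _; rewrite /= lee_fin normrM !ger0_norm//; last first.
    by have /andP[] := poisson_itv_bounds x (e0 n) ab.
  by rewrite ler_piMr//; have /andP[] := poisson_itv_bounds x (e0 n) ab.
Qed.

End poisson_interval.

Lemma cvg_prod_ord {R : realType} n (u : 'I_n -> nat -> R) (l : 'I_n -> R) :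
  (forall i, u i k @[k --> \oo] --> l i) ->
  \prod_(i < n) u i k @[k --> \oo] --> \prod_(i < n) l i.
Proof.
elim: n u l => [|n ih] u l ul.
  by under eq_fun do rewrite big_ord0; rewrite big_ord0; exact: cvg_cst.
under eq_fun do rewrite big_ord_recl; rewrite big_ord_recl.
by apply: cvgM => //; apply: (ih (fun i => u (lift ord0 i)) (fun i => l (lift ord0 i))).
Qed.

Lemma expabsn_le1 {R : realType} n (e : R) (v : Rd R n) : 0 <= e -> expabsn e v <= 1.
Proof.
move=> e0; apply: (@le_trans _ _ (\prod_(i < n) (1 : R))); last by rewrite big1.
apply: ler_prod => i _; rewrite expabs_ge0/= -expR0 ler_expR oppr_le0.
by rewrite mulr_ge0.
Qed.

(** Read [u = |f|^2], [v = |g|^2], [w = <f, g>] and [z = <F f, F g>]: the contraction property for f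
    + t g loses its diagonal terms when [f] and [g] are isometric. *)
Lemma psd_aux {R : realFieldType} (u v w z t : R) :
  u + 2 * (t * z) + t * (t * v) <= u + 2 * (t * w) + t * (t * v) ->
  0 <= 0 + 2 * t * (w - z) + t ^+ 2 * 0.
Proof. lra. Qed.

(** * Contraction on L^1 and L^2 functions, and equality on boxes *)

Section isometry.
Context {R : realType} {d : nat}.
Local Notation mu := (lebesgue_Rd d : {sigma_finite_measure set (Rd R d) -> \bar R}).
Local Notation fct := (Rd R d -> R[i]).
Local Notation F := (@fourier_L1 R d).
Implicit Types f g h : fct.

Lemma cintD f g : cint mu f -> cint mu g -> cint mu (f \+ g).
Proof.
move=> fi gi; apply: (@le_cint _ _ _ (fun x => cabs1 f x + cabs1 g x)).
- by apply: cmeasD; exact: cint_cmeas.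
- by apply: (integrableD measurableT (cint_cabs1 fi) (cint_cabs1 gi)).
- move=> x; rewrite /cabs1 /=; case: (f x) (g x) => [a b] [p q] /=.
  by rewrite addrACA lerD// ler_normD.
Qed.

Lemma cintM (c : R[i]) f : cint mu f -> cint mu (fun x => c * f x).
Proof.
move=> fi; apply: (@le_cint _ _ _ (fun x => (`|complex.Re c| + `|complex.Im c|) * cabs1 f x)).
- by apply: cmeasM; [split; exact: measurable_cst|exact: cint_cmeas].
- by apply: integrable_scale => //; exact: cint_cabs1.
- move=> x; rewrite /cabs1; case: c (f x) => [a b] [p q] /=.
  have := ler_normB (a * p) (b * q); have := ler_normD (a * q) (b * p).
  rewrite !normrM; lra.
Qed.

Lemma cintegralD f g : cint mu f -> cint mu g ->
  cintegral (f \+ g) = cintegral f + cintegral g.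
Proof.
move=> [f1 f2] [g1 g2]; apply/eqP; rewrite eq_complex /cintegral /=.
apply/andP; split; apply/eqP; rewrite -RintegralD//; apply: eq_Rintegral => x _ /=;
  by case: (f x) (g x) => [? ?] [].
Qed.

Lemma cintegralM (c : R[i]) f : cint mu f ->
  cintegral (fun x => c * f x) = c * cintegral f.
Proof.
move=> [f1 f2]; apply/eqP; rewrite eq_complex /cintegral; case: c => a b /=.
apply/andP; split; apply/eqP; rewrite -!RintegralZl//.
  rewrite -RintegralB//; [|exact: integrable_scale..].
  by apply: eq_Rintegral => x _; case: (f x).
rewrite -RintegralD//; [|exact: integrable_scale..].
by apply: eq_Rintegral => x _; case: (f x).
Qed.

Lemma fourier_L1D f g : cint mu f -> cint mu g -> F (f \+ g) = F f \+ F g.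
Proof.
move=> fi gi; apply/funext => xi; rewrite /fourier_L1 /= -cintegralD; last 2 first.
- by apply: cint_expci => //; exact: measurable_phase.
- by apply: cint_expci => //; exact: measurable_phase.
by congr cintegral; apply/funext => x /=; rewrite mulrDl.
Qed.

Lemma fourier_L1M (c : R[i]) f : cint mu f -> F (fun x => c * f x) = fun xi => c * F f xi.
Proof.
move=> fi; apply/funext => xi; rewrite /fourier_L1 /= -cintegralM; last first.
  by apply: cint_expci => //; exact: measurable_phase.
by congr cintegral; apply/funext => x /=; rewrite mulrA.
Qed.

Lemma fourier_L1B f g : cint mu f -> cint mu g -> F (f \- g) = F f \- F g.
Proof.
move=> fi gi; rewrite subZE fourier_L1D//; last exact: cintM.
by rewrite fourier_L1M// -subZE.
Qed.

Lemma cintB f g : cint mu f -> cint mu g -> cint mu (f \- g).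
Proof. by move=> fi gi; rewrite subZE; apply: cintD => //; apply: cintM. Qed.

(** Removes the damping from [damped_le] by Fatou's lemma along e = 1/(n+1). *)
Lemma fourier_L1_contraction f : cint mu f -> L2 f ->
  L2 (F f) /\ nrm (F f) <= nrm f.
Proof.
move=> fi f2.
have h : (\int[mu]_xi (cdot (F f xi) (F f xi))%:E <= (ip f f)%:E)%E.
  apply: (@ge0_fatou_le _ _ _ _ _ (fun n xi => expabsn (n.+1%:R^-1) xi * cdot (F f xi) (F f xi))) => //.
  - move=> n; apply: measurable_funM; first exact: measurable_expabsn.
    by apply: measurable_cdot; exact: cmeas_fourier_L1.
  - by move=> n x _; rewrite mulr_ge0 ?expabsn_ge0 ?cdot_ge0.
  - move=> xi _; rewrite -[X in _ --> X]mul1r; apply: cvgMl.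
    suff : expabsn n.+1%:R^-1 xi @[n --> \oo] --> \prod_(i < d) (1 : R) by rewrite big1.
    apply: (@cvg_prod_ord _ d (fun i n => expabs n.+1%:R^-1 (tnth xi i))) => i.
    suff H : expabs k.+1%:R^-1 (tnth xi i) @[k --> \oo] --> expR (- (0 * `|tnth xi i|)).
      by rewrite mul0r oppr0 expR0 in H.
    apply: (@cvg_comp _ _ _ (fun n : nat => - (n.+1%:R^-1 * `|tnth xi i|)) expR); last exact: continuous_expR.
    by apply: cvgN; apply: cvgMl; exact: cvg_harmonic.
  - by move=> n; apply: damped_le => //; rewrite invr_gt0.
have F2 : L2 (F f).
  by apply/L2P; split; [exact: cmeas_fourier_L1|rewrite (le_lt_trans h)// ltry].
split=> //; rewrite ler_wsqrtr//.
by rewrite -lee_fin ipE.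
Qed.

Definition isom f := [/\ cint mu f, L2 f & nrm (F f) = nrm f].

Lemma isom_scale (c : R[i]) f : isom f -> isom (fun x => c * f x).
Proof.
move=> [fi f2 ff]; have [Ff2 _] := fourier_L1_contraction fi f2.
have h g : L2 g -> L2 (fun x => c * g x) /\ nrm (fun x => c * g x) = Num.sqrt (cdot c c) * nrm g.
  move=> g2; have [mg _] := (L2P g).1 g2.
  have E x : cdot (c * g x) (c * g x) = cdot c c * cdot (g x) (g x).
    by case: c (g x) => [a b] [p q]; rewrite /cdot /=; ring.
  split.
    apply/L2P; split; first by apply: cmeasM => //; split; exact: measurable_cst.
    under eq_integral do rewrite E EFinM.
    rewrite ge0_integralZl//; last 3 first.
      by apply/measurable_EFinP; exact: measurable_cdot.
      by move=> x _; rewrite lee_fin cdot_ge0.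
      by rewrite lee_fin cdot_ge0.
    by rewrite -ipE// -EFinM ltry.
  rewrite /nrm -sqrtrM ?cdot_ge0//; congr Num.sqrt.
  rewrite /ip -RintegralZl//; last exact: L2_integrable.
  by apply: eq_Rintegral => x _; rewrite E.
split; first exact: cintM.
  by have [] := h f f2.
rewrite fourier_L1M//; have [_ ->] := h _ Ff2; have [_ ->] := h _ f2.
by rewrite ff.
Qed.

(* The isometric elements form the null space of the positive semidefinite
   form [|f|^2 - |F f|^2]. *)
Lemma isomD f g : isom f -> isom g -> isom (f \+ g).
Proof.
move=> [fi f2 ff] [gi g2 gg].
have [Ff2 _] := fourier_L1_contraction fi f2.
have [Fg2 _] := fourier_L1_contraction gi g2.
split; [exact: cintD|exact: L2D|].
have e1 : ip (F f) (F f) = ip f f by rewrite -!nrm_sq ff.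
have e2 : ip (F g) (F g) = ip g g by rewrite -!nrm_sq gg.
pose B := ip f g - ip (F f) (F g).
have : B ^+ 2 <= 0 * 0.
  apply: psd_quadratic => // t.
  have ti := cintM (t%:C%C) gi; have t2 := L2Z t g2.
  have [_] := fourier_L1_contraction (cintD fi ti) (L2D f2 t2).
  rewrite -ler_sqr ?nnegrE ?nrm_ge0// !nrm_sq fourier_L1D// fourier_L1M//.
  have Ft2 := L2Z t Fg2.
  rewrite (ip_DD Ff2 Ft2) (ip_DD f2 t2) (ipZr t Fg2 Ff2) (ipZr t g2 f2).
  rewrite (ipZl t Fg2 Ft2) (ipZr t Fg2 Fg2) (ipZl t g2 t2) (ipZr t g2 g2) e1 e2 /B.
  exact: psd_aux.
rewrite mulr0 => B0; have {}B0 : B = 0.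
  by apply/eqP; rewrite -sqrf_eq0 eq_le B0 sqr_ge0.
rewrite /nrm fourier_L1D// (ip_DD Ff2 Fg2) (ip_DD f2 g2) e1 e2; congr Num.sqrt.
by rewrite (subr0_eq B0).
Qed.

Lemma isomB f g : isom f -> isom g -> isom (f \- g).
Proof. by move=> fG gG; rewrite subZE; apply: isomD => //; exact: isom_scale. Qed.

(** The contraction property applied to the differences makes the transforms converge as well, so
    the equality of norms passes to the limit. *)
Lemma isom_lim (f_ : nat -> fct) f : (forall n, isom (f_ n)) -> cint mu f -> L2 f ->
  nrm (f_ n \- f) @[n --> \oo] --> (0 : R) -> isom f.
Proof.
move=> fG fi f2 ff; split=> //.
have i_ n : cint mu (f_ n) by have [] := fG n.
have l_ n : L2 (f_ n) by have [] := fG n.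
have [Ff2 _] := fourier_L1_contraction fi f2.
have h1 := cvg_nrm l_ f2 ff.
have F_ n : L2 (F (f_ n)) by have [] := fourier_L1_contraction (i_ n) (l_ n).
have h2 : nrm (F (f_ n)) @[n --> \oo] --> nrm (F f).
  apply: cvg_nrm => //; apply: (squeeze_cvgr _ (cvg_cst 0) ff).
  apply: nearW => n; rewrite nrm_ge0/= -fourier_L1B//.
  by have [] := fourier_L1_contraction (cintB (i_ n) fi) (L2B (l_ n) f2).
have h3 : (fun n => nrm (F (f_ n))) = (fun n => nrm (f_ n)).
  by apply/funext => n; have [] := fG n.
by rewrite h3 in h2; exact: cvg_unique h2 h1.
Qed.

Lemma L2_dominated (f_ : nat -> fct) f (g : fct) : (forall n, cmeas (f_ n)) -> cmeas f ->
  L2 g -> (forall x, cdot (f_ n x - f x) (f_ n x - f x) @[n --> \oo] --> (0:R)) ->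
  (forall n x, cdot (f_ n x - f x) (f_ n x - f x) <= cdot (g x) (g x)) ->
  nrm (f_ n \- f) @[n --> \oo] --> (0:R).
Proof.
move=> mf_ mf g2 cf fg.
have H : (\int[mu]_x (cdot (f_ n x - f x) (f_ n x - f x))%:E)%E @[n --> \oo] --> (\int[mu]_x (0%E : \bar R))%E.
  apply: (@dominated_cvg _ _ _ mu setT measurableT _ _ (fun x => (cdot (g x) (g x))%:E)) => //.
  - by move=> n; apply/measurable_EFinP; apply: measurable_cdot; exact: cmeasB.
  - by move=> x _; rewrite -[0%E]/(0%:E); apply: cvg_EFin; [exact: nearW|exact: cf].
  - exact: L2_integrable.
  - by move=> n x _; rewrite /= lee_fin ger0_norm ?cdot_ge0.
rewrite integral0 in H; have {H}/fine_cvg H := H.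
rewrite -(sqrtr0 R).
by apply: (@cvg_comp _ _ _ (fun n => ip (f_ n \- f) (f_ n \- f)) Num.sqrt _ _ _ H); exact: sqrt_continuous.
Qed.

Definition cind (A : set (Rd R d)) : fct := fun v => (\1_A v : R)%:C%C.

Lemma cind_L12 A : measurable A -> (mu A < +oo)%E -> cint mu (cind A) /\ L2 (cind A).
Proof.
move=> mA Aoo.
have ii : mu.-integrable setT (EFin \o (\1_A : _ -> R)).
  apply/integrableP; split; first by apply/measurable_EFinP.
  under eq_integral do rewrite /= ger0_norm//.
  by rewrite integral_indic// setIT.
have mi : cmeas (cind A) by split; [exact: measurable_indic|exact: measurable_cst].
split.
  split; first exact: ii.
  by under eq_fun do rewrite /=; exact: integrable0.
apply/L2P; split=> //.
rewrite (_ : (fun _ => _) = (EFin \o (\1_A : _ -> R))).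
  by rewrite integral_indic// setIT.
apply/funext => x; rewrite /cdot /cind /= mulr0 addr0 indicE.
by case: (x \in A); rewrite ?mulr1 ?mulr0.
Qed.

Lemma lebesgue_box_lty a b : (mu (box a b) < +oo)%E.
Proof.
(* Enlarging the box downwards makes each side nondegenerate, as the volume formula
   [integral_boxind] requires. *)
pose a' i := Num.min (a i) (b i) - 1; pose b' i := b i.
apply: (@le_lt_trans _ _ (mu (box a' b'))).
  apply: le_measure; rewrite ?inE; [exact: measurable_box..|].
  move=> v vB i; have /andP[h1 h2] := vB i; rewrite h2 andbT /a'.
  have : Num.min (a i) (b i) <= a i by rewrite ge_min lexx.
  lra.
have -> : mu (box a' b') = (\int[mu]_v (boxind a' b' v)%:E)%E.
  under eq_integral do rewrite boxindE.
  by rewrite integral_indic// ?setIT//; exact: measurable_box.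
rewrite integral_boxind ?ltry// => i; rewrite /a' /b'.
have : Num.min (a i) (b i) <= b i by rewrite ge_min lexx orbT.
lra.
Qed.

(** By contraction only the lower bound is missing. The norm of the transform dominates its damped
    version, which by the damped identity is a product of one-dimensional integrals tending to the
    volume of the box. *)
Lemma isom_box a b : isom (cind (box a b)).
Proof.
have [fi f2] := cind_L12 (measurable_box a b) (lebesgue_box_lty a b).
have [Ff2 Ffle] := fourier_L1_contraction fi f2.
split=> //; apply/eqP; rewrite eq_le Ffle /=.
have [[i ba]|nba] := pselect (exists i, b i <= a i).
  rewrite (_ : nrm (cind (box a b)) = 0) ?nrm_ge0//.
  rewrite /nrm (_ : ip _ _ = 0) ?sqrtr0//.
  transitivity (\int[mu]_x (0:R)); last by rewrite /Rintegral integral0.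
  apply: eq_Rintegral => v _; rewrite /cind indicE memNset.
    by rewrite /cdot /= !mulr0 addr0.
  by move=> /(_ i) /andP[/lt_le_trans h /h]; rewrite ltNge ba.
have ab i : a i < b i.
  by rewrite ltNge; apply/negP => h; apply: nba; exists i.
rewrite ler_wsqrtr//.
have e0 n : 0 < (n.+1%:R^-1 : R) by rewrite invr_gt0.
have cE x y : cdot (cind (box a b) y) (cind (box a b) x) = boxind a b x * boxind a b y.
  by rewrite /cdot /cind /= !boxindE mulr0 addr0 mulrC.
have -> : ip (cind (box a b)) (cind (box a b)) = \prod_(i < d) (b i - a i).
  rewrite /ip /Rintegral -[RHS]/(fine (\prod_(i < d) (b i - a i))%:E) -integral_boxind//.
  congr fine; apply: eq_integral => v _; rewrite cE !boxindE indicE.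
  by case: (v \in _); rewrite ?mulr1 ?mulr0.
have key n : \prod_(i < d) poisson_itv2 n.+1%:R^-1 (a i) (b i) <= ip (F (cind (box a b))) (F (cind (box a b))).
  rewrite -lee_fin ipE//.
  apply: (@le_trans _ _ (\int[mu]_xi (expabsn n.+1%:R^-1 xi * cdot (F (cind (box a b)) xi) (F (cind (box a b)) xi))%:E)%E); last first.
    apply: ge0_le_integral => //.
    - by move=> x _; rewrite lee_fin mulr_ge0 ?expabsn_ge0 ?cdot_ge0.
    - apply/measurable_EFinP; apply: measurable_funM; first exact: measurable_expabsn.
      by apply: measurable_cdot; exact: cmeas_fourier_L1.
    - by apply/measurable_EFinP; apply: measurable_cdot; exact: cmeas_fourier_L1.
    - move=> x _; rewrite lee_fin ler_piMl ?cdot_ge0 ?expabsn_le1 ?invr_ge0//.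
  rewrite -(fineK (integrable_fin_num measurableT (integrable_damped_fourier (e0 n) fi))).
  rewrite -[X in (_ <= X%:E)%E]/(\int[mu]_xi (expabsn n.+1%:R^-1 xi * cdot (F (cind (box a b)) xi) (F (cind (box a b)) xi))).
  rewrite damped_plancherel// lee_fin.
  rewrite -[leLHS]/(fine (\prod_(i < d) poisson_itv2 n.+1%:R^-1 (a i) (b i))%:E).
  rewrite -(@integral_tuple_prod _ _ (fun i x => \1_(`]a i, b i]%classic) x * poisson_itv n.+1%:R^-1 (a i) (b i) x)); last 3 first.
  - move=> i; apply: measurable_funM; first exact: measurable_indic_itv.
    exact: measurable_poisson_itv.
  - by move=> i x; rewrite mulr_ge0//; have /andP[] := poisson_itv_bounds x (e0 n) (ab i).
  - by move=> i; exact: poisson_itv2E.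
  rewrite le_eqVlt; apply/orP; left; apply/eqP; congr fine; apply: eq_integral => x _.
  rewrite big_split /= -/(boxind a b x) /Rintegral fineK.
    under eq_integral do rewrite cE mulrCA EFinM.
    rewrite ge0_integralZl//; last 3 first.
    - apply/measurable_EFinP; apply: measurable_funM; first exact: measurable_poissonn.
      exact: measurable_boxind.
    - by move=> y _; rewrite lee_fin mulr_ge0 ?boxind_ge0// poissonn_ge0.
    - by rewrite lee_fin boxind_ge0.
    rewrite EFinM; congr (_ * _)%E.
    rewrite -(@integral_tuple_prod _ _ (fun i y => \1_(`]a i, b i]%classic) y * poissonk n.+1%:R^-1 (tnth x i - y))); last 3 first.
    - move=> i; apply: measurable_funM; first exact: measurable_indic_itv.
      by apply: (measurableT_comp (measurable_poissonk (e0 n))); apply: measurable_funB.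
    - by move=> i y; rewrite mulr_ge0// poissonk_ge0.
    - move=> i; rewrite -[RHS](integral_poissonk_itv (tnth x i) (e0 n) (ab i)).
      rewrite [RHS]integral_mkcond; apply: eq_integral => y _.
      rewrite /patch /= indicE; case: (y \in _); rewrite ?mul1r ?mul0r//.
    by apply: eq_integral => y _; rewrite big_split /= mulrC.
  apply: integrable_fin_num => //.
  have ipo : mu.-integrable setT (EFin \o poissonn n.+1%:R^-1 x).
    apply/integrableP; split; first by apply/measurable_EFinP; exact: measurable_poissonn.
    under eq_integral do rewrite /= ger0_norm ?poissonn_ge0//.
    by rewrite integral_poissonn// ltry.
  apply: le_integrable ipo => //.
    apply/measurable_EFinP; apply: measurable_funM; first exact: measurable_poissonn.
    apply: measurable_cdot; first exact: L2_cmeas.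
    by split; exact: measurable_cst.
  move=> y _; rewrite /= lee_fin cE normrM ler_piMr// !boxindE !indicE.
  by case: (_ \in _); case: (_ \in _); rewrite ?mulr1 ?mulr0 ?normr1 ?normr0.
have lim : \prod_(i < d) poisson_itv2 n.+1%:R^-1 (a i) (b i) @[n --> \oo] --> \prod_(i < d) (b i - a i).
  by apply: (@cvg_prod_ord _ d (fun i n => poisson_itv2 n.+1%:R^-1 (a i) (b i))) => i; exact: cvg_poisson_itv2.
rewrite -(cvg_lim _ lim)//; apply: limr_le; first by apply/cvg_ex; eexists; exact: lim.
exact: nearW.
Qed.

End isometry.

(** * Equality of norms on all of L^1 and L^2 *)

Section isometry_all.
Context {R : realType} {d : nat}.
Local Notation mu := (lebesgue_Rd d : {sigma_finite_measure set (Rd R d) -> \bar R}).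
Local Notation fct := (Rd R d -> R[i]).
Local Notation F := (@fourier_L1 R d).
Implicit Types f g h : fct.

Lemma measurable_cube n : measurable (@cube R d n). Proof. exact: measurable_box. Qed.

Lemma cind_cube_L12 (S : set (Rd R d)) n : measurable S ->
  cint mu (cind (S `&` cube n)) /\ L2 (cind (S `&` cube n)).
Proof.
move=> mS; apply: cind_L12; first by apply: measurableI => //; exact: measurable_cube.
apply: le_lt_trans (lebesgue_box_lty (fun=> - n%:R) (fun=> n%:R)).
by apply: le_measure; rewrite ?inE; [apply: measurableI => //; exact: measurable_cube|exact: measurable_cube|exact: subIsetr].
Qed.

(** Dynkin's lemma over boxes. The intersection with a cube keeps every set of finite measure, and
    it turns complements into differences from the cube. *)
Lemma isom_set (S : set (Rd R d)) n : measurable S -> isom (cind (S `&` cube n)).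
Proof.
rewrite measurable_boxes => mS; move: n; move: S mS.
apply: (@dynkin_induction _ (Rd R d) boxes) => //=.
- exact: measurable_boxes.
- exact: setI_closed_boxes.
- by move=> n; rewrite setTI; exact: isom_box.
- by move=> _ [a [b ->]] n; rewrite /cube boxI; exact: isom_box.
- move=> S mS PS n.
  rewrite (_ : cind _ = cind (cube n) \- cind (S `&` cube n)).
    by apply: isomB => //; exact: isom_box.
  apply/funext => v /=; rewrite /cind -rmorphB /=; congr (_%:C)%C.
  rewrite !indicE !in_setI in_setC.
  by case: (v \in S); case: (v \in cube n); rewrite /= ?subrr ?subr0.
- move=> A mA tA PA n.
  (* Finite unions are sums of disjoint indicators; they converge to the full union in L^2 because
     the cube dominates them and membership of a point is decided at a finite stage. *)
  pose U k := \bigcup_(j < k) A j.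
  have mU k : measurable (U k) by apply: bigcup_measurable => j _.
  apply: (@isom_lim _ _ (fun k => cind (U k `&` cube n))).
  + elim=> [|k ih].
      rewrite (_ : cind _ = fun x => 0 * cind (cube n) x).
        by apply: isom_scale; exact: isom_box.
      apply/funext => v; rewrite mul0r /cind indicE memNset//= => -[[j]].
      by move=> /=.
    rewrite (_ : cind _ = cind (U k `&` cube n) \+ cind (A k `&` cube n)).
      exact: isomD.
    apply/funext => v /=; rewrite /cind -rmorphD /=; congr (_%:C)%C.
    have UE : U k.+1 = U k `|` A k.
      apply/seteqP; split => x /=.
        by move=> [j /=]; rewrite ltnS leq_eqVlt => /predU1P[-> ?|jk Ajx]; [right|left; exists j].
      by move=> [[j /= jk Ajx]|Akx]; [exists j => //=; rewrite ltnS ltnW|exists k => /=].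
    rewrite UE !indicE !in_setI in_setU.
    case: (boolP (v \in U k)) => [/set_mem [j /= jk Ajv]|_]; last by case: (v \in A k); case: (v \in cube n); rewrite /= ?addr0 ?add0r.
    rewrite (_ : (v \in A k) = false) ?addr0 //=.
    apply: memNset => Akv; have := tA j k I I; rewrite (_ : (j = k) = False).
      by apply; exists v.
    by rewrite propeqE; split => // jkE; move: jk; rewrite jkE ltnn.
  + by apply: (cind_cube_L12 n _).1; exact: bigcup_measurable.
  + by apply: (cind_cube_L12 n _).2; exact: bigcup_measurable.
  + apply: (@L2_dominated _ _ _ _ (cind (cube n))).
    * by move=> k; apply: L2_cmeas; apply: (cind_cube_L12 n _).2.
    * by apply: L2_cmeas; apply: (cind_cube_L12 n _).2; exact: bigcup_measurable.
    * by have := (cind_cube_L12 n (measurableT)).2; rewrite setTI.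
    * move=> v; have [[j _ Ajv]|nA] := pselect ((\bigcup_k A k) v).
        apply: cvg_near_cst; exists j.+1 => // k /= jk.
        rewrite (_ : cind (U k `&` cube n) v = cind (\bigcup_k A k `&` cube n) v).
          by rewrite subrr /cdot /= !mulr0 addr0.
        by rewrite /cind !indicE !in_setI !(mem_set (A := U k)) ?(mem_set (A := \bigcup_k A k)) //; exists j.
      rewrite (_ : (fun k => _) = cst 0); first exact: cvg_cst.
      apply/funext => k /=; rewrite /cind !indicE !in_setI !(memNset (A := U k)) ?(memNset (A := \bigcup_k A k)) //=.
        by rewrite subrr /cdot /= !mulr0 addr0.
      by move=> [j _ Ajv]; apply: nA; exists j.
    * move=> k v; have UA : U k v -> (\bigcup_k A k) v by move=> [j _ ?]; exists j.
      rewrite /cind -rmorphB /cdot /= !mulr0 !addr0 !indicE !in_setI.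
      case: (boolP (v \in U k)) => [/set_mem/UA/mem_set ->|_]; first by rewrite subrr mulr0 mulr_ge0.
      case: (v \in \bigcup_k A k); case: (v \in cube n); rewrite /= ?subrr ?subr0 ?mulr0 ?mulr1 ?sub0r ?mulrNN ?mulr1//.
Qed.

Lemma le_L2 f g : cmeas g -> L2 f -> (forall x, cdot (g x) (g x) <= cdot (f x) (f x)) -> L2 g.
Proof.
move=> mg /L2P[mf fo] gf; apply/L2P; split=> //; apply: le_lt_trans fo.
apply: ge0_le_integral => //.
- by move=> x _; rewrite lee_fin cdot_ge0.
- by apply/measurable_EFinP; exact: measurable_cdot.
- by apply/measurable_EFinP; exact: measurable_cdot.
- by move=> x _; rewrite lee_fin.
Qed.

Lemma isom_sum (I : Type) (s : seq I) (c : I -> R[i]) (G : I -> fct) :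
  (forall i, isom (G i)) -> isom (fun x => \sum_(i <- s) c i * G i x).
Proof.
move=> GG; elim: s => [|i s ih].
  rewrite (_ : (fun _ => _) = fun x => 0 * cind (cube 0) x).
    by apply: isom_scale; exact: isom_box.
  by apply/funext => x; rewrite big_nil mul0r.
rewrite (_ : (fun _ => _) = (fun x => c i * G i x) \+ (fun x => \sum_(i <- s) c i * G i x)).
  by apply: isomD => //; exact: isom_scale.
by apply/funext => x; rewrite big_cons.
Qed.

Let rc (h : Rd R d -> R) : fct := fun x => (h x)%:C%C.

Let cdot_rc (a b : R) : cdot (a%:C)%C (b%:C)%C = a * b.
Proof. by rewrite /cdot /= mulr0 addr0. Qed.

Import HBNNSimple.

(** Approximation from below by simple functions, cut to growing cubes: the level sets themselves
    may have infinite measure, in particular the one at 0. *)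
Lemma isom_ge0 (h : Rd R d -> R) : (forall x, 0 <= h x) ->
  cint mu (rc h) -> L2 (rc h) -> isom (rc h).
Proof.
move=> h0 hi h2.
have mh : measurable_fun setT h by have [] := L2_cmeas h2.
have mEh : measurable_fun setT (EFin \o h) by apply/measurable_EFinP.
pose g n := nnsfun_approx measurableT mEh n.
have gcvg x : g n x @[n --> \oo] --> h x.
  have := @cvg_nnsfun_approx _ _ _ _ measurableT _ mEh (fun x _ => h0 x) x I.
  by move/fine_cvg.
have gh n x : g n x <= h x.
  rewrite -(cvg_lim _ (gcvg x))//.
  apply: (@nondecreasing_cvgn_le _ (fun n => g n x)).
    by move=> a b ab; exact/lefP/nd_nnsfun_approx.
  by apply/cvg_ex; eexists; exact: gcvg.
pose f_ n : fct := fun x => ((g n x * \1_(cube n) x)%:C)%C.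
have mf_ n : cmeas (f_ n).
  split; last exact: measurable_cst.
  by apply: measurable_funM => //; apply: measurable_indic; exact: measurable_cube.
have le_f n x : 0 <= g n x * \1_(cube n) x <= h x.
  rewrite mulr_ge0//= indicE; case: (x \in _); rewrite ?mulr1 ?gh// mulr0 h0//.
apply: (@isom_lim _ _ f_) => //.
- move=> n; rewrite (_ : f_ n = fun x => \sum_(y <- finmap.enum_fset (fset_set (range (g n))))
      (y%:C)%C * cind (g n @^-1` [set y] `&` cube n) x).
    apply: isom_sum => y; apply: isom_set.
    by rewrite -[X in measurable X]setTI; apply: measurable_funP.
  apply/funext => x; rewrite /f_ /cind.
  transitivity ((\sum_(y <- finmap.enum_fset (fset_set (range (g n)))) y * \1_(g n @^-1` [set y] `&` cube n) x)%:C)%C; last first.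
    by rewrite rmorph_sum /=; apply: eq_bigr => y _; rewrite rmorphM.
  congr (_%:C)%C; rewrite {1}(fimfunE (g n)) fsbig_finite//= mulr_suml.
  apply: eq_bigr => y _; rewrite -mulrA; congr (_ * _).
  by rewrite !indicE in_setI; case: (_ \in _); case: (_ \in _); rewrite /= ?mulr0 ?mulr1 ?mul0r.
- apply: (@L2_dominated _ _ _ _ (rc h)) => //.
  + move=> x; pose u n := g n x * \1_(cube n) x - h x.
    have E n : cdot (f_ n x - rc h x) (f_ n x - rc h x) = u n * u n.
      by rewrite /f_ /rc -rmorphB cdot_rc.
    under eq_fun do rewrite E.
    have [N NP] := mem_cube x.
    have H : u n @[n --> \oo] --> (0 : R).
      rewrite -(subrr (h x)); apply: cvgB; last exact: cvg_cst.
      rewrite -[X in _ --> X]mulr1; apply: cvgM; first exact: gcvg.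
      apply: cvg_near_cst; exists N => // n /= Nn; rewrite indicE mem_set//; exact: NP.
    by rewrite -(mulr0 0); apply: cvgM.
  + move=> n x; rewrite /f_ /rc -rmorphB !cdot_rc -!expr2.
    have /andP[l1 l2] := le_f n x.
    rewrite -sqrrN opprB ler_sqr ?nnegrE ?subr_ge0 ?h0//.
    by rewrite lerBlDr lerDl.
Qed.

Lemma isom_real (h : Rd R d -> R) : cint mu (rc h) -> L2 (rc h) -> isom (rc h).
Proof.
move=> hi h2.
have mh : measurable_fun setT h by have [] := L2_cmeas h2.
have P (p : Rd R d -> R) : measurable_fun setT p -> (forall x, 0 <= p x <= `|h x|) -> isom (rc p).
  move=> mp pb; have cp : cmeas (rc p) by split; [exact: mp|exact: measurable_cst].
  apply: isom_ge0 => [x||]; first by have /andP[] := pb x.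
    apply: (@le_cint _ _ _ (cabs1 (rc h))) => //; first exact: cint_cabs1.
    by move=> x; have /andP[p0 ph] := pb x; rewrite /cabs1 /rc /= normr0 !addr0 ger0_norm.
  apply: (@le_L2 (rc h)) => // x; rewrite !cdot_rc -!expr2 -[leRHS]real_normK ?num_real//.
  by have /andP[p0 ph] := pb x; rewrite ler_sqr ?nnegrE.
rewrite (_ : rc h = rc (fun x => Num.max (h x) 0) \- rc (fun x => Num.max (- h x) 0)).
  apply: isomB; apply: P.
  - by apply: measurable_maxr.
  - by move=> x; rewrite le_max lexx orbT /= ge_max ler_norm normr_ge0.
  - by apply: measurable_maxr => //; exact: measurable_funN.
  - by move=> x; rewrite le_max lexx orbT /= ge_max normr_ge0 -normrN ler_norm.
apply/funext => x /=; rewrite /rc -rmorphB; congr (_%:C)%C.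
have [h0|h0] := leP 0 (h x).
  by rewrite (_ : Num.max (- h x) 0 = 0) ?subr0//; apply/max_idPr; rewrite oppr_le0.
by rewrite (_ : Num.max (- h x) 0 = - h x) ?sub0r ?opprK//; apply/max_idPl; rewrite oppr_ge0 ltW.
Qed.

Lemma isom_L12 f : cint mu f -> L2 f -> isom f.
Proof.
move=> fi f2; have [m1 m2] := L2_cmeas f2.
have P (p : Rd R d -> R) : measurable_fun setT p ->
    (forall x, `|p x| <= cabs1 f x) -> (forall x, p x * p x <= cdot (f x) (f x)) -> isom (rc p).
  move=> mp p1 p2; have cp : cmeas (rc p) by split; [exact: mp|exact: measurable_cst].
  apply: isom_real.
    apply: (@le_cint _ _ _ (cabs1 f)) => //; first exact: cint_cabs1.
    by move=> x; rewrite /cabs1 /= normr0 !addr0; exact: p1.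
  by apply: (@le_L2 f) => // x; rewrite cdot_rc.
rewrite (_ : f = rc (fun x => complex.Re (f x)) \+ (fun x => Complex 0 1 * rc (fun x => complex.Im (f x)) x)).
  apply: isomD; last apply: isom_scale; apply: P => //.
  - by move=> x; rewrite lerDl.
  - by move=> x; rewrite /cdot lerDl -expr2 sqr_ge0.
  - by move=> x; rewrite lerDr.
  - by move=> x; rewrite /cdot lerDr -expr2 sqr_ge0.
apply/funext => x; rewrite /rc /=; case: (f x) => a b; apply/eqP; rewrite eq_complex /=.
by apply/andP; split; apply/eqP; ring.
Qed.

End isometry_all.

(** * Fourier multipliers on L^2 *)

Section fourier_L2.
Context {R : realType} {d : nat}.
Local Notation mu := (lebesgue_Rd d : {sigma_finite_measure set (Rd R d) -> \bar R}).
Local Notation fct := (Rd R d -> R[i]).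
Local Notation F := (@fourier_L1 R d).
Implicit Types f g h : fct.

Definition cjf f : fct := fun x => conjc (f x).

Lemma cjfK f : cjf (cjf f) = f.
Proof. by apply/funext => x; rewrite /cjf; case: (f x) => a b /=; rewrite opprK. Qed.

Lemma ip_cjf f g : ip (cjf f) (cjf g) = ip f g.
Proof.
by apply: eq_Rintegral => x _; rewrite /cjf /cdot; case: (f x) (g x) => [a b] [p q] /=; ring.
Qed.

Lemma ip_cjfl f g : ip (cjf f) g = ip f (cjf g).
Proof. by rewrite -[in LHS](cjfK g) ip_cjf. Qed.

Lemma nrm_cjf f : nrm (cjf f) = nrm f. Proof. by rewrite /nrm ip_cjf. Qed.

Lemma L2_cjf f : L2 f -> L2 (cjf f).
Proof.
move=> f2; apply: (le_L2 _ f2); first by apply: cmeas_conj; exact: L2_cmeas.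
by move=> x; rewrite /cjf /cdot; case: (f x) => a b /=; rewrite mulrNN.
Qed.

Definition trunc_cube (n : nat) f : fct := fun x => (\1_(cube n) x : R)%:C%C * f x.

Lemma trunc_cube_L12 n f : L2 f -> cint mu (trunc_cube n f) /\ L2 (trunc_cube n f).
Proof.
move=> f2; have mf := L2_cmeas f2.
have t2 : L2 (trunc_cube n f).
  apply: (@L2_bounded _ _ (\1_(cube n)) 1) => //.
    by apply: measurable_indic; exact: measurable_cube.
  by move=> x; rewrite indicE; case: (_ \in _); rewrite ?normr1 ?normr0.
split=> //; have coo : (mu (@cube R d n) < +oo)%E by exact: lebesgue_box_lty.
have [ci _] := cind_L12 (@measurable_cube R d n) coo.
(* On the cube |Re f| + |Im f| <= 1 + |f|^2, since t <= t^2 + 1/4. *)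
apply: (@le_cint _ _ _ (fun x => cabs1 (cind (cube n)) x + cdot (f x) (f x))).
- exact: L2_cmeas.
- by apply: (integrableD measurableT (cint_cabs1 ci) (L2_integrable f2 f2)).
- move=> x; rewrite /cabs1 /trunc_cube /cind indicE /cdot; case: (f x) => a b /=.
  case: (_ \in _); rewrite ?mul1r ?mul0r ?mulr0 ?normr0 ?normr1 ?subr0 ?addr0 ?add0r -?expr2.
    rewrite -(real_normK (num_real a)) -(real_normK (num_real b)).
    have := sqr_ge0 (`|a| - 2^-1); have := sqr_ge0 (`|b| - 2^-1); nra.
  by rewrite normr0 addr0 addr_ge0// sqr_ge0.
Qed.

Lemma cvg_trunc_cube f : L2 f -> nrm (trunc_cube n f \- f) @[n --> \oo] --> (0 : R).
Proof.
move=> f2; apply: (@L2_dominated _ _ _ _ f) => //.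
- by move=> n; apply: L2_cmeas; apply: (trunc_cube_L12 n f2).2.
- exact: L2_cmeas.
- move=> x; have [N NP] := mem_cube x; apply: cvg_near_cst; exists N => // n /= Nn.
  rewrite /trunc_cube indicE mem_set; last exact: NP.
  by rewrite mul1r subrr /cdot /= !mulr0 addr0.
- move=> n x; rewrite /trunc_cube indicE; case: (_ \in _); rewrite ?mul1r ?mul0r.
    by rewrite subrr /cdot /= !mulr0 addr0 cdot_ge0.
  by rewrite sub0r /cdot; case: (f x) => a b /=; rewrite !mulrNN.
Qed.

Lemma is_fourier_approx f g : is_fourier f g -> exists G : nat -> fct,
  [/\ forall n, cint mu (G n), forall n, L2 (G n),
      nrm (G n \- f) @[n --> \oo] --> (0 : R) &
      nrm (F (G n) \- g) @[n --> \oo] --> (0 : R)].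
Proof.
move=> [f2 g2 [G [G12 Gf FGg]]]; exists G; split.
- by move=> n; apply/L1P; have [] := G12 n.
- by move=> n; have [] := G12 n.
- by apply/cvg_L2P => // n; have [] := G12 n.
- apply/cvg_L2P => // n; have [/L1P Gi G2] := G12 n.
  by have [] := fourier_L1_contraction Gi G2.
Qed.

Lemma is_fourier_nrm f g : is_fourier f g -> nrm g = nrm f.
Proof.
move=> fg; have [f2 g2 _] := fg; have [G [Gi G2 Gf FGg]] := is_fourier_approx fg.
have h1 := cvg_nrm G2 f2 Gf.
have FG2 n : L2 (F (G n)) by have [] := fourier_L1_contraction (Gi n) (G2 n).
have h2 := cvg_nrm FG2 g2 FGg.
have h3 : (fun n => nrm (F (G n))) = (fun n => nrm (G n)).
  by apply/funext => n; have [] := isom_L12 (Gi n) (G2 n).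
by rewrite h3 in h2; exact: cvg_unique h2 h1.
Qed.

Lemma is_fourier_lin f g f' g' (a : R) : is_fourier f g -> is_fourier f' g' ->
  is_fourier (f \+ (fun x => a%:C%C * f' x)) (g \+ (fun x => a%:C%C * g' x)).
Proof.
move=> fg fg'; have [f2 g2 _] := fg; have [f'2 g'2 _] := fg'.
have [G [Gi G2 Gf FGg]] := is_fourier_approx fg.
have [G' [Gi' G2' Gf' FGg']] := is_fourier_approx fg'.
pose S (u v : fct) := u \+ (fun x => a%:C%C * v x).
have S2 u v : L2 u -> L2 v -> L2 (S u v) by move=> u2 v2; apply: L2D => //; exact: L2Z.
have SB u v u' v' : S u v \- S u' v' = S (u \- u') (v \- v').
  by apply/funext => x; rewrite /S /=; ring.
have cS (u u' : nat -> fct) (v v' : fct) : (forall n, L2 (u n)) -> (forall n, L2 (u' n)) ->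
    L2 v -> L2 v' -> nrm (u n \- v) @[n --> \oo] --> (0 : R) ->
    nrm (u' n \- v') @[n --> \oo] --> (0 : R) ->
    nrm (S (u n) (u' n) \- S v v') @[n --> \oo] --> (0 : R).
  move=> u2 u'2 v2 v'2 uv uv'.
  have H : nrm (u n \- v) + `|a| * nrm (u' n \- v') @[n --> \oo] --> (0 : R).
    rewrite -(addr0 0) -[X in _ + X](mulr0 `|a|).
    by apply: cvgD => //; apply: cvgM => //; exact: cvg_cst.
  apply: (squeeze_cvgr _ (cvg_cst 0) H); apply: nearW => n; rewrite nrm_ge0/= SB.
  rewrite -nrmZ; last exact: L2B.
  by apply: nrmD; [exact: L2B|apply: L2Z; exact: L2B].
have FG2 n : L2 (F (G n)) by have [] := fourier_L1_contraction (Gi n) (G2 n).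
have FG2' n : L2 (F (G' n)) by have [] := fourier_L1_contraction (Gi' n) (G2' n).
split; [exact: S2|exact: S2|].
exists (fun n => S (G n) (G' n)); split.
- move=> n; split; last exact: S2.
  by apply/L1P; apply: cintD => //; exact: cintM.
- by apply/cvg_L2P; [move=> n; exact: S2|exact: S2|exact: cS].
have E n : F (S (G n) (G' n)) = S (F (G n)) (F (G' n)).
  by rewrite fourier_L1D// ?fourier_L1M//; exact: cintM.
apply/cvg_L2P; [by move=> n; rewrite E; exact: S2|exact: S2|].
under eq_fun do rewrite E; exact: cS.
Qed.

Lemma is_fourier_sub f g f' g' : is_fourier f g -> is_fourier f' g' ->
  is_fourier (f \- f') (g \- g').
Proof. by move=> fg fg'; rewrite !subZE; exact: is_fourier_lin. Qed.

(** Justifies the selection: truncations to cubes lie in L^1 and L^2, their transforms form a Cauchy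
    sequence by contraction, and completeness provides the limit. *)
Lemma fourierP f : L2 f -> is_fourier f (fourier f).
Proof.
move=> f2; rewrite /fourier; apply: (@xgetPex _ _ [set g | is_fourier f g]) => /=.
pose G n := trunc_cube n f.
have Gi n : cint mu (G n) by have [] := trunc_cube_L12 n f2.
have G2 n : L2 (G n) by have [] := trunc_cube_L12 n f2.
have FG2 n : L2 (F (G n)) by have [] := fourier_L1_contraction (Gi n) (G2 n).
have Gf := cvg_trunc_cube f2.
have [e e0|g g2 gl] := L2_complete FG2.
  have e20 : 0 < e / 2 by rewrite divr_gt0.
  move/cvgrPdist_le : Gf => /(_ _ e20) [N _ NP]; exists N => m n Nm Nn.
  rewrite -fourier_L1B//.
  have [_ le1] := fourier_L1_contraction (cintB (Gi m) (Gi n)) (L2B (G2 m) (G2 n)).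
  apply: (le_trans le1); apply: (le_trans (nrmB_le (G2 m) f2 (G2 n))).
  have q k : (N <= k)%N -> nrm (G k \- f) <= e / 2.
    by move=> /NP /=; rewrite sub0r normrN ger0_norm ?nrm_ge0.
  by rewrite (nrm_subC f (G n)) (splitr e); apply: lerD; exact: q.
exists g; split => //; exists G; split.
- by move=> n; split => //; apply/L1P.
- exact/cvg_L2P.
- exact/cvg_L2P.
Qed.

Lemma L2_fourier f : L2 f -> L2 (fourier f).
Proof. by move=> /fourierP[]. Qed.

Lemma nrm_fourier f : L2 f -> nrm (fourier f) = nrm f.
Proof. by move=> /fourierP/is_fourier_nrm. Qed.

(** [fourier] selects representatives, so linearity is available through the relation [is_fourier]
    rather than as an equality of functions; the isometry applied to the difference gives all that
    polarization needs. *)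
Lemma nrm_fourierB f g : L2 f -> L2 g ->
  nrm (fourier f \- fourier g) = nrm (f \- g).
Proof. by move=> f2 g2; have /is_fourier_nrm := is_fourier_sub (fourierP f2) (fourierP g2). Qed.

Lemma polarization f g : L2 f -> L2 g ->
  ip f g = 2^-1 * (nrm f ^+ 2 + nrm g ^+ 2 - nrm (f \- g) ^+ 2).
Proof. by move=> f2 g2; rewrite !nrm_sq ip_BB//; field. Qed.

Lemma ip_fourier f g : L2 f -> L2 g -> ip (fourier f) (fourier g) = ip f g.
Proof.
move=> f2 g2; rewrite !polarization//; [|exact: L2_fourier..].
by rewrite !nrm_fourier// nrm_fourierB.
Qed.

(** Extends [fourier_L1_mult] by density in each argument in turn: one approximating sequence goes
    to its limit while the other is frozen, and symmetry of the formula allows a second pass. *)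
Lemma fourier_mult f g : L2 f -> L2 g ->
  ip (fourier f) (cjf g) = ip f (cjf (fourier g)).
Proof.
move=> f2 g2.
have [Ff2 Fg2] := (L2_fourier f2, L2_fourier g2).
have [G [Gi G2 Gf FGf]] := is_fourier_approx (fourierP f2).
have [H [Hi H2 Hg FHg]] := is_fourier_approx (fourierP g2).
have FG2 n : L2 (F (G n)) by have [] := fourier_L1_contraction (Gi n) (G2 n).
have FH2 n : L2 (F (H n)) by have [] := fourier_L1_contraction (Hi n) (H2 n).
have step m : ip (fourier f) (cjf (H m)) = ip f (cjf (F (H m))).
  have h1 := cvg_ip FG2 Ff2 (L2_cjf (H2 m)) FGf.
  have h2 := cvg_ip G2 f2 (L2_cjf (FH2 m)) Gf.
  have h3 : (fun n => ip (F (G n)) (cjf (H m))) = (fun n => ip (G n) (cjf (F (H m)))).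
    by apply/funext => n; exact: fourier_L1_mult.
  by rewrite h3 in h1; exact: cvg_unique h1 h2.
have h1 := cvg_ip H2 g2 (L2_cjf Ff2) Hg.
have h2 := cvg_ip FH2 Fg2 (L2_cjf f2) FHg.
have h3 : (fun n => ip (H n) (cjf (fourier f))) = (fun n => ip (F (H n)) (cjf f)).
  by apply/funext => n; rewrite -ip_cjfl ipC step ipC ip_cjfl.
rewrite h3 in h1.
have E : ip g (cjf (fourier f)) = ip (fourier g) (cjf f) by exact: cvg_unique h1 h2.
by rewrite ipC ip_cjfl E ipC ip_cjfl.
Qed.

(* [|F J F h - J h|^2 = 2 |h|^2 - 2 <F J F h, J h>], and the multiplication
   formula turns the last inner product into [|h|^2]. *)
Lemma fourier_inversion h : L2 h ->
  nrm (fourier (cjf (fourier h)) \- cjf h) = 0.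
Proof.
move=> h2.
have Fh2 := L2_fourier h2; have JFh2 := L2_cjf Fh2; have FJ2 := L2_fourier JFh2.
have Jh2 := L2_cjf h2.
rewrite /nrm ip_BB// fourier_mult// -!nrm_sq nrm_fourier// !nrm_cjf nrm_fourier//.
rewrite (_ : _ - _ + _ = 0) ?sqrtr0//; ring.
Qed.

(** Conjugating before and after replaces exp(-2 i pi x.xi) by its conjugate, so this is the inverse
    transform. *)
Definition fourier_inv h : fct := cjf (fourier (cjf h)).

Lemma L2_fourier_inv h : L2 h -> L2 (fourier_inv h).
Proof. by move=> h2; apply: L2_cjf; apply: L2_fourier; exact: L2_cjf. Qed.

Lemma fourier_invK h : L2 h -> ae_eqc (fourier (fourier_inv h)) h.
Proof.
move=> h2; have Jh2 := L2_cjf h2; apply: nrm0_ae => //.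
  by apply: L2_fourier; exact: L2_fourier_inv.
by have := fourier_inversion Jh2; rewrite cjfK.
Qed.

(** For a bounded multiplier the class from which [fourier_multiplier] selects is nonempty, so its
    default value 0 is not what is returned. *)
Lemma fourier_multiplierP (m : Rd R d -> R) (M : R) f : measurable_fun setT m ->
  (forall x, `|m x| <= M) -> L2 f ->
  L2 (fourier_multiplier m f) /\
  ae_eqc (fourier (fourier_multiplier m f)) (fun xi => (m xi)%:C%C * fourier f xi).
Proof.
move=> mm mM f2; rewrite /fourier_multiplier.
apply: (@xgetPex _ _ [set g | cLfun 2%:E g /\
    ae_eqc (fourier g) (fun xi => (m xi)%:C%C * fourier f xi)]).
have mf2 := L2_bounded mm mM (L2_fourier f2).
exists (fourier_inv (fun xi => (m xi)%:C%C * fourier f xi)); split.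
  exact: L2_fourier_inv.
exact: fourier_invK.
Qed.

Lemma ip_fourier_multiplier (m : Rd R d -> R) (M : R) f g : measurable_fun setT m ->
  (forall x, `|m x| <= M) -> L2 f -> L2 g ->
  ip (fourier_multiplier m f) g = ip (fun xi => (m xi)%:C%C * fourier f xi) (fourier g).
Proof.
move=> mm mM f2 g2; have [Mf2 Mf] := fourier_multiplierP mm mM f2.
rewrite -ip_fourier//; apply: ae_ip => //.
- by apply: L2_cmeas; exact: L2_fourier.
- by apply: L2_cmeas; apply: (L2_bounded mm mM); exact: L2_fourier.
- by apply: L2_cmeas; exact: L2_fourier.
Qed.

Lemma fourier_multiplier_adj (m : Rd R d -> R) (M : R) f g : measurable_fun setT m ->
  (forall x, `|m x| <= M) -> L2 f -> L2 g ->
  ip (fourier_multiplier m f) g = ip f (fourier_multiplier m g).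
Proof.
move=> mm mM f2 g2; rewrite (ip_fourier_multiplier mm mM f2 g2).
by rewrite [RHS]ipC (ip_fourier_multiplier mm mM g2 f2) ipMl ipC.
Qed.

Lemma nrm_fourier_multiplier (m : Rd R d -> R) (M : R) f : measurable_fun setT m ->
  (forall x, `|m x| <= M) -> L2 f -> nrm (fourier_multiplier m f) <= M * nrm f.
Proof.
move=> mm mM f2; have [Mf2 Mf] := fourier_multiplierP mm mM f2.
rewrite -nrm_fourier// (ae_nrm _ _ Mf).
- by rewrite -(nrm_fourier f2); apply: nrm_bounded => //; exact: L2_fourier.
- by apply: L2_cmeas; exact: L2_fourier.
- by apply: L2_cmeas; apply: (L2_bounded mm mM); exact: L2_fourier.
Qed.

Lemma nrm_cst0 : nrm (cst 0 : fct) = 0.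
Proof.
rewrite /nrm (_ : ip _ _ = 0) ?sqrtr0//.
transitivity (\int[mu]_x (0 : R)); last by rewrite /Rintegral integral0.
by apply: eq_Rintegral => x _; rewrite /cdot /= mulr0 addr0.
Qed.

End fourier_L2.

(** * Mittag-Leffler functions *)

Section gamma_beta.
Context {R : realType}.
Local Notation leb := (@lebesgue_measure R).

(** The kernel of fractional integration of order [a], up to the factor 1/Gamma(a). The cut-off at 0
    turns convolutions over ]0, t[ into integrals over the whole line, to which translation, scaling
    and Tonelli apply directly. *)
Definition pk (a t : R) : R := if 0 < t then t `^ (a - 1) else 0.

Lemma pk_ge0 a t : 0 <= pk a t.
Proof. by rewrite /pk; case: ifP => // _; exact: powR_ge0. Qed.

Lemma pkE a t : 0 < t -> pk a t = t `^ (a - 1). Proof. by rewrite /pk => ->. Qed.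

Lemma pk_gt0 a t : 0 < t -> 0 < pk a t.
Proof. by move=> t0; rewrite pkE// powR_gt0. Qed.

Lemma pk0 a t : t <= 0 -> pk a t = 0. Proof. by rewrite /pk ltNge => ->. Qed.

Lemma measurable_pk a : measurable_fun setT (pk a).
Proof.
rewrite (_ : pk a = (fun t => \1_(`]0, +oo[%classic : set R) t * t `^ (a - 1))).
  apply: measurable_funM; first exact: measurable_indic.
  exact: measurable_powR.
apply/funext => t; rewrite /pk indicE; case: ifPn => t0.
  by rewrite mem_set ?mul1r//= in_itv/= t0.
by rewrite memNset ?mul0r//= in_itv/= andbT; exact/negP.
Qed.

Lemma pk_scale a t s : 0 < t -> pk a (t * s) = t `^ (a - 1) * pk a s.
Proof.
move=> t0; rewrite /pk pmulr_rgt0//; case: ifPn => s0; last by rewrite mulr0.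
by rewrite powRM// ltW.
Qed.

(** Away from the singularity the primitive t^a / a applies and gives at most 1/a; monotone
    convergence over [1/(n+1), 1] does the rest. *)
Lemma pk_itv_lty (a : R) : 0 < a -> (\int[leb]_(t in `]0%R, 1%R]) (pk a t)%:E < +oo)%E.
Proof.
move=> a0.
pose I n : set R := `[n.+1%:R^-1, 1]%classic.
have IU : \bigcup_n I n = `]0, 1]%classic.
  apply/seteqP; split => t /=.
    move=> [n _]; rewrite /I /= !in_itv/= => /andP[nt ->]; rewrite andbT.
    by apply: lt_le_trans nt; rewrite invr_gt0.
  rewrite in_itv/= => /andP[t0 t1]; exists (Num.truncn t^-1) => //=.
  rewrite /I /= in_itv/= t1 andbT invf_ple ?posrE//.
  by rewrite ltW// truncnS_gt.
have H : (\int[leb]_(t in I n) (pk a t)%:E)%E @[n --> \oo] --> (\int[leb]_(t in `]0%R, 1%R]) (pk a t)%:E)%E.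
  rewrite -IU; apply: ge0_nondecreasing_set_cvg_integral.
  - move=> m n mn; apply/subsetPset => t; rewrite /I /= !in_itv/= => /andP[mt ->].
    by rewrite andbT (le_trans _ mt)// lef_pV2 ?posrE// ler_nat ltnS.
  - by move=> n; exact: measurable_itv.
  - by move=> n; apply/measurable_EFinP/measurable_funTS; exact: measurable_pk.
  - by move=> n t _; rewrite lee_fin pk_ge0.
apply: (@le_lt_trans _ _ (a^-1)%:E); last by rewrite ltry.
rewrite -(cvg_lim _ H)//; apply: lime_le; first by apply/cvg_ex; eexists; exact: H.
apply: nearW => n; rewrite /I.
have n0 : 0 < (n.+1%:R^-1 : R) by rewrite invr_gt0.
have := n0; set e : R := n.+1%:R^-1 => e0.
(* For [n = 0] the interval degenerates to the point 1. *)
have [e1|e1] := ltP e 1; last first.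
  apply: (@le_trans _ _ 0%E); last by rewrite lee_fin invr_ge0 ltW.
  have : (`[e, 1]%classic : set R) `<=` [set 1].
    by move=> t /=; rewrite in_itv/= => /andP[h1 h2]; apply/eqP; rewrite eq_le h2 (le_trans e1).
  move=> sub; apply: (@le_trans _ _ (\int[leb]_(t in [set 1%R]) (pk a t)%:E)%E); last by rewrite integral_set1.
  apply: ge0_subset_integral => //.
  - by apply/measurable_EFinP/measurable_funTS; exact: measurable_pk.
  - by move=> t _; rewrite lee_fin pk_ge0.
have D (x : R) : 0 < x -> is_derive x (1 : R) (fun t : R => a^-1 * t `^ a) (x `^ (a - 1)).
  move=> x0; have dp := is_derive1_powR a x0.
  apply: is_derive_eq; rewrite /GRing.scale /= mulrA mulVf ?mul1r// gt_eqF//.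
have -> : (\int[leb]_(t in `[e, 1%R]) (pk a t)%:E = \int[leb]_(t in `[e, 1%R]) (t `^ (a - 1))%:E)%E.
  by apply: eq_integral => t; rewrite inE /= in_itv/= => /andP[et _]; rewrite pkE// (lt_le_trans e0).
have cD (b x : R) : 0 < x -> {for x, continuous (fun t : R => t `^ b)}.
  move=> x0; have [dp _] := is_derive1_powR b x0.
  by have /derivable1_diffP/differentiable_continuous := dp.
rewrite (@continuous_FTC2 _ _ (fun t : R => a^-1 * t `^ a))//.
- rewrite powR1 mulr1 -EFinB lee_fin lerBlDr lerDl mulr_ge0 ?powR_ge0//.
  by rewrite invr_ge0 ltW.
- apply/continuous_within_itvP => //; split.
  + by move=> x; rewrite in_itv/= => /andP[ex _]; apply: cD; exact: lt_trans ex.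
  + by apply: cvg_at_right_filter; exact: cD.
  + by apply: cvg_at_left_filter; exact: cD.
- split=> [x| |].
  + by rewrite in_itv/= => /andP[ex _]; have [] := D x (lt_trans e0 ex).
  + by apply: cvg_at_right_filter; apply: cvgM; [exact: cvg_cst|exact: cD].
  + by apply: cvg_at_left_filter; apply: cvgM; [exact: cvg_cst|exact: cD].
- move=> x; rewrite in_itv/= => /andP[ex _]; rewrite derive1E.
  by have /@derive_val -> := D x (lt_trans e0 ex).
Qed.

(** A single term of the exponential series at t/2, of integer order above [p], dominates the power;
    this is where the factorial constant comes from. *)
Lemma le_powR_expR (p : R) : exists2 C, 0 < C & forall t, 1 <= t -> t `^ p <= C * expR (t / 2).
Proof.
have [N pN] : exists N : nat, p <= N%:R.
  by exists (Num.truncn p).+1; rewrite ltW// truncnS_gt.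
exists (2 ^+ N.+1 * (N.+1)`!%:R); first by rewrite mulr_gt0 ?exprn_gt0 ?ltr0n ?fact_gt0.
move=> s s1; have s0 : 0 <= s / 2 by rewrite divr_ge0// (le_trans ler01).
apply: (@le_trans _ _ (s ^+ N.+1)).
  rewrite -powR_mulrn ?(le_trans ler01)//; apply: ler_powR => //.
  by rewrite (le_trans pN)// ler_nat.
have := expR_ge1Dxn N s0; rewrite -lerBrDl => h.
rewrite -mulrA -ler_pdivrMl ?exprn_gt0//.
apply: (@le_trans _ _ ((N.+1)`!%:R * ((s / 2) ^+ N.+1 / (N.+1)`!%:R))).
  by rewrite mulrCA divff ?mulr1 ?pnatr_eq0 -?lt0n ?fact_gt0// expr_div_n mulrC.
by rewrite ler_wpM2l// (le_trans h)// gerBl.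
Qed.

Lemma measurable_expN : measurable_fun setT (fun t : R => expR (- t)).
Proof. by apply: measurableT_comp => //; exact: measurable_funN. Qed.

Lemma integral_exp_decay (c : R) : 0 < c -> (\int[leb]_(t in `[0%R, +oo[) (expR (- (c * t)))%:E = (c^-1)%:E)%E.
Proof.
move=> c0.
have := integral_expabs c0; rewrite ge0_symfun_integralT; last 3 first.
- by move=> x; exact: expabs_ge0.
- exact: continuous_expabs.
- by move=> x; rewrite /= /expabs normrN.
rewrite -set_itvcy.
have -> : (\int[leb]_(t in `[0%R, +oo[) (expabs c t)%:E =
    \int[leb]_(t in `[0%R, +oo[) (expR (- (c * t)))%:E)%E.
  by apply: eq_integral => t; rewrite inE /= in_itv/= andbT => t0; rewrite /expabs ger0_norm.
move=> /(congr1 (fun z => (2^-1)%:E * z)%E).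
rewrite muleA -!EFinM mulVf ?mul1e// => ->.
by congr EFin; field; rewrite gt_eqF.
Qed.

Lemma Gamma_lty (a : R) : 0 < a -> (\int[leb]_t (pk a t * expR (- t))%:E < +oo)%E.
Proof.
move=> a0.
have mf : measurable_fun setT (fun t => (pk a t * expR (- t))%:E).
  apply/measurable_EFinP; apply: measurable_funM; first exact: measurable_pk.
  exact: measurable_expN.
have f0 t : (0 <= (pk a t * expR (- t))%:E)%E by rewrite lee_fin mulr_ge0 ?pk_ge0 ?expR_ge0.
rewrite -(setUv (`]-oo, 1]%classic : set R)) ge0_integral_setU//; last 3 first.
- exact: measurableC.
- exact: measurable_funTS.
- by apply/disj_setPS => t [].
rewrite setCitvl lte_add_pinfty//.
  apply: (@le_lt_trans _ _ (\int[leb]_(t in `]0%R, 1%R]) (pk a t)%:E)%E); last exact: pk_itv_lty.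
  rewrite integral_mkcond [leRHS]integral_mkcond; apply: ge0_le_integral => //.
  - by move=> t _; apply: erestrict_ge0.
  - by apply/(measurable_restrictT _ _).1 => //; exact: measurable_funTS.
  - apply/(measurable_restrictT _ _).1 => //.
    by apply/measurable_EFinP/measurable_funTS; exact: measurable_pk.
  - move=> t _; rewrite /patch; case: ifPn => [|_].
      rewrite inE /= in_itv/= => t1; case: ifPn => [|].
        by rewrite inE /= in_itv/= => /andP[t0 _]; rewrite lee_fin ler_piMr ?pk_ge0// -expR0 ler_expR oppr_le0 ltW.
      rewrite notin_setE /= in_itv/= t1 andbT => /negP; rewrite -leNgt => t0.
      by rewrite pk0// mul0r.
    by case: ifPn => // _; rewrite lee_fin pk_ge0.
have [C C0 CP] := le_powR_expR (a - 1).
apply: (@le_lt_trans _ _ (\int[leb]_(t in `]1%R, +oo[) (C%:E * (expR (- (2^-1 * t)))%:E))%E).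
  apply: ge0_le_integral => //.
  - exact: measurable_funTS.
  - apply/measurable_EFinP/measurable_funTS; apply: measurable_funM => //.
    by apply: measurableT_comp => //; apply: measurable_funN; apply: measurable_funM.
  - move=> t /=; rewrite in_itv/= andbT => t1; rewrite lee_fin pkE ?(lt_trans _ t1)//.
    rewrite (_ : - (2^-1 * t) = t / 2 + - t); last by field.
    by rewrite expRD mulrA ler_wpM2r ?expR_ge0// CP// ltW.
apply: (@le_lt_trans _ _ (\int[leb]_(t in `[0%R, +oo[) (C%:E * (expR (- (2^-1 * t)))%:E))%E).
  apply: ge0_subset_integral => //.
  - apply/measurable_EFinP/measurable_funTS; apply: measurable_funM => //.
    by apply: measurableT_comp => //; apply: measurable_funN; apply: measurable_funM.
  - by move=> t _; rewrite lee_fin mulr_ge0 ?expR_ge0// ltW.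
  - by move=> t /=; rewrite !in_itv/= !andbT => /ltW; apply: le_trans.
rewrite ge0_integralZl//; last 2 first.
- apply/measurable_EFinP/measurable_funTS.
  by apply: measurableT_comp => //; apply: measurable_funN; apply: measurable_funM.
- by rewrite lee_fin ltW.
by rewrite integral_exp_decay// -EFinM ltry.
Qed.

Lemma GammaE (a : R) : 0 < a -> (\int[leb]_t (pk a t * expR (- t))%:E = (Gamma a)%:E)%E.
Proof.
move=> a0; rewrite /Gamma /Rintegral.
have -> : (\int[leb]_(t in `]0%R, +oo[) (t `^ (a - 1) * expR (- t))%:E =
    \int[leb]_t (pk a t * expR (- t))%:E)%E.
  rewrite integral_mkcond; apply: eq_integral => t _; rewrite /patch.
  case: ifPn => [|]; first by rewrite inE /= in_itv/= andbT => t0; rewrite pkE.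
  by rewrite notin_setE /= in_itv/= andbT => /negP; rewrite -leNgt => t0; rewrite pk0// mul0r.
rewrite fineK// ge0_fin_numE; first exact: Gamma_lty.
by apply: integral_ge0 => t _; rewrite lee_fin mulr_ge0 ?pk_ge0 ?expR_ge0.
Qed.

(** Keep only the part of the integral over [M, M+1]; the factor 1/2 covers exponents a - 1 between
    -1 and 0. Since [M] is free, [Gamma] outgrows every geometric sequence. *)
Lemma Gamma_lower (a M : R) : 0 < a -> 1 <= M -> M `^ (a - 1) * expR (- (M + 1)) / 2 <= Gamma a.
Proof.
move=> a0 M1; rewrite -lee_fin -GammaE//.
have M0 : 0 < M by exact: lt_le_trans M1.
apply: (@le_trans _ _ (\int[leb]_(t in `[M, (M + 1)%R]) (M `^ (a - 1) * expR (- (M + 1)) / 2)%:E)%E).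
  rewrite integral_cst//= lebesgue_measure_itv/= lte_fin ltrDl ltr01 -EFinD.
  by rewrite addrAC subrr add0r mule1.
apply: (@le_trans _ _ (\int[leb]_(t in `[M, (M + 1)%R]) (pk a t * expR (- t))%:E)%E); last first.
  apply: ge0_subset_integral => //.
    apply/measurable_EFinP; apply: measurable_funM; first exact: measurable_pk.
    exact: measurable_expN.
  by move=> t _; rewrite lee_fin mulr_ge0 ?pk_ge0 ?expR_ge0.
apply: ge0_le_integral => //.
- by move=> t _; rewrite lee_fin divr_ge0// mulr_ge0 ?powR_ge0 ?expR_ge0.
- apply/measurable_EFinP/measurable_funTS; apply: measurable_funM; first exact: measurable_pk.
  exact: measurable_expN.
move=> t /=; rewrite in_itv/= => /andP[Mt tM]; rewrite lee_fin.
have t0 : 0 < t by exact: lt_le_trans Mt.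
rewrite pkE// mulrAC ler_pM ?divr_ge0 ?powR_ge0 ?expR_ge0//; last by rewrite ler_expR lerN2.
have h : M `^ (a - 1) / 2 <= M `^ (a - 1) * (t / M) `^ (a - 1).
  rewrite ler_wpM2l ?powR_ge0//.
  have tM1 : 1 <= t / M by rewrite ler_pdivlMr// mul1r.
  have tM2 : t / M <= 2 by rewrite ler_pdivrMr//; lra.
  apply: (@le_trans _ _ ((t / M) `^ (-1))); last by apply: ler_powR => //; lra.
  rewrite powR_inv1 ?(le_trans ler01)// lef_pV2 ?posrE//; exact: lt_le_trans tM1.
by rewrite (le_trans h)// -powRM ?divr_ge0 ?(ltW t0) ?(ltW M0)// mulrCA divff ?mulr1 ?gt_eqF.
Qed.

Lemma Gamma_gt0 (a : R) : 0 < a -> 0 < Gamma a.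
Proof.
move=> a0; apply: lt_le_trans (Gamma_lower a0 (lexx 1)).
by rewrite divr_gt0// mulr_gt0 ?expR_gt0// powR_gt0.
Qed.

Lemma Gamma1 : Gamma (1 : R) = 1.
Proof.
apply/eqP; rewrite -eqe -GammaE//.
have := integral_exp_decay (@ltr01 R); rewrite invr1 => <-.
rewrite [X in _ == X]integral_mkcond; apply/eqP.
rewrite -integral_mkcond -integral_itv_obnd_cbnd; last first.
  apply/measurable_EFinP/measurable_funTS.
  by apply: measurableT_comp => //; apply: measurable_funN; apply: measurable_funM.
rewrite [RHS]integral_mkcond; apply: eq_integral => t _; rewrite /patch.
case: ifPn => [|].
  by rewrite inE /= in_itv/= andbT => t0; rewrite pkE// subrr powRr0 !mul1r.
by rewrite notin_setE /= in_itv/= andbT => /negP; rewrite -leNgt => t0; rewrite pk0// mul0r.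
Qed.

Let conv (a b t : R) : \bar R := (\int[leb]_s (pk a (t - s) * pk b s)%:E)%E.

Let conv_scale (a b t : R) : 0 < t -> conv a b t = ((t `^ (a + b - 1))%:E * conv a b 1)%E.
Proof.
move=> t0; rewrite /conv.
have mf (u : R) : measurable_fun setT (fun s : R => (pk a (u - s) * pk b s)%:E).
  apply/measurable_EFinP; apply: measurable_funM; last exact: measurable_pk.
  by apply: (measurableT_comp (@measurable_pk a)); apply: measurable_funB.
have f0 (u s : R) : (0 <= (pk a (u - s) * pk b s)%:E)%E by rewrite lee_fin mulr_ge0 ?pk_ge0.
have -> : (\int[leb]_s (pk a (t - s) * pk b s)%:E = t%:E * \int[leb]_s (pk a (t - t * s) * pk b (t * s))%:E)%E.
  have -> := ge0_integral_scale t0 (mf t) (f0 t).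
  by rewrite muleA -EFinM divff ?gt_eqF// mul1e.
have E s : (pk a (t - t * s) * pk b (t * s))%:E =
    ((t `^ (a - 1 + (b - 1)))%:E * (pk a (1 - s) * pk b s)%:E)%E.
  rewrite -[X in X - t * s]mulr1 -mulrBr !pk_scale// -EFinM; congr EFin.
  by rewrite [in RHS]powRD ?(gt_eqF t0) ?implybT// mulrACA.
under eq_integral do rewrite E.
rewrite ge0_integralZl// ?lee_fin ?powR_ge0//; last exact: mf.
rewrite muleA -EFinM; congr (_%:E * _)%E.
rewrite -{1}(powRr1 (ltW t0)) -powRD ?(gt_eqF t0) ?implybT//; congr (_ `^ _); ring.
Qed.

(* The Beta integral, in the form of the semigroup law of fractional integration. *)
Lemma conv_pk (a b t : R) : 0 < a -> 0 < b -> 0 < t ->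
  (\int[leb]_s (pk a (t - s) * pk b s)%:E =
   (Gamma a * Gamma b / Gamma (a + b) * t `^ (a + b - 1))%:E)%E.
Proof.
move=> a0 b0 t0; have ab0 := addr_gt0 a0 b0.
rewrite -/(conv a b t) conv_scale//.
(* Scaling leaves the constant at t = 1 to be found; it is identified by computing Gamma(a) Gamma(b)
   as a double integral in both orders. The finite left-hand side also excludes an infinite
   constant. *)
suff : ((Gamma a * Gamma b)%:E = (Gamma (a + b))%:E * conv a b 1)%E.
  have := Gamma_gt0 ab0; case: (conv a b 1) => [r||] /= g0.
  - rewrite -!EFinM => -[->]; congr EFin.
    by rewrite [X in X / _]mulrC mulfK ?gt_eqF// mulrC.
  - by rewrite gt0_muley ?lte_fin.
  - by rewrite gt0_muleNy ?lte_fin.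
pose f (z : R * R) : R := pk a (z.1 - z.2) * pk b z.2 * expR (- z.1).
have mf : measurable_fun setT f.
  apply: measurable_funM; last exact: (measurableT_comp measurable_expN measurable_fst).
  apply: measurable_funM; last exact: (measurableT_comp (@measurable_pk b) measurable_snd).
  apply: (measurableT_comp (@measurable_pk a)).
  by apply: measurable_funB; [exact: measurable_fst|exact: measurable_snd].
have f0 z : 0 <= f z by rewrite !mulr_ge0 ?pk_ge0 ?expR_ge0.
transitivity (\int[leb]_s \int[leb]_u (f (u, s))%:E)%E.
  transitivity (\int[leb]_s ((Gamma a)%:E * (pk b s * expR (- s))%:E))%E.
    rewrite ge0_integralZl//; first by rewrite GammaE// EFinM.
    - apply/measurable_EFinP; apply: measurable_funM; first exact: measurable_pk.
      exact: measurable_expN.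
    - by move=> s _; rewrite lee_fin mulr_ge0 ?pk_ge0 ?expR_ge0.
    - by rewrite lee_fin ltW// Gamma_gt0.
  apply: eq_integral => s _; rewrite muleC -GammaE//.
  have mg : measurable_fun setT (fun u => (pk a u * expR (- u))%:E).
    apply/measurable_EFinP; apply: measurable_funM; first exact: measurable_pk.
    exact: measurable_expN.
  rewrite -(ge0_integral_shift (- s) mg); last by move=> u; rewrite lee_fin mulr_ge0 ?pk_ge0 ?expR_ge0.
  rewrite -ge0_integralZl//.
  - apply: eq_integral => u _; rewrite -EFinM /f /=; congr EFin.
    rewrite (_ : - u = - (u - s) + - s); last by ring.
    by rewrite expRD; ring.
  - apply/measurable_EFinP; apply: measurable_funM.
      by apply: (measurableT_comp (@measurable_pk a)); apply: measurable_funD.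
    by apply: (measurableT_comp measurable_expN); apply: measurable_funD.
  - by move=> u _; rewrite lee_fin mulr_ge0 ?pk_ge0 ?expR_ge0.
  - by rewrite lee_fin mulr_ge0 ?pk_ge0 ?expR_ge0.
transitivity (\int[leb]_u \int[leb]_s (f (u, s))%:E)%E.
  symmetry; apply: (@fubini_tonelli _ _ _ _ _ leb leb (EFin \o f)).
    by apply/measurable_EFinP.
  by move=> z; rewrite lee_fin.
have c10 : (0 <= conv a b 1)%E.
  by apply: integral_ge0 => s _; rewrite lee_fin mulr_ge0 ?pk_ge0.
rewrite -GammaE// -ge0_integralZr//; last 2 first.
- apply/measurable_EFinP; apply: measurable_funM; first exact: measurable_pk.
  exact: measurable_expN.
- by move=> s _; rewrite lee_fin mulr_ge0 ?pk_ge0 ?expR_ge0.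
apply: eq_integral => u _; rewrite /f /=.
have [u0|u0] := ltP 0 u.
  transitivity ((expR (- u))%:E * conv a b u)%E.
    rewrite /conv -ge0_integralZl ?lee_fin ?expR_ge0//.
    - by apply: eq_integral => s _; rewrite mulrC EFinM.
    - apply/measurable_EFinP; apply: measurable_funM; last exact: measurable_pk.
      by apply: (measurableT_comp (@measurable_pk a)); apply: measurable_funB.
    - by move=> s _; rewrite lee_fin mulr_ge0 ?pk_ge0.
  by rewrite conv_scale// pkE// muleA -EFinM [X in X%:E]mulrC.
rewrite pk0// mul0r mul0e; apply: integral0_eq => s _.
have [s0|s0] := ltP 0 s; last by rewrite (@pk0 b)// mulr0 mul0r.
by rewrite pk0 ?mul0r// subr_le0 (le_trans u0)// ltW.
Qed.

End gamma_beta.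

(** * Convergence, recursion and fractional integration of the series *)

Section mittag_leffler_series.
Context {R : realType}.
Variable al : R.
Hypothesis al0 : 0 < al.
Local Notation leb := (@lebesgue_measure R).

Lemma powR_le0_ger (r : R) : r <= 0 -> forall z w : R, 0 < z -> z <= w -> w `^ r <= z `^ r.
Proof.
move=> r0 z w z0 zw; have w0 := lt_le_trans z0 zw.
rewrite -[r]opprK !(powRN _ (- r)) lef_pV2 ?posrE ?powR_gt0//.
by apply: ge0_ler_powR; rewrite ?oppr_ge0// nnegrE ltW.
Qed.

Lemma ml_arg_gt0 (rho : R) (k : nat) : 0 < rho -> 0 < al * k%:R + rho.
Proof. by move=> r0; rewrite ltr_wpDl// mulr_ge0// ltW. Qed.

Lemma ml_coef_gt0 (rho : R) (k : nat) : 0 < rho -> 0 < (Gamma (al * k%:R + rho))^-1.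
Proof. by move=> r0; rewrite invr_gt0 Gamma_gt0// ml_arg_gt0. Qed.

(** The free parameter of [Gamma_lower] is taken so large that M^(-al) <= r. As [r] is arbitrary,
    the series defines an entire function. *)
Lemma ml_coef_le (rho r : R) : 0 < rho -> 0 < r ->
  exists2 C, 0 < C & forall k : nat, (Gamma (al * k%:R + rho))^-1 <= C * r ^+ k.
Proof.
move=> rho0 r0; set M := Num.max 1 (r `^ (- al^-1)).
have M1 : 1 <= M by rewrite le_max lexx.
have M0 : 0 < M by exact: lt_le_trans M1.
have hM : M `^ (- al) <= r.
  rewrite [leRHS](_ : r = (r `^ (- al^-1)) `^ (- al)); last first.
    by rewrite -powRrM mulrNN mulVf ?gt_eqF// powRr1// ltW.
  by apply: powR_le0_ger; [rewrite oppr_le0 ltW|exact: powR_gt0|rewrite le_max lexx orbT].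
exists (2 * expR (M + 1) * M `^ (1 - rho)).
  by rewrite !mulr_gt0 ?expR_gt0 ?powR_gt0.
move=> k; have ak := ml_arg_gt0 k rho0.
have low : 0 < M `^ (al * k%:R + rho - 1) * expR (- (M + 1)) / 2.
  by rewrite divr_gt0// mulr_gt0 ?expR_gt0 ?powR_gt0.
apply: (@le_trans _ _ (M `^ (al * k%:R + rho - 1) * expR (- (M + 1)) / 2)^-1).
  by rewrite lef_pV2 ?posrE ?Gamma_gt0//; exact: Gamma_lower.
rewrite !invfM invrK expRN invrK -powRN.
rewrite (_ : - (al * k%:R + rho - 1) = (1 - rho) + (- al) * k%:R); last by ring.
rewrite powRD ?(gt_eqF M0) ?implybT// powRrM powR_mulrn ?powR_ge0//.
rewrite (_ : _ * _ * _ * 2 = 2 * expR (M + 1) * M `^ (1 - rho) * (M `^ (- al)) ^+ k); last by ring.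
rewrite ler_wpM2l ?lerXn2r ?nnegrE ?powR_ge0 ?(ltW r0)//.
by rewrite !mulr_ge0 ?expR_ge0 ?powR_ge0.
Qed.

Lemma ml_coef_geo (rho X : R) : 0 < rho -> 0 < X ->
  exists2 C, 0 < C & forall k : nat, X ^+ k * (Gamma (al * k%:R + rho))^-1 <= C * 2^-1 ^+ k.
Proof.
move=> rho0 X0; have X20 : 0 < (2 * X)^-1 by rewrite invr_gt0 mulr_gt0.
have [C C0 CP] := ml_coef_le rho0 X20; exists C => // k.
apply: (le_trans (ler_wpM2l _ (CP k))); first by rewrite exprn_ge0// ltW.
by rewrite mulrCA -exprMn invfM mulrCA divff ?gt_eqF// mulr1.
Qed.

Definition ml_term (rho z : R) : R^nat := fun k => z ^+ k / Gamma (al * k%:R + rho).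
Definition mls (rho z : R) : R^nat := series (ml_term rho z).

Lemma geo_half_le (C : R) n : 0 <= C -> \sum_(0 <= k < n) C * 2^-1 ^+ k <= 2 * C.
Proof.
move=> C0; have := @geometric_seriesE _ C (2^-1 : R).
have h : (2^-1 : R) != 1 by rewrite lt_eqF// invf_lt1// ltr1n.
move=> /(_ h)/(congr1 (fun f => f n)); rewrite /series /geometric /= => ->.
rewrite (_ : (1 - 2^-1 : R) = 2^-1); last by field.
by rewrite invrK mulrC ler_wpM2l// ler_piMr// gerBl exprn_ge0.
Qed.

Lemma mls_le (rho X : R) : 0 < rho -> 0 < X ->
  exists2 C, 0 <= C & forall z n, `|z| <= X -> `|mls rho z n| <= C.
Proof.
move=> rho0 X0; have [C C0 CP] := ml_coef_geo rho0 X0.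
exists (2 * C); first by rewrite mulr_ge0// ltW.
move=> z n zX; rewrite /mls /series /=.
apply: (le_trans (ler_norm_sum _ _ _)); apply: le_trans (geo_half_le n (ltW C0)).
apply: ler_sum => k _; rewrite /ml_term normrM normrX.
rewrite (ger0_norm (ltW (ml_coef_gt0 k rho0))); apply: le_trans (CP k).
by rewrite ler_wpM2r ?(ltW (ml_coef_gt0 k rho0))// lerXn2r// nnegrE ltW.
Qed.

Lemma cvg_ml (rho z : R) : 0 < rho -> mls rho z n @[n --> \oo] --> mittag_leffler al rho z.
Proof.
move=> rho0; suff : cvgn (mls rho z) by [].
apply: normed_cvg; have X0 : 0 < `|z| + 1 by rewrite ltr_wpDl.
have [C C0 CP] := ml_coef_geo rho0 X0.
apply: (@series_le_cvg _ _ (geometric C 2^-1)) => //.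
- by move=> n /=.
- by move=> n; rewrite /geometric /= mulr_ge0 ?exprn_ge0// ltW.
- move=> k; rewrite /= normrM normrX.
  rewrite (ger0_norm (ltW (ml_coef_gt0 k rho0))); apply: le_trans (CP k).
  by rewrite ler_wpM2r ?(ltW (ml_coef_gt0 k rho0))// lerXn2r ?nnegrE ?(ltW X0)// lerDl.
- by apply: is_cvg_geometric_series; rewrite ger0_norm// invf_lt1// ltr1n.
Qed.

(** The factor (2X)^k replaces the sharper k X^(k-1): it is purely geometric, hence absorbed by the
    coefficients through [ml_coef_geo]. *)
Lemma expr_lip (X z w : R) k : 1 <= X -> `|z| <= X -> `|w| <= X ->
  `|z ^+ k - w ^+ k| <= (2 * X) ^+ k * `|z - w|.
Proof.
move=> X1 zX wX; have X0 : 0 <= X by exact: le_trans X1.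
elim: k => [|k IH]; first by rewrite !expr0 subrr normr0 mul1r.
rewrite (_ : z ^+ k.+1 - w ^+ k.+1 = z * (z ^+ k - w ^+ k) + (z - w) * w ^+ k); last first.
  by rewrite !exprS; ring.
apply: (le_trans (ler_normD _ _)); rewrite !normrM normrX.
have h1 : `|z| * `|z ^+ k - w ^+ k| <= X * ((2 * X) ^+ k * `|z - w|) by rewrite ler_pM.
have h2 : `|z - w| * `|w| ^+ k <= X * ((2 * X) ^+ k * `|z - w|).
  rewrite mulrC mulrA ler_wpM2r//; apply: (@le_trans _ _ (X ^+ k)).
    by rewrite lerXn2r ?nnegrE.
  rewrite exprMn mulrA ler_peMl ?exprn_ge0//.
  by rewrite mulr_ege1// exprn_ege1// ler1n.
have -> : (2 * X) ^+ k.+1 * `|z - w| = X * ((2 * X) ^+ k * `|z - w|) + X * ((2 * X) ^+ k * `|z - w|).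
  by rewrite exprS; ring.
exact: lerD.
Qed.

Lemma ml_lip (rho X : R) : 0 < rho -> exists2 L, 0 < L & forall z w, `|z| <= X -> `|w| <= X ->
  `|mittag_leffler al rho z - mittag_leffler al rho w| <= L * `|z - w|.
Proof.
move=> rho0; set Y := Num.max 1 X; have Y1 : 1 <= Y by rewrite le_max lexx.
have Y20 : 0 < 2 * Y by rewrite mulr_gt0// (lt_le_trans _ Y1).
have [C C0 CP] := ml_coef_geo rho0 Y20.
exists (2 * C); first by rewrite mulr_gt0.
move=> z w zX wX; have XY : X <= Y by rewrite le_max lexx orbT.
have H : `|mls rho z n - mls rho w n| @[n --> \oo] --> `|mittag_leffler al rho z - mittag_leffler al rho w|.
  by apply: cvg_norm; apply: cvgB; exact: cvg_ml.
rewrite -(cvg_lim _ H)//; apply: limr_le; first by apply/cvg_ex; eexists; exact: H.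
apply: nearW => n; rewrite /mls /series /= -sumrB.
apply: (le_trans (ler_norm_sum _ _ _)).
apply: (@le_trans _ _ ((\sum_(0 <= k < n) C * 2^-1 ^+ k) * `|z - w|)); last first.
  by rewrite ler_wpM2r// geo_half_le// ltW.
rewrite mulr_suml; apply: ler_sum => k _; rewrite /ml_term -mulrBl normrM.
rewrite (ger0_norm (ltW (ml_coef_gt0 k rho0))).
have := @expr_lip Y z w k Y1 (le_trans zX XY) (le_trans wX XY).
move=> /(ler_wpM2r (ltW (ml_coef_gt0 k rho0)))/le_trans; apply.
by rewrite mulrAC ler_wpM2r.
Qed.

Lemma continuous_ml (rho : R) : 0 < rho -> continuous (mittag_leffler al rho).
Proof.
move=> rho0 z; have [L L0 LP] := @ml_lip rho (`|z| + 1) rho0.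
apply/cvgrPdist_le => /= e e0; near=> w.
have zw1 : `|z - w| <= 1 by near: w; apply: (@cvgr_dist_le _ _ _ _ _ idfun z).
apply: (@le_trans _ _ (L * `|z - w|)).
  apply: LP; first by rewrite lerDl.
  by rewrite -lerBlDl (le_trans (lerB_dist _ _))// distrC.
rewrite mulrC -ler_pdivlMr//; near: w.
by apply: (@cvgr_dist_le _ _ _ _ _ idfun z) => //; rewrite divr_gt0.
Unshelve. all: by end_near. Qed.

Lemma measurable_ml (rho : R) : 0 < rho -> measurable_fun setT (mittag_leffler al rho).
Proof. by move=> rho0; apply: continuous_measurable_fun; exact: continuous_ml. Qed.

Lemma ml0 (rho : R) : 0 < rho -> mittag_leffler al rho 0 = (Gamma rho)^-1.
Proof.
move=> rho0; have H := @cvg_ml rho 0 rho0; rewrite -(cvg_lim _ H)//.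
apply: cvg_lim => //; rewrite -(cvg_shiftS (mls rho 0)).
rewrite (_ : (fun n => _) = fun=> (Gamma rho)^-1); first exact: cvg_cst.
apply/funext => n; rewrite /mls /series /= big_nat_recl// big1 => [|k _].
  by rewrite addr0 /ml_term expr0 mulr0 add0r mul1r.
by rewrite /ml_term exprS mul0r mul0r.
Qed.

(** Separating the term of index 0 and shifting the rest raises the second parameter by [al]. *)
Lemma ml_rec (rho z : R) : 0 < rho ->
  mittag_leffler al rho z = (Gamma rho)^-1 + z * mittag_leffler al (rho + al) z.
Proof.
move=> rho0; have ra0 := addr_gt0 rho0 al0.
have H := @cvg_ml rho z rho0; rewrite -(cvg_lim _ H)//.
apply: cvg_lim => //; rewrite -(cvg_shiftS (mls rho z)).
rewrite (_ : (fun n => _) = fun n => (Gamma rho)^-1 + z * mls (rho + al) z n).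
  by apply: cvgD; [exact: cvg_cst|apply: cvgM; [exact: cvg_cst|exact: cvg_ml]].
apply/funext => n; rewrite /mls /series /= big_nat_recl// mulr_sumr; congr (_ + _).
  by rewrite /ml_term expr0 mulr0 add0r mul1r.
apply: eq_bigr => k _; rewrite /ml_term exprS -mulrA; congr (_ * (_ / Gamma _)).
by rewrite -natr1; ring.
Qed.

(* [t ^ (rho - 1) E_{al,rho} (- lam t ^ al)] for [t > 0] *)
Definition mlk (rho lam t : R) : R := pk rho t * mittag_leffler al rho (- (lam * t `^ al)).

Lemma mlk0 (rho lam t : R) : t <= 0 -> mlk rho lam t = 0.
Proof. by move=> t0; rewrite /mlk pk0// mul0r. Qed.

Lemma mlk_rec (rho lam t : R) : 0 < rho ->
  mlk rho lam t = pk rho t / Gamma rho - lam * mlk (rho + al) lam t.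
Proof.
move=> rho0; have [t0|t0] := ltP 0 t; last by rewrite !mlk0// pk0// mul0r mulr0 subr0.
rewrite /mlk {1}ml_rec// mulrDr mulNr mulrN; congr (_ - _).
rewrite mulrCA -!mulrA; congr (_ * _); rewrite [RHS]mulrC [in LHS]mulrCA mulrC !pkE//.
rewrite mulrA; congr (_ * _); rewrite -powRD ?(gt_eqF t0) ?implybT//; congr (_ `^ _); ring.
Qed.

Lemma measurable_mlk (rho lam : R) : 0 < rho -> measurable_fun setT (mlk rho lam).
Proof.
move=> rho0; apply: measurable_funM; first exact: measurable_pk.
apply: (measurableT_comp (measurable_ml rho0)); apply: measurable_funN.
by apply: measurable_funM => //; exact: measurable_powR.
Qed.

(** Fractional integration of order [gam] moves the second parameter from [rho] to [rho + gam]: each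
    term of the series is a power, to which the Beta integral applies. Partial sums are bounded
    uniformly for s < t, which allows dominated convergence. *)
Lemma conv_mlk (rho gam lam t : R) : 0 < rho -> 0 < gam -> 0 < t ->
  leb.-integrable setT (fun s : R => (pk gam (t - s) * mlk rho lam s)%:E) /\
  (\int[leb]_s (pk gam (t - s) * mlk rho lam s)%:E = (Gamma gam * mlk (rho + gam) lam t)%:E)%E.
Proof.
move=> rho0 gam0 t0.
have mpk : measurable_fun setT (fun s : R => pk gam (t - s)).
  by apply: (measurableT_comp (@measurable_pk _ gam)); apply: measurable_funB.
pose F (n : nat) (s : R) := pk gam (t - s) * (pk rho s * mls rho (- (lam * s `^ al)) n).
have E n s : F n s = \sum_(0 <= k < n)
    ((- lam) ^+ k / Gamma (al * k%:R + rho)) * (pk gam (t - s) * pk (al * k%:R + rho) s).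
  rewrite /F /mls /series /= !mulr_sumr; apply: eq_bigr => k _.
  have [s0|s0] := ltP 0 s; last by rewrite !(pk0 _ s0) !(mul0r, mulr0).
  rewrite /ml_term -mulNr exprMn [pk (_ + _) s]pkE// -[al * _ + _ - 1]addrA.
  rewrite powRD ?(gt_eqF s0) ?implybT// powRrM powR_mulrn ?powR_ge0// (pkE rho s0); ring.
have ak k := ml_arg_gt0 k rho0.
have ipk (b : R) : 0 < b -> leb.-integrable setT (fun s : R => (pk gam (t - s) * pk b s)%:E).
  move=> b0; apply/integrableP; split.
    by apply/measurable_EFinP; apply: measurable_funM => //; exact: measurable_pk.
  rewrite (_ : (fun x => _) = fun s => (pk gam (t - s) * pk b s)%:E).
    by rewrite conv_pk// ltry.
  by apply/funext => s /=; rewrite ger0_norm// mulr_ge0 ?pk_ge0.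
have lat : 0 < `|lam * t `^ al| + 1 by rewrite ltr_wpDl.
have [C C0 CP] := mls_le rho0 lat.
have := @dominated_convergence _ _ R leb setT measurableT (fun n (s : R) => (F n s)%:E)
  (fun s : R => (pk gam (t - s) * mlk rho lam s)%:E)
  (fun s : R => (C%:E * (pk gam (t - s) * pk rho s)%:E)%E).
case.
- move=> n; apply/measurable_EFinP; rewrite (_ : F n = fun s => \sum_(0 <= k < n)
    ((- lam) ^+ k / Gamma (al * k%:R + rho)) * (pk gam (t - s) * pk (al * k%:R + rho) s)); last exact/funext/E.
  apply: measurable_sum => k; apply: measurable_funM => //; apply: measurable_funM => //.
  exact: measurable_pk.
- by apply/measurable_EFinP; apply: measurable_funM => //; exact: measurable_mlk.
- apply: aeW => s _; apply: cvg_EFin; first exact: nearW.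
  by apply: cvgM; [exact: cvg_cst|apply: cvgM; [exact: cvg_cst|exact: cvg_ml]].
- by apply: integrableZl => //; exact: ipk.
- apply: aeW => s n _; rewrite /= -EFinM lee_fin /F !normrM.
  rewrite (ger0_norm (pk_ge0 _ _)) (ger0_norm (pk_ge0 _ _)) mulrA mulrC.
  have [s0|s0] := ltP 0 s; last by rewrite (pk0 _ s0) !mulr0.
  have [ts|st] := leP t s; first by rewrite pk0 ?subr_le0// mul0r !mulr0.
  rewrite ler_wpM2r ?mulr_ge0 ?pk_ge0//; apply: CP; rewrite normrN !normrM.
  apply: (@le_trans _ _ (`|lam| * `|t `^ al|)); last by rewrite lerDl.
  rewrite ler_wpM2l// !ger0_norm ?powR_ge0//.
  by apply: ge0_ler_powR; rewrite ?nnegrE ltW.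
move=> intf _ cv; split => //.
rewrite -(cvg_lim (@ereal_hausdorff R) cv); apply: cvg_lim => //.
rewrite (_ : [sequence _]_n = fun n => (Gamma gam * (pk (rho + gam) t * mls (rho + gam) (- (lam * t `^ al)) n))%:E).
  apply: cvg_EFin; first exact: nearW.
  apply: cvgM; first exact: cvg_cst.
  by apply: cvgM; [exact: cvg_cst|apply: cvg_ml; exact: addr_gt0].
apply/funext => n /=.
transitivity (\sum_(0 <= k < n) (((- lam) ^+ k / Gamma (al * k%:R + rho))%:E *
    \int[leb]_s (pk gam (t - s) * pk (al * k%:R + rho) s)%:E))%E.
  transitivity (\int[leb]_s (\sum_(0 <= k < n) (((- lam) ^+ k / Gamma (al * k%:R + rho))%:E *
     (pk gam (t - s) * pk (al * k%:R + rho) s)%:E)))%E.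
    by apply: eq_integral => s _; rewrite E -sumEFin.
  rewrite integral_sum//; last by move=> k; apply: integrableZl => //; exact: ipk.
  by apply: eq_bigr => k _; rewrite integralZl//; exact: ipk.
rewrite /mls /series /= !mulr_sumr -sumEFin; apply: eq_bigr => k _.
rewrite conv_pk// -EFinM; congr EFin.
rewrite /ml_term -mulNr exprMn pkE// -(powR_mulrn k (powR_ge0 t al)) -powRrM.
rewrite (_ : gam + (al * k%:R + rho) - 1 = (rho + gam - 1) + al * k%:R); last by ring.
rewrite powRD ?(gt_eqF t0) ?implybT//.
rewrite (_ : gam + (al * k%:R + rho) = al * k%:R + (rho + gam)); last by ring.
have g1 := Gamma_gt0 (ak k); have g2 := Gamma_gt0 (ml_arg_gt0 k (addr_gt0 rho0 gam0)).
move: (Gamma _) (Gamma _) (t `^ _) (t `^ _) (Gamma gam) ((- lam) ^+ k) g1 g2.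
by move=> x y c1 c2 c3 c4 x0 y0; field; rewrite !gt_eqF.
Qed.

Lemma mlkE rho lam t : mlk rho lam t = pk rho t * mittag_leffler al rho (- (lam * t `^ al)).
Proof. by []. Qed.

End mittag_leffler_series.

(* Unification would otherwise unfold failed matches down to the integrals defining Gamma. *)
#[global] Opaque mlk.

(** * Nonnegativity of the resolvent and its consequences *)

Section mittag_leffler_sign.
Context {R : realType}.
Variable al : R.
Hypothesis al01 : 0 < al < 1.
Local Notation leb := (@lebesgue_measure R).

Let al0 : 0 < al. Proof. by case/andP: al01. Qed.
Let al1 : al < 1. Proof. by case/andP: al01. Qed.
Let Ga0 : 0 < Gamma al. Proof. exact: Gamma_gt0. Qed.

(** A convex function lies above its tangent, here x^(al-1) at [z]. Obtained from exp x >= 1 + x and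
    ln (1 + x) <= x, without differentiating. *)
Lemma powR_diff_ge (y z : R) : 0 < y -> y <= z ->
  (1 - al) * z `^ (al - 2) * (z - y) <= y `^ (al - 1) - z `^ (al - 1).
Proof.
move=> y0 yz; have z0 : 0 < z by exact: lt_le_trans yz.
have q0 : 0 < y / z by rewrite divr_gt0.
have h : 1 + (1 - al) * (1 - y / z) <= (y / z) `^ (al - 1).
  rewrite /powR gt_eqF//; apply: le_trans (expR_ge1Dx _); rewrite lerD2l.
  rewrite -[al - 1]opprB mulNr -mulrN ler_wpM2l ?subr_ge0 ?(ltW al1)//.
  have : -1 < y / z - 1 by rewrite ltrBDr addrC subrr.
  by move=> /le_ln1Dx; rewrite addrCA subrr addr0 => hl; rewrite -lerN2 opprK opprB.
have -> : y `^ (al - 1) = z `^ (al - 1) * (y / z) `^ (al - 1).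
  by rewrite -powRM ?ltW// mulrCA divff ?mulr1// gt_eqF.
have -> : (1 - al) * z `^ (al - 2) * (z - y) = z `^ (al - 1) * ((1 - al) * (1 - y / z)).
  have -> : z `^ (al - 1) = z `^ (al - 2) * z.
    by rewrite -[X in _ = _ * X](powRr1 (ltW z0)) -powRD ?(gt_eqF z0) ?implybT//; congr (_ `^ _); ring.
  by field; rewrite gt_eqF.
rewrite [leRHS](_ : _ = z `^ (al - 1) * ((y / z) `^ (al - 1) - 1)); last by rewrite mulrBr mulr1.
by rewrite ler_wpM2l ?powR_ge0// lerBrDl.
Qed.

Let E (x : R) := mittag_leffler al al (- x).
(** It is enough to treat lam = 1: as [s] varies, s^al runs through all arguments at which the sign
    of [E] is wanted. *)
Let f (s : R) := mlk al al 1 s.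

Let f_E s : f s = pk al s * E (s `^ al).
Proof. by rewrite /f mlkE /E mul1r. Qed.

(** The resolvent equation Gamma(al) f + pk * f = pk. *)
Let conv_f t : 0 < t ->
  leb.-integrable setT (fun s : R => (pk al (t - s) * f s)%:E) /\
  (\int[leb]_s (pk al (t - s) * f s)%:E = (pk al t - Gamma al * f t)%:E)%E.
Proof.
move=> t0; have [h1 ->] := conv_mlk al0 1 al0 al0 t0; split => //.
congr EFin; rewrite /f (mlk_rec al0 _ _ al0) mul1r mulrBr opprB.
by rewrite [_ * (pk _ _ / _)]mulrCA divff ?mulr1 ?gt_eqF// addrCA subrr addr0.
Qed.

Let integral_ind (a b c : R) : a <= b ->
  leb.-integrable setT (fun s : R => (c * \1_(`[a, b[%classic : set R) s)%:E) /\
  (\int[leb]_s (c * \1_(`[a, b[%classic : set R) s)%:E = (c * (b - a))%:E)%E.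
Proof.
move=> ab.
have i1 : leb.-integrable setT (fun s : R => (\1_(`[a, b[%classic : set R) s)%:E).
  exact: integrable_indic_itv.
split; first by under eq_fun do rewrite EFinM; exact: integrableZl.
under eq_integral do rewrite EFinM.
rewrite integralZl// integral_indic//= setIT lebesgue_measure_itv/= lte_fin EFinM.
case: ltP => [_|ba]; first by rewrite EFinB.
have -> : b - a = 0 by apply/eqP; rewrite subr_eq0 eq_le ba ab.
by [].
Qed.

Section first_zero.
Variables (t0 L eta : R).
Hypotheses (t00 : 0 < t0) (ft0 : f t0 <= 0) (fpos : forall s, 0 < s -> s < t0 -> 0 < f s).
Hypotheses (L0 : 0 < L) (fL : forall s, t0 / 2 <= s -> s < t0 -> f s <= L * (t0 - s)).
Hypotheses (eta0 : 0 < eta) (feta : forall s, 0 < s -> s <= t0 / 4 -> eta <= f s).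

(** Product of the lower bound of [powR_diff_ge] over [[t0/8, t0/4[], divided by [t0 - t], with the
    lower bound [eta] of [f] there; the 8 comes from s >= t0/8. *)
Let c := (1 - al) * t0 `^ (al - 2) / 8 * eta.

(** The equation at [t] is compared with (t/t0)^(al-1) times the equation at [t0], a factor for
    which the forcing terms cancel. For s < t the kernel difference is nonnegative, and on [t0/8,
    t0/4[ it is of order t0 - t. Negative values occur only on [t, t0[, where the Lipschitz decay of
    [f] makes them of order (t0 - t)^al. *)
Let pointwise t s : t0 / 2 <= t -> t < t0 ->
  c * (t0 - t) * \1_(`[t0 / 8, t0 / 4[%classic : set R) s -
    2 * L * (t0 - t) `^ al * \1_(`[t, t0[%classic : set R) s <=
  pk al (t - s) * f s - (t / t0) `^ (al - 1) * (pk al (t0 - s) * f s).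
Proof.
move=> t02 tt0; have tp : 0 < t by rewrite (lt_le_trans _ t02)// divr_gt0.
have r0 : 0 < t / t0 by rewrite divr_gt0.
have r1 : t / t0 < 1 by rewrite ltr_pdivrMr// mul1r.
have wE : (t / t0) `^ (al - 1) * pk al (t0 - s) = pk al (t - t / t0 * s).
  rewrite -pk_scale//; congr (pk _ _); field; rewrite gt_eqF//.
have mem a b : (\1_(`[a, b[%classic : set R) s : R) = ((a <= s) && (s < b))%:R.
  rewrite indicE; case: (boolP ((a <= s) && (s < b))) => h.
    by rewrite mem_set//= in_itv.
  by rewrite memNset//= in_itv/=; exact/negP.
rewrite !mem.
have [s0|s0] := leP s 0.
  rewrite /f mlk0// !mulr0 subr0.
  have -> : (t0 / 8 <= s) = false by apply/negbTE; rewrite -ltNge (le_lt_trans s0)// divr_gt0.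
  have -> : (t <= s) = false by apply/negbTE; rewrite -ltNge (le_lt_trans s0).
  by rewrite !mulr0 subr0.
have [st|ts] := ltP s t.
  rewrite /= mulr0 subr0 mulrA wE -mulrBl.
  have fs : 0 < f s by apply: fpos => //; exact: lt_trans tt0.
  have zy : (t - t / t0 * s) - (t - s) = s * (t0 - t) / t0 by field; rewrite gt_eqF.
  have y0 : 0 < t - s by rewrite subr_gt0.
  have yz : t - s <= t - t / t0 * s by rewrite lerD2l lerN2 ler_piMl// ltW.
  have z0 := lt_le_trans y0 yz.
  rewrite !pkE//; have D := powR_diff_ge y0 yz; rewrite zy in D.
  case: andP => [[h1 h2]|_]; last first.
    rewrite mulr0 mulr_ge0 ?(ltW fs)//; apply: le_trans D.
    by rewrite !mulr_ge0 ?powR_ge0 ?invr_ge0 ?subr_ge0// ltW.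
  rewrite mulr1 (_ : c * (t0 - t) = (1 - al) * t0 `^ (al - 2) / 8 * (t0 - t) * eta); last first.
    by rewrite /c; ring.
  apply: ler_pM; last by apply: feta => //; exact: ltW.
  - by rewrite !mulr_ge0 ?powR_ge0 ?invr_ge0 ?subr_ge0// ltW.
  - exact: ltW.
  apply: le_trans D.
  rewrite (_ : (1 - al) * t0 `^ (al - 2) / 8 * (t0 - t) = (1 - al) * (t0 `^ (al - 2) * ((t0 - t) / 8))); last by ring.
  rewrite -[leRHS]mulrA ler_wpM2l ?subr_ge0 ?(ltW al1)//.
  have zt0 : t - t / t0 * s <= t0.
    by rewrite (@le_trans _ _ t) ?(ltW tt0)// gerBl mulr_ge0 ?ltW.
  apply: ler_pM; rewrite ?powR_ge0 ?mulr_ge0 ?subr_ge0 ?(ltW tt0)//.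
    by apply: powR_le0_ger => //; rewrite subr_le0 (le_trans (ltW al1))// ler1n.
  rewrite [s * _]mulrC -mulrA ler_wpM2l ?subr_ge0 ?(ltW tt0)//.
  by rewrite ler_pdivlMr// mulrC.
have -> : (s < t0 / 4) = false.
  apply/negbTE; rewrite -leNgt (le_trans _ ts)// (le_trans _ t02)//.
  by rewrite ler_pM2l// lef_pV2 ?posrE// ler_nat.
rewrite andbF mulr0 sub0r pk0 ?subr_le0// mul0r sub0r lerN2.
have [st0|st0] := ltP s t0; last by rewrite (@pk0 _ _ (t0 - s)) ?subr_le0// mul0r !mulr0.
rewrite mulr1; have q : 0 < t0 - s by rewrite subr_gt0.
have t2s : t0 / 2 <= s by exact: le_trans ts.
have fs0 : 0 <= f s by rewrite ltW// fpos// (lt_le_trans tp).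
(* Since t >= t0/2 and the exponent is at least -1. *)
have w2 : (t / t0) `^ (al - 1) <= 2.
  apply: (@le_trans _ _ ((t / t0) `^ (-1))).
    by apply: ger_powR; rewrite ?r0 ?(ltW r1)// lerBrDl subrr ltW.
  rewrite powR_inv1 ?(ltW r0)// invf_div ler_pdivrMr// mulrC -ler_pdivrMr//.
apply: (@le_trans _ _ (2 * (pk al (t0 - s) * (L * (t0 - s))))).
  apply: ler_pM => //; [exact: powR_ge0|by rewrite mulr_ge0 ?pk_ge0|].
  by apply: ler_pM => //; [exact: pk_ge0|exact: fL].
rewrite (_ : 2 * _ = 2 * L * (pk al (t0 - s) * (t0 - s))); last by ring.
rewrite ler_wpM2l ?mulr_ge0 ?(ltW L0)// pkE// -[X in _ * X](powRr1 (ltW q)).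
rewrite -powRD ?(gt_eqF q) ?implybT// subrK.
by apply: ge0_ler_powR; rewrite ?nnegrE ?(ltW al0) ?(ltW q) ?subr_ge0 ?(ltW tt0)// lerD2l lerN2.
Qed.

(** The integral in [pointwise] is w Gamma(al) f(t0) - Gamma(al) f(t), which is at most 0. The gain
    is of order t0 - t, while the loss, over an interval of length t0 - t, is of order (t0 -
    t)^(1+al); one factor t0 - t is divided out. *)
Let first_zero_bound t : t0 / 2 <= t -> t < t0 -> c * (t0 / 8) <= 2 * L * (t0 - t) `^ al.
Proof.
move=> t02 tt0; have tp : 0 < t by rewrite (lt_le_trans _ t02)// divr_gt0.
have [i1 I1] := conv_f tp; have [i2 I2] := conv_f t00.
have h48 : t0 / 8 <= t0 / 4 by rewrite ler_pM2l// lef_pV2 ?posrE// ler_nat.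
have [j1 J1] := integral_ind (c * (t0 - t)) h48.
have [j2 J2] := integral_ind (2 * L * (t0 - t) `^ al) (ltW tt0).
set w := (t / t0) `^ (al - 1).
have i3 : leb.-integrable setT (fun s : R => (w%:E * (pk al (t0 - s) * f s)%:E)%E) by exact: integrableZl.
have : (\int[leb]_s ((c * (t0 - t) * \1_(`[(t0 / 8)%R, (t0 / 4)%R[%classic : set R) s)%:E -
    (2 * L * (t0 - t) `^ al * \1_(`[t, t0[%classic : set R) s)%:E) <=
  \int[leb]_s ((pk al (t - s) * f s)%:E - w%:E * (pk al (t0 - s) * f s)%:E))%E.
  apply: le_integral => //; [exact: integrableB|exact: integrableB|].
  by move=> s _; rewrite -EFinM -!EFinB lee_fin; exact: pointwise.
rewrite integralB// integralB// J1 J2 I1 integralZl// I2 -EFinM -!EFinB lee_fin.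
have -> : w * (pk al t0 - Gamma al * f t0) = pk al t - w * Gamma al * f t0.
  rewrite mulrBr mulrA; congr (_ - _).
  by rewrite /w !pkE// -powRM ?divr_ge0 ?ltW// mulrAC mulfK// gt_eqF.
move=> H.
have H1 : c * (t0 - t) * (t0 / 4 - t0 / 8) - 2 * L * (t0 - t) `^ al * (t0 - t) <= 0.
  apply: (le_trans H).
  have : 0 < Gamma al * f t by rewrite mulr_gt0// fpos.
  have : w * Gamma al * f t0 <= 0 by rewrite mulr_ge0_le0// mulr_ge0 ?powR_ge0// ltW.
  move: (w * _ * _) (Gamma al * _) (pk _ _) => x y z; lra.
have d0 : 0 < t0 - t by rewrite subr_gt0.
rewrite -(ler_pM2r d0) -subr_le0; apply: le_trans H1.
by rewrite le_eqVlt; apply/orP; left; apply/eqP; congr (_ - _); field.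
Qed.

Lemma no_first_zero : False.
Proof.
have c0 : 0 < c by rewrite !mulr_gt0 ?invr_gt0 ?subr_gt0 ?powR_gt0.
have q0 : 0 < c * t0 / (32 * L) by apply: divr_gt0; apply: mulr_gt0.
(* Chosen so that the right-hand side of [first_zero_bound] is at most c t0 / 16, half of its
   left-hand side. *)
pose del := Num.min (t0 / 2) ((c * t0 / (32 * L)) `^ al^-1).
have del0 : 0 < del by rewrite lt_min divr_gt0//= powR_gt0.
have dt : t0 / 2 <= t0 - del.
  rewrite lerBrDl -lerBrDr (_ : t0 - t0 / 2 = t0 / 2); last by field.
  by rewrite ge_min lexx.
have := @first_zero_bound (t0 - del) dt; rewrite gtrBl => /(_ del0).
rewrite opprB addrC subrK => h.
have : del `^ al <= c * t0 / (32 * L).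
  rewrite [leRHS](_ : _ = ((c * t0 / (32 * L)) `^ al^-1) `^ al); last first.
    by rewrite -powRrM mulVf ?gt_eqF// powRr1// ltW.
  by apply: ge0_ler_powR; rewrite ?nnegrE ?powR_ge0 ?(ltW del0) ?(ltW al0)// ge_min lexx orbT.
have L20 : 0 <= 2 * L by rewrite mulr_ge0// ltW.
move=> /(ler_wpM2l L20)/(le_trans h).
rewrite (_ : 2 * L * _ = c * t0 / 16); last by field; rewrite gt_eqF.
rewrite [X in X <= _](_ : _ = c * t0 * 8^-1); last by rewrite mulrA.
by rewrite (ler_pM2l (mulr_gt0 c0 t00)) lef_pV2 ?posrE// ler_nat.
Qed.

End first_zero.

(** Otherwise the infimum [x0] of the points with [E <= 0] is positive, because E 0 = 1/Gamma(al),
    and [E <= 0] at [x0] by continuity. The time t0 = x0^(1/al) is then a first zero as excluded by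
    [no_first_zero]. *)
Lemma ml_ge0 (x : R) : 0 <= x -> 0 <= mittag_leffler al al (- x).
Proof.
move=> x_ge0; rewrite leNgt; apply/negP => Ex.
pose S := [set y : R | 0 <= y /\ E y <= 0].
have Sx : S x by split => //; exact: ltW.
have lbS : lbound S 0 by move=> y [].
have infS : has_inf S by split; [exists x|exists 0].
pose x0 := inf S.
have x00 : 0 <= x0 by apply: lb_le_inf => //; exists x.
have cE : continuous E.
  by move=> y; apply: (@continuous_comp _ _ _ (-%R) (mittag_leffler al al)); [exact: opp_continuous|exact: continuous_ml].
have Ex0 : E x0 <= 0.
  rewrite leNgt; apply/negP => Ep.
  have : \forall y \near x0, 0 < E y.
    exact: (@cvgr_gt _ _ _ _ E _ (cE x0)).
  move=> /nbhs_ballP[e /= e0 eP]; have [y [y0 Ey] yx] := inf_adherent e0 infS.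
  suff : 0 < E y by rewrite ltNge Ey.
  apply: eP; rewrite /ball /= distrC ger0_norm ?subr_ge0; last by apply: ge_inf => //; exists 0.
  by rewrite ltrBlDl.
have E0 : 0 < E 0 by rewrite /E oppr0 ml0// invr_gt0.
have x0p : 0 < x0.
  rewrite lt_neqAle x00 andbT; apply/eqP => h; move: Ex0; rewrite -h.
  by rewrite leNgt E0.
have Epos y : 0 <= y -> y < x0 -> 0 < E y.
  move=> y0 yx; rewrite ltNge; apply/negP => Ey.
  suff : x0 <= y by rewrite leNgt yx.
  by apply: ge_inf; [exists 0|split].
pose t0 := x0 `^ al^-1.
have t00 : 0 < t0 by exact: powR_gt0.
have t0E : t0 `^ al = x0 by rewrite /t0 -powRrM mulVf ?gt_eqF// powRr1.
have pal (s t : R) : 0 <= s -> s <= t -> s `^ al <= t `^ al.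
  by move=> s0 st; apply: ge0_ler_powR; rewrite ?nnegrE ?(ltW al0)// (le_trans s0).
have pal' (s t : R) : 0 <= s -> s < t -> s `^ al < t `^ al.
  by move=> s0 st; apply: gt0_ltr_powR; rewrite ?nnegrE ?(ltW (le_lt_trans s0 st)).
have fpos s : 0 < s -> s < t0 -> 0 < f s.
  move=> s0 st; rewrite f_E mulr_gt0 ?pk_gt0// Epos ?powR_ge0//.
  by rewrite -t0E pal'// ltW.
have [L L0 LP] := @ml_lip _ _ al0 al x0 al0.
have ft0 : f t0 <= 0 by rewrite f_E mulr_ge0_le0 ?pk_ge0// t0E.
have t02 : 0 < t0 / 2 by rewrite divr_gt0.
have [c cin cP] : exists2 c, c \in `[0%R, (t0 / 4) `^ al] & forall y, y \in `[0%R, (t0 / 4) `^ al] -> E c <= E y.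
  apply: EVT_min; first exact: powR_ge0.
  exact: continuous_subspaceT.
have Ec : 0 < E c.
  move: cin; rewrite in_itv/= => /andP[c0 c4]; apply: Epos => //.
  apply: (le_lt_trans c4); rewrite -t0E pal' ?divr_ge0 ?ltW//.
  by rewrite gtr_pMr// invf_lt1// ltr1n.
(* The Lipschitz constant uses that s^(al-1) is at most its value at t0/2, and [eta] that s^(al-1)
   >= t0^(al-1) together with the minimum of [E] over a compact interval. *)
apply: (@no_first_zero t0 ((t0 / 2) `^ (al - 1) * (L * (x0 / t0))) (t0 `^ (al - 1) * E c)) => //.
- by rewrite !mulr_gt0 ?powR_gt0 ?invr_gt0.
- move=> s t2s st; have s0 : 0 < s by exact: lt_le_trans t2s.
  rewrite f_E pkE// -mulrA; apply: ler_pM; rewrite ?powR_ge0//.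
  + by rewrite ltW// Epos ?powR_ge0// -t0E pal'// ltW.
  + by apply: powR_le0_ger => //; rewrite subr_le0 ltW.
  have sx : s `^ al <= x0 by rewrite -t0E pal// ltW.
  have : `|E (s `^ al) - E x0| <= L * `|- (s `^ al) - - x0|.
    by apply: LP; rewrite normrN ger0_norm// powR_ge0.
  rewrite (_ : - _ - - x0 = x0 - s `^ al); last by ring.
  rewrite [X in _ <= _ * X]ger0_norm ?subr_ge0// => h.
  apply: (@le_trans _ _ (L * (x0 - s `^ al))).
    by apply: le_trans h; apply: le_trans (ler_norm _); rewrite lerDl oppr_ge0.
  rewrite -mulrA ler_wpM2l ?(ltW L0)//.
  (* Converts the Lipschitz bound in x = s^al into one that is linear in t0 - s. *)
  have hs : s / t0 <= (s / t0) `^ al.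
    have q1 : s / t0 <= 1 by rewrite ler_pdivrMr// mul1r ltW.
    have q0 : 0 < s / t0 by rewrite divr_gt0.
    by rewrite -{1}(powRr1 (ltW q0)); apply: ger_powR; rewrite ?q0 ?q1// ltW.
  have sE : s `^ al = x0 * (s / t0) `^ al.
    by rewrite -t0E -powRM ?divr_ge0 ?ltW// mulrCA divff ?mulr1// gt_eqF.
  rewrite sE (_ : x0 / t0 * (t0 - s) = x0 - x0 * (s / t0)); last by field; rewrite gt_eqF.
  by rewrite lerD2l lerN2 ler_wpM2l// ltW.
- by rewrite mulr_gt0 ?powR_gt0.
- move=> s s0 s4; have st : s < t0 by rewrite (le_lt_trans s4)// gtr_pMr// invf_lt1// ltr1n.
  rewrite f_E pkE//; apply: ler_pM; rewrite ?powR_ge0 ?(ltW Ec)//.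
    by apply: powR_le0_ger => //; rewrite ?subr_le0 ltW.
  by apply: cP; rewrite in_itv/= powR_ge0/= pal// ltW.
Qed.

Section consequences.
Variable lam : R.
Hypothesis lam0 : 0 <= lam.

Lemma mlk_ge0 t : 0 <= mlk al al lam t.
Proof. by rewrite mlkE mulr_ge0 ?pk_ge0// ml_ge0// mulr_ge0 ?powR_ge0. Qed.

(** It is a fractional integral of the nonnegative resolvent. *)
Lemma mlkD_ge0 gam t : 0 < gam -> 0 <= mlk al (al + gam) lam t.
Proof.
move=> gam0; have [t0|t0] := ltP 0 t; last by rewrite mlk0.
have [_ H] := conv_mlk al0 lam al0 gam0 t0.
rewrite -(pmulr_rge0 _ (Gamma_gt0 gam0)) -lee_fin -H.
by apply: integral_ge0 => s _; rewrite lee_fin mulr_ge0 ?pk_ge0 ?mlk_ge0.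
Qed.

Lemma mlk_le t : mlk al al lam t <= pk al t / Gamma al.
Proof. by rewrite (mlk_rec al0 _ _ al0) gerBl mulr_ge0// mlkD_ge0. Qed.

Lemma pk1E (t : R) : 0 < t -> pk 1 t = 1.
Proof. by move=> t0; rewrite pkE// (subrr 1) powRr0. Qed.

Lemma mlk1E t : 0 < t -> mlk al 1 lam t = mittag_leffler al 1 (- (lam * t `^ al)).
Proof. by move=> t0; rewrite mlkE pk1E// mul1r. Qed.

Lemma ml1_ge0 t : 0 <= t -> 0 <= mittag_leffler al 1 (- (lam * t `^ al)).
Proof.
rewrite le_eqVlt => /orP[/eqP<-|t0].
  by rewrite powR0 ?gt_eqF// mulr0 oppr0 ml0// Gamma1 invr1.
(* Take gam = 1 - al: the multiplier of [Sop] is the fractional integral of order 1 - al of the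
   resolvent. *)
by rewrite -mlk1E// -[X in mlk _ X](subrK al) addrC mlkD_ge0// subr_gt0.
Qed.

Lemma integral_mlk t : 0 < t ->
  (\int[leb]_s (pk 1 (t - s) * mlk al al lam s)%:E = (mlk al (al + 1) lam t)%:E)%E.
Proof. by move=> t0; have [_ ->] := conv_mlk al0 lam al0 (@ltr01 R) t0; rewrite Gamma1 mul1r. Qed.

Lemma ml1_mlk t : 0 < t ->
  mittag_leffler al 1 (- (lam * t `^ al)) = 1 - lam * mlk al (al + 1) lam t.
Proof.
move=> t0; apply: (etrans (esym (mlk1E t0))); apply: (etrans (mlk_rec al0 lam t (@ltr01 R))).
by rewrite [1 + al]addrC pk1E// Gamma1 divr1.
Qed.

Lemma ml1_le1 t : 0 < t -> mittag_leffler al 1 (- (lam * t `^ al)) <= 1.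
Proof. by move=> t0; rewrite ml1_mlk// gerBl mulr_ge0// mlkD_ge0. Qed.

(** The left-hand side is 1 - e(t), where e(t) >= 0 is the multiplier of [Sop]. The bound is uniform
    in [t] and [lam]. *)
Lemma integral_mlk_itv t : 0 < t ->
  (lam%:E * \int[leb]_(s in `]0%R, t[) (mlk al al lam s)%:E <= 1)%E.
Proof.
move=> t0; have -> : (\int[leb]_(s in `]0%R, t[) (mlk al al lam s)%:E = (mlk al (al + 1) lam t)%:E)%E.
  rewrite -[RHS]integral_mlk// integral_mkcond; apply: eq_integral => s _; rewrite /patch.
  case: ifPn => [|].
    by rewrite inE/= in_itv/= => /andP[s0 st]; rewrite pk1E ?subr_gt0// mul1r.
  rewrite notin_setE /= in_itv/= => /negP; rewrite negb_and -!leNgt => /orP[s0|st].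
    by rewrite mlk0// mulr0.
  by rewrite pk0 ?subr_le0// mul0r.
rewrite -EFinM lee_fin.
have : mittag_leffler al 1 (- (lam * t `^ al)) = 1 - lam * mlk al (al + 1) lam t by rewrite ml1_mlk.
by move=> h; rewrite -subr_ge0 -h ml1_ge0// ltW.
Qed.

(** Gamma(1-al) e(t) is the integral of (t-s)^(-al) f(s), hence at least t^(-al) times the integral
    of f. Multiplying by lam t^al turns the latter into 1 - e(t). The product form avoids a division
    by [lam], which may be 0. *)
Lemma ml1_lower t : 0 < t ->
  1 <= (1 + Gamma (1 - al) * lam * t `^ al) * mittag_leffler al 1 (- (lam * t `^ al)).
Proof.
move=> t0; have a10 : 0 < 1 - al by rewrite subr_gt0.
have [i1] := conv_mlk al0 lam al0 a10 t0; rewrite [al + _]addrC subrK mlk1E// => I1.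
have [i2 _] := conv_mlk al0 lam al0 (@ltr01 R) t0.
have h : t `^ (- al) * mlk al (al + 1) lam t <=
    Gamma (1 - al) * mittag_leffler al 1 (- (lam * t `^ al)).
  rewrite -lee_fin.
  have -> : ((t `^ (- al) * mlk al (al + 1) lam t)%:E =
      (t `^ (- al))%:E * \int[leb]_s (pk 1 (t - s) * mlk al al lam s)%:E)%E.
    apply: (etrans (EFinM _ _)); congr (_ * _)%E; exact: esym (integral_mlk t0).
  rewrite -I1.
  rewrite -integralZl//; apply: le_integral => //.
    exact: integrableZl.
  move=> s _; rewrite -EFinM lee_fin mulrA.
  have [s0|s0] := ltP 0 s; last by rewrite mlk0// !mulr0.
  rewrite ler_wpM2r ?mlk_ge0//.
  have [ts|st] := leP t s; first by rewrite !pk0 ?subr_le0// mulr0.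
  rewrite pk1E ?subr_gt0// mulr1 pkE ?subr_gt0// (_ : 1 - al - 1 = - al); last by ring.
  by apply: powR_le0_ger; rewrite ?oppr_le0 ?subr_gt0 ?gerBl ?ltW.
have ta0 : 0 < t `^ al by exact: powR_gt0.
have := ml1_mlk t0; move: (mittag_leffler _ _ _) h => e h eE.
have h2 : lam * mlk al (al + 1) lam t <= Gamma (1 - al) * lam * t `^ al * e.
  have lt0 : 0 <= lam * t `^ al by rewrite mulr_ge0// ltW.
  have := ler_wpM2l lt0 h; rewrite powRN mulrA mulfK ?gt_eqF//.
  by move/le_trans; apply; rewrite le_eqVlt; apply/orP; left; apply/eqP; ring.
by rewrite mulrDl mul1r -lerBlDl {1}eE opprB addrC subrK.
Qed.

End consequences.
End mittag_leffler_sign.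


(** * Strongly measurable families and Bochner integrals *)

(* Unlike [ge0_le_integral], no measurability is required. *)
Lemma ge0_le_integral_sup d (T : measurableType d) (R : realType)
    (m : {measure set T -> \bar R}) (f g : T -> \bar R) :
  (forall x, 0 <= f x)%E -> (forall x, f x <= g x)%E -> (\int[m]_x f x <= \int[m]_x g x)%E.
Proof.
move=> f0 fg; have g0 x : (0 <= g x)%E by exact: le_trans (fg x).
rewrite !ge0_integralTE//; apply: le_ereal_sup => _ [h hf <-].
by exists h => // x; exact: le_trans (hf x) (fg x).
Qed.

(** * Families with values in L^2 and the measurability of their pairings *)

Section L2_families.
Context {R : realType} {d : nat}.
Local Notation fct := (Rd R d -> R[i]).
Local Notation leb := (@lebesgue_measure R).

Definition comb n (c : 'I_n -> R) (v : 'I_n -> fct) : fct :=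
  fun x => \sum_(i < n) (c i)%:C%C * v i x.

Lemma L2_comb n (c : 'I_n -> R) (v : 'I_n -> fct) : (forall i, L2 (v i)) -> L2 (comb c v).
Proof. by move=> hv; have [] := @ip_suml R d n (fun i x => (c i)%:C%C * v i x) _ (fun i => L2Z (c i) (hv i)) L20. Qed.

Lemma ip_comb n (c : 'I_n -> R) (v : 'I_n -> fct) g : (forall i, L2 (v i)) -> L2 g ->
  ip (comb c v) g = \sum_(i < n) c i * ip (v i) g.
Proof.
move=> hv hg; have [_ ->] := @ip_suml R d n (fun i x => (c i)%:C%C * v i x) _ (fun i => L2Z (c i) (hv i)) hg.
by apply: eq_bigr => i _; exact: ipZl.
Qed.

(** Turns bounds on pairings into bounds on norms: test against [f] itself and divide by its
    norm. *)
Lemma nrm_le_dual (f : fct) (b : R) : 0 <= b -> ip f f <= nrm f * b -> nrm f <= b.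
Proof.
move=> b0; rewrite -nrm_sq expr2.
have := nrm_ge0 f; rewrite le_eqVlt => /orP[/eqP<-//|f0].
by rewrite ler_pM2l.
Qed.

Lemma nrm_comb n (c : 'I_n -> R) (v : 'I_n -> fct) : (forall i, L2 (v i)) ->
  nrm (comb c v) <= \sum_(i < n) `|c i| * nrm (v i).
Proof.
move=> hv; have hc := L2_comb c hv; apply: nrm_le_dual.
  by apply: sumr_ge0 => i _; rewrite mulr_ge0 ?nrm_ge0.
rewrite ip_comb// mulr_sumr; apply: ler_sum => i _.
rewrite (le_trans (ler_norm _))// normrM mulrCA ler_wpM2l// mulrC.
exact: ip_CS.
Qed.

(* Pointwise limits of finite combinations of fixed elements of L^2 with
   measurable coefficients. *)
Definition L2meas d1 (T : measurableType d1) (F : T -> fct) : Prop :=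
  (forall x, L2 (F x)) /\
  exists (k : nat -> nat) (c : forall n, 'I_(k n) -> T -> R) (v : forall n, 'I_(k n) -> fct),
    [/\ forall n i, measurable_fun setT (c n i), forall n i, L2 (v n i) &
      forall x, nrm (comb (fun i => c n i x) (v n) \- F x) @[n --> \oo] --> (0 : R)].

(** Joint measurability needs strong measurability of one factor only. This asymmetry is used with
    the solution as the strongly measurable factor and [Km s g], shown to be weakly measurable in
    [s], as the other. *)
Lemma L2meas_ip d1 d2 (T1 : measurableType d1) (T2 : measurableType d2)
    (F : T1 -> fct) (G : T2 -> fct) :
  L2meas F -> (forall y, L2 (G y)) ->
  (forall v, L2 v -> measurable_fun setT (fun y => ip v (G y))) ->
  measurable_fun setT (fun z : T1 * T2 => ip (F z.1) (G z.2)).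
Proof.
move=> [hF [k [c [v [mc hv cv]]]]] hG mG.
apply: (@measurable_fun_cvg _ _ _ _ (fun n z => ip (comb (fun i => c n i z.1) (v n)) (G z.2))).
  move=> n; rewrite (_ : (fun z => _) = fun z : T1 * T2 => \sum_(i < k n) c n i z.1 * ip (v n i) (G z.2)).
    apply: measurable_sum => i; apply: measurable_funM.
      exact: (measurableT_comp (mc n i) measurable_fst).
    exact: (measurableT_comp (mG _ (hv n i)) measurable_snd).
  by apply/funext => z; rewrite ip_comb.
move=> z _; apply: cvg_ip => // n; exact: L2_comb.
Qed.

Lemma L2meas_ip_cst d1 (T : measurableType d1) (F : T -> fct) g :
  L2meas F -> L2 g -> measurable_fun setT (fun x => ip (F x) g).
Proof.
move=> mF hg; have := @L2meas_ip _ _ T T F (fun=> g) mF (fun=> hg) (fun v _ => @measurable_cst _ _ _ _ _ _).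
move=> H; have mdiag : measurable_fun setT (fun x : T => (x, x)).
  by apply/measurable_fun_pairP; split; exact: measurable_id.
exact: (measurableT_comp H mdiag).
Qed.

Lemma L2meas_ip_diag d1 (T : measurableType d1) (F G : T -> fct) :
  L2meas F -> L2meas G -> measurable_fun setT (fun x => ip (F x) (G x)).
Proof.
move=> mF mG; have [hG _] := mG.
have H : measurable_fun setT (fun z : T * T => ip (F z.1) (G z.2)).
  apply: L2meas_ip => // v hv.
  by rewrite (_ : (fun y => _) = fun y => ip (G y) v); [exact: L2meas_ip_cst|apply/funext => y; exact: ipC].
have mdiag : measurable_fun setT (fun x : T => (x, x)).
  by apply/measurable_fun_pairP; split; exact: measurable_id.
exact: (measurableT_comp H mdiag).
Qed.

Lemma measurable_sqrt : measurable_fun setT (Num.sqrt : R -> R).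
Proof. by apply: continuous_measurable_fun => x; exact: sqrt_continuous. Qed.

Lemma L2meas_nrm d1 (T : measurableType d1) (F : T -> fct) :
  L2meas F -> measurable_fun setT (fun x => nrm (F x)).
Proof. by move=> mF; apply: (measurableT_comp measurable_sqrt); exact: L2meas_ip_diag. Qed.

Lemma L2meas_nrmB d1 (T : measurableType d1) (F G : T -> fct) :
  L2meas F -> L2meas G -> measurable_fun setT (fun x => nrm (F x \- G x)).
Proof.
move=> mF mG; apply: (measurableT_comp measurable_sqrt).
have [hF _] := mF; have [hG _] := mG.
rewrite (_ : (fun x => _) = fun x => ip (F x) (F x) - ip (F x) (G x) - (ip (G x) (F x) - ip (G x) (G x))).
  by apply: measurable_funB; apply: measurable_funB; exact: L2meas_ip_diag.
by apply/funext => x; rewrite ipBl ?ipBr//; exact: L2B.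
Qed.

Lemma L2meas_comb d1 (T : measurableType d1) n (c : 'I_n -> T -> R) (v : 'I_n -> fct) :
  (forall i, measurable_fun setT (c i)) -> (forall i, L2 (v i)) ->
  L2meas (fun x => comb (fun i => c i x) v).
Proof.
move=> mc hv; split; first by move=> x; exact: L2_comb.
exists (fun=> n), (fun=> c), (fun=> v); split => // x.
rewrite (_ : (fun _ => _) = fun=> 0); first exact: cvg_cst.
apply/funext => m; apply/eqP; rewrite eq_le nrm_ge0 andbT.
apply: nrm_le_dual => //; rewrite mulr0 ipBl; try exact: L2_comb; last by apply: L2B; exact: L2_comb.
by rewrite subrr.
Qed.

Lemma L2meas_scale d1 (T : measurableType d1) (F : T -> fct) (m : Rd R d -> R) (M : R) :
  measurable_fun setT m -> (forall x, `|m x| <= M) ->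
  L2meas F -> L2meas (fun t x => (m x)%:C%C * F t x).
Proof.
move=> mm mM [hF [k [c [v [mc hv cv]]]]]; split; first by move=> t; exact: (L2_bounded mm mM).
exists k, c, (fun n i x => (m x)%:C%C * v n i x); split => //.
  by move=> n i; exact: (L2_bounded mm mM).
move=> t; have H : (M * nrm (comb (fun i => c n i t) (v n) \- F t)) @[n --> \oo] --> (0 : R).
  by rewrite -[0](mulr0 M); apply: cvgM; [exact: cvg_cst|exact: cv].
apply: (squeeze_cvgr _ (cvg_cst 0) H); apply: nearW => n; rewrite nrm_ge0/=.
rewrite [X in nrm X](_ : _ = fun x => (m x)%:C%C * (comb (fun i => c n i t) (v n) \- F t) x).
  by apply: nrm_bounded => //; apply: L2B => //; exact: L2_comb.
apply/funext => x /=; rewrite mulrBr /comb mulr_sumr; congr (_ - _).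
by apply: eq_bigr => i _; rewrite mulrCA.
Qed.

End L2_families.

(** * Bochner integrals tested against vectors *)

Section bochner.
Context {R : realType} {d : nat}.
Local Notation fct := (Rd R d -> R[i]).
Local Notation leb := (@lebesgue_measure R).
Implicit Types (D : set R) (F : R -> fct) (s : @L2_simple R d).

Lemma L2_simple_funE s t : L2_simple_fun s t = comb (fun i => (\1_(ls_set (l:=s) i) t : R)) (ls_val (l:=s)).
Proof. by []. Qed.

Lemma L2meas_simple s : L2meas (L2_simple_fun s).
Proof.
apply: L2meas_comb; last exact: ls_L2.
by move=> i; apply: measurable_indic; exact: ls_measurable.
Qed.

Lemma simple_ip_integral D s g : measurable D -> L2 g ->
  leb.-integrable D (fun t => (ip (L2_simple_fun s t) g)%:E) /\
  ((ip (L2_simple_integral D s) g)%:E = \int[leb]_(t in D) (ip (L2_simple_fun s t) g)%:E)%E.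
Proof.
move=> mD hg.
have ii i : leb.-integrable D (fun t => (\1_(ls_set (l:=s) i) t)%:E : \bar R).
  apply/integrableP; split.
    by apply/measurable_EFinP/measurable_funTS; apply: measurable_indic; exact: ls_measurable.
  rewrite (_ : (fun x => _) = fun t => (\1_(ls_set (l:=s) i) t)%:E); last first.
    by apply/funext => t /=; rewrite ger0_norm.
  rewrite integral_indic//; last exact: ls_measurable.
  apply: le_lt_trans (ls_finite (l:=s) i); apply: le_measure; rewrite ?inE; last exact: subIsetl.
    by apply: measurableI => //; exact: ls_measurable.
  exact: ls_measurable.
have E t : (ip (L2_simple_fun s t) g)%:E =
    (\sum_(i < ls_size s) ((ip (ls_val (l:=s) i) g)%:E * (\1_(ls_set (l:=s) i) t)%:E))%E.
  rewrite L2_simple_funE ip_comb//; last exact: ls_L2.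
  by rewrite -sumEFin; apply: eq_bigr => i _; rewrite -EFinM mulrC.
have ij i : leb.-integrable D (fun t => ((ip (ls_val (l:=s) i) g)%:E * (\1_(ls_set (l:=s) i) t)%:E)%E).
  exact: integrableZl.
split; first by under eq_fun do rewrite E; exact: integrable_sum.
under eq_integral do rewrite E.
rewrite integral_sum// (_ : L2_simple_integral D s = comb (fun i => fine (leb (ls_set (l:=s) i `&` D))) (ls_val (l:=s)))//.
rewrite ip_comb//; last exact: ls_L2.
rewrite -sumEFin; apply: eq_bigr => i _; rewrite integralZl// integral_indic//; last exact: ls_measurable.
suff fi : leb (ls_set (l:=s) i `&` D) \is a fin_num by rewrite mulrC EFinM; congr (_ * _)%E; exact: fineK.
rewrite ge0_fin_numE//.
apply: le_lt_trans (ls_finite (l:=s) i); apply: le_measure; rewrite ?inE; last exact: subIsetl.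
  by apply: measurableI => //; exact: ls_measurable.
exact: ls_measurable.
Qed.

Lemma simple_nrm_lty D s : measurable D -> (\int[leb]_(t in D) (nrm (L2_simple_fun s t))%:E < +oo)%E.
Proof.
move=> mD.
have mi i : measurable_fun D (fun t => (\1_(ls_set (l:=s) i) t)%:E : \bar R).
  by apply/measurable_EFinP/measurable_funTS; apply: measurable_indic; exact: ls_measurable.
apply: (@le_lt_trans _ _ (\int[leb]_(t in D) \sum_(i < ls_size s)
    ((nrm (ls_val (l:=s) i))%:E * (\1_(ls_set (l:=s) i) t)%:E))%E).
  apply: ge0_le_integral => //.
  - by move=> t _; rewrite lee_fin nrm_ge0.
  - by apply/measurable_EFinP/measurable_funTS; apply: L2meas_nrm; exact: L2meas_simple.
  - by apply: emeasurable_sum => i; apply: measurable_funeM; exact: mi.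
  - move=> t _; rewrite [leRHS](_ : _ = (\sum_(i < ls_size s) nrm (ls_val (l:=s) i) * \1_(ls_set (l:=s) i) t)%:E); last first.
      by rewrite -sumEFin; apply: eq_bigr => i _; rewrite EFinM.
    rewrite lee_fin.
    rewrite L2_simple_funE; apply: le_trans (nrm_comb _ _) _; first exact: ls_L2.
    by apply: ler_sum => i _; rewrite ger0_norm// mulrC.
rewrite ge0_integral_sum//; last 2 first.
- by move=> i; apply: measurable_funeM; exact: mi.
- by move=> i t _; rewrite -EFinM lee_fin mulr_ge0 ?nrm_ge0.
apply: lte_sum_pinfty => i _; rewrite ge0_integralZl//; [|exact: mi|by rewrite lee_fin nrm_ge0].
rewrite integral_indic//; last exact: ls_measurable.
apply: lte_mul_pinfty; rewrite ?lee_fin ?nrm_ge0//.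
apply: le_lt_trans (ls_finite (l:=s) i); apply: le_measure; rewrite ?inE; last exact: subIsetl.
  by apply: measurableI => //; exact: ls_measurable.
exact: ls_measurable.
Qed.

(* [F'] is [F] off the null set where the simple functions do not converge, and 0 there. *)
Lemma bochner_approx_rep D F (s : nat -> L2_simple) : measurable D -> bochner_approx D F s ->
  exists F' : R -> fct, [/\ L2meas F', {ae leb, forall t, D t -> F t = F' t} &
    (\int[leb]_(t in D) (nrm (L2_simple_fun (s n) t \- F' t))%:E)%E @[n --> \oo] --> 0%E].
Proof.
move=> mD [hF [N [mN N0 badN]] cvI].
pose E := D `\` N; have mE : measurable E by exact: measurableD.
pose F' (t : R) : fct := if t \in E then F t else cst 0.
have hS n t : L2 (L2_simple_fun (s n) t) by rewrite L2_simple_funE; apply: L2_comb; exact: ls_L2.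
have hF' t : L2 (F' t).
  by rewrite /F'; case: ifPn => [|_]; [rewrite inE => -[Dt _]; exact: hF|exact: L20].
have good t : E t -> nrm (L2_simple_fun (s n) t \- F t) @[n --> \oo] --> (0 : R).
  move=> [Dt Nt]; apply/cvg_L2P => //; first exact: hF.
  by apply: contrapT => bad; apply: Nt; apply: badN => /=; move=> /(_ Dt).
have mF' : L2meas F'.
  split => //; exists (fun n => ls_size (s n)),
    (fun n i t => \1_E t * (\1_(ls_set (l:=s n) i) t : R)), (fun n i => ls_val (l:=s n) i); split.
  + move=> n i; apply: measurable_funM; first exact: measurable_indic.
    by apply: measurable_indic; exact: ls_measurable.
  + by move=> n i; exact: ls_L2.
  + move=> t; rewrite /F'; case: ifPn => tE.
      have -> : (fun n => nrm (comb (fun i => \1_E t * (\1_(ls_set (l:=s n) i) t : R)) (ls_val (l:=s n)) \- F t)) =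
          (fun n => nrm (L2_simple_fun (s n) t \- F t)).
        apply/funext => n.
        suff -> : comb (fun i => \1_E t * (\1_(ls_set (l:=s n) i) t : R)) (ls_val (l:=s n)) = L2_simple_fun (s n) t by [].
        apply/funext => x; rewrite /comb /L2_simple_fun; apply: eq_bigr => i _.
        by rewrite indicE tE mul1r.
      by apply: good; rewrite inE in tE.
    rewrite (_ : (fun n => _) = fun=> 0); first exact: cvg_cst.
    apply/funext => n; apply/eqP; rewrite eq_le nrm_ge0 andbT.
    have Z : comb (fun i => \1_E t * (\1_(ls_set (l:=s n) i) t : R)) (ls_val (l:=s n)) \- (cst 0 : fct) = cst 0.
      apply/funext => x /=; rewrite subr0 /comb big1// => i _.
      by rewrite indicE (negbTE tE) mul0r mul0r.
    by rewrite Z nrm_cst0.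
exists F'; split => //.
- exists N; split => // t /= h; apply: contrapT => Nt; apply: h => Dt.
  by rewrite /F' mem_set.
- apply: (squeeze_cvge _ (cvg_cst 0%E) cvI); apply: nearW => n; apply/andP; split.
    by apply: integral_ge0 => t _; rewrite lee_fin nrm_ge0.
  rewrite (ge0_negligible_integral mN mD _ _ N0); last 2 first.
  + apply/measurable_EFinP/measurable_funTS.
    exact: (L2meas_nrmB (L2meas_simple (s n)) mF').
  + by move=> t _; rewrite lee_fin nrm_ge0.
  (* The larger integrand involves [F] itself, whose norm is not known to be measurable in time,
     hence a comparison without measurability. *)
  rewrite -/E integral_mkcond [leRHS]integral_mkcond; apply: ge0_le_integral_sup => t.
    by rewrite /patch; case: ifPn => // _; rewrite lee_fin nrm_ge0.
  rewrite /patch; case: ifPn => tE.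
    move: (tE); rewrite inE => -[Dt _]; rewrite mem_set//.
    rewrite cLnorm_nrm; last by apply: L2B => //; exact: hF.
    by rewrite /F' tE.
  by case: ifPn => // _; exact: Lnorm_ge0.
Qed.

Section pairing.
Variables (D : set R) (s : nat -> @L2_simple R d) (F : R -> fct).
Hypotheses (mD : measurable D) (mF : L2meas F).
Let S n := L2_simple_fun (s n).
Let v n := L2_simple_integral D (s n).
Let a n : \bar R := (\int[leb]_(t in D) (nrm (S n t \- F t))%:E)%E.
Hypothesis cva : a n @[n --> \oo] --> 0%E.

Let L2S n t : L2 (S n t). Proof. by have [h _] := L2meas_simple (s n); exact: h. Qed.
Let L2F t : L2 (F t). Proof. by have [h _] := mF; exact: h. Qed.
Let L2v n : L2 (v n). Proof. by apply: L2_comb; exact: ls_L2. Qed.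

Let mnSF n : measurable_fun D (fun t => (nrm (S n t \- F t))%:E).
Proof. by apply/measurable_EFinP/measurable_funTS; exact: (L2meas_nrmB (L2meas_simple (s n)) mF). Qed.
Let mnF : measurable_fun D (fun t => (nrm (F t))%:E).
Proof. by apply/measurable_EFinP/measurable_funTS; exact: L2meas_nrm. Qed.
Let mnS n : measurable_fun D (fun t => (nrm (S n t))%:E).
Proof. by apply/measurable_EFinP/measurable_funTS; apply: L2meas_nrm; exact: L2meas_simple. Qed.
Let nge0 (f : R -> fct) t : D t -> (0 <= (nrm (f t))%:E)%E.
Proof. by move=> _; rewrite lee_fin nrm_ge0. Qed.

Let subf0 (f : fct) : f \- (cst 0 : fct) = f.
Proof. by apply/funext => x /=; rewrite subr0. Qed.

Lemma rep_nrm_lty : (\int[leb]_(t in D) (nrm (F t))%:E < +oo)%E.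
Proof.
have /fine_cvgP[[N _ /(_ N (leqnn N)) aN] _] := cva.
apply: (@le_lt_trans _ _ (a N + \int[leb]_(t in D) (nrm (S N t))%:E)%E).
  rewrite /a -(ge0_integralD leb mD (@nge0 _) (mnSF N) (@nge0 _) (mnS N)).
  apply: (ge0_le_integral leb mD (@nge0 _) mnF (emeasurable_funD (mnSF N) (mnS N))).
  move=> t _; rewrite -EFinD lee_fin nrm_subC.
  have := nrmB_le (L2F t) (L2S N t) (@L20 R d).
  by rewrite !subf0.
by apply: lte_add_pinfty; [rewrite ltey_eq aN|exact: simple_nrm_lty].
Qed.

Let afin n : a n \is a fin_num.
Proof.
rewrite ge0_fin_numE; last by apply: integral_ge0 => t _; rewrite lee_fin nrm_ge0.
apply: (@le_lt_trans _ _ (\int[leb]_(t in D) (nrm (S n t))%:E + \int[leb]_(t in D) (nrm (F t))%:E)%E).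
  rewrite -(ge0_integralD leb mD (@nge0 _) (mnS n) (@nge0 _) mnF).
  apply: (ge0_le_integral leb mD (@nge0 _) (mnSF n) (emeasurable_funD (mnS n) mnF)).
  move=> t _; rewrite -EFinD lee_fin.
  have := nrmB_le (L2S n t) (@L20 R d) (L2F t); rewrite (nrm_subC (cst 0)).
  by rewrite !subf0.
by apply: lte_add_pinfty; [exact: simple_nrm_lty|exact: rep_nrm_lty].
Qed.

Let cvfa : fine (a n) @[n --> \oo] --> (0 : R).
Proof. by have /fine_cvgP[] := cva. Qed.

Let ipv n g : L2 g -> leb.-integrable D (fun t => (ip (S n t) g)%:E) /\
  ((ip (v n) g)%:E = \int[leb]_(t in D) (ip (S n t) g)%:E)%E.
Proof. exact: simple_ip_integral. Qed.

Let diff_le n m g : L2 g -> `|ip (v n \- v m) g| <= nrm g * (fine (a n) + fine (a m)).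
Proof.
move=> hg; have [in_ En] := ipv n hg; have [im Em] := ipv m hg.
rewrite -lee_fin.
have -> : (`|ip (v n \- v m) g|%:E =
    `|\int[leb]_(t in D) ((ip (S n t) g)%:E - (ip (S m t) g)%:E)|)%E.
  by rewrite integralB// -En -Em -EFinB -ipBl.
apply: (le_trans (le_abse_integral leb mD _)).
  by apply: (measurable_int leb); exact: integrableB.
have -> : (nrm g * (fine (a n) + fine (a m)))%:E = ((nrm g)%:E * (a n + a m))%E.
  by rewrite -{2}(fineK (afin n)) -{2}(fineK (afin m)).
have mD2 : measurable_fun D (fun t => (nrm (S n t \- F t))%:E + (nrm (S m t \- F t))%:E)%E.
  by apply: emeasurable_funD; exact: mnSF.
rewrite /a -(ge0_integralD leb mD (@nge0 _) (mnSF n) (@nge0 _) (mnSF m)).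
rewrite -ge0_integralZl//; last 2 first.
- by move=> t _; rewrite -EFinD lee_fin addr_ge0 ?nrm_ge0.
- by rewrite lee_fin nrm_ge0.
apply: ge0_le_integral => //.
- by apply: measurableT_comp => //; apply: (measurable_int leb); exact: integrableB.
- exact: measurable_funeM.
- move=> t _; rewrite -EFinB -EFinD -EFinM /= lee_fin -ipBl//; try exact: L2S.
  apply: (le_trans (ip_CS _ hg)); first by apply: L2B; exact: L2S.
  rewrite mulrC ler_wpM2l ?nrm_ge0// (nrm_subC (S m t)).
  by apply: nrmB_le.
Qed.

(** The Cauchy property is checked by duality: [diff_le] is tested against the difference itself. *)
Lemma simple_integral_cvg : exists2 w, L2 w & nrm (v n \- w) @[n --> \oo] --> (0 : R).
Proof.
apply: L2_complete => // e e0.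
have e20 : 0 < e / 2 by rewrite divr_gt0.
have [N _ HN] : \forall n \near \oo, fine (a n) <= e / 2 by exact: (cvgr_le 0 cvfa).
exists N => m n Nm Nn; apply: (@le_trans _ _ (fine (a m) + fine (a n))).
  apply: nrm_le_dual; first by rewrite addr_ge0// fine_ge0// integral_ge0// => t _; rewrite lee_fin nrm_ge0.
  by apply: le_trans (diff_le _ _ _); [exact: ler_norm|exact: L2B].
by rewrite (splitr e) lerD// HN.
Qed.

(** The pairing of [v n] with [g] is the integral of the pairings of [S n], which exceeds that of
    [F] by at most |g| times the L^1 distance [a n]. *)
Lemma simple_integral_le w g : L2 w -> L2 g -> nrm (v n \- w) @[n --> \oo] --> (0 : R) ->
  (`|ip w g|%:E <= \int[leb]_(t in D) `|ip (F t) g|%:E)%E.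
Proof.
move=> hw hg cw.
have mip : measurable_fun D (fun t => `|ip (F t) g|%:E).
  by apply/measurable_EFinP/measurable_funTS; apply: measurableT_comp => //; exact: L2meas_ip_cst.
set X := (X in (_ <= X)%E); have X0 : (0 <= X)%E by apply: integral_ge0 => t _; rewrite lee_fin.
have Xfin : X \is a fin_num.
  rewrite ge0_fin_numE//; apply: (@le_lt_trans _ _ (\int[leb]_(t in D) ((nrm g)%:E * (nrm (F t))%:E))%E).
    apply: ge0_le_integral => //; first exact: measurable_funeM.
    by move=> t _; rewrite -EFinM lee_fin mulrC ip_CS.
  rewrite (ge0_integralZl leb mD mnF); [|exact: nge0|by rewrite lee_fin nrm_ge0].
  by apply: lte_mul_pinfty; rewrite ?lee_fin ?nrm_ge0//; exact: rep_nrm_lty.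
have bd n : `|ip (v n) g| <= fine X + nrm g * fine (a n).
  have [in_ En] := ipv n hg; rewrite -lee_fin.
  have -> : (`|ip (v n) g|%:E = `|\int[leb]_(t in D) (ip (S n t) g)%:E|)%E by rewrite -En.
  have -> : (fine X + nrm g * fine (a n))%:E = (X + (nrm g)%:E * a n)%E.
    by rewrite -{2}(fineK Xfin) -{2}(fineK (afin n)).
  apply: (le_trans (le_abse_integral leb mD _)); first exact: (measurable_int leb).
  rewrite /a /X -(ge0_integralZl leb mD (mnSF n)); [|exact: nge0|by rewrite lee_fin nrm_ge0].
  rewrite -ge0_integralD//; last 2 first.
  - by move=> t _; rewrite -EFinM lee_fin mulr_ge0 ?nrm_ge0.
  - by apply: measurable_funeM; exact: mnSF.
  apply: ge0_le_integral => //.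
  - by apply: measurableT_comp => //; exact: (measurable_int leb).
  - by apply: emeasurable_funD => //; apply: measurable_funeM; exact: mnSF.
  - move=> t _; rewrite -EFinM -EFinD /= lee_fin.
    have -> : ip (S n t) g = ip (F t) g + ip (S n t \- F t) g.
      by rewrite ipBl// addrC subrK.
    rewrite (le_trans (ler_normD _ _))// lerD2l mulrC ip_CS//; exact: L2B.
have cip : `|ip (v n) g| @[n --> \oo] --> `|ip w g| by apply: cvg_norm; exact: cvg_ip.
have cbd : (fine X + nrm g * fine (a n)) @[n --> \oo] --> fine X.
  rewrite -[X in _ --> X]addr0 -(mulr0 (nrm g)); apply: cvgD; first exact: cvg_cst.
  by apply: cvgM; [exact: cvg_cst|exact: cvfa].
rewrite -(fineK Xfin) lee_fin -(cvg_lim _ cip)// -(cvg_lim _ cbd)//.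
by apply: ler_lim; [apply/cvg_ex; eexists; exact: cip|apply/cvg_ex; eexists; exact: cbd|exact: nearW].
Qed.

End pairing.

(** The value selected by [bochner_integral] brings its own approximating sequence. The
    representative [F'] is built from that sequence; the one given by integrability serves only to
    show that the selection is not the default. *)
Lemma bochner_integral_ip D F : measurable D -> bochner_integrable D F ->
  L2 (bochner_integral D F) /\ exists F' : R -> fct,
  [/\ L2meas F', {ae leb, forall t, D t -> F t = F' t},
    (\int[leb]_(t in D) (nrm (F' t))%:E < +oo)%E &
    forall g, L2 g -> (`|ip (bochner_integral D F) g|%:E <= \int[leb]_(t in D) `|ip (F' t) g|%:E)%E].
Proof.
move=> mD [s0 hs0].
have L2v (s : nat -> L2_simple) n : L2 (L2_simple_integral D (s n)).
  by apply: L2_comb; exact: ls_L2.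
have [F0 [mF0 _ cv0]] := bochner_approx_rep mD hs0.
have [w0 hw0 cw0] := simple_integral_cvg mD mF0 cv0.
have [] : [set v | L2 v /\ exists2 s, bochner_approx D F s &
      cvg_L2 (fun n => L2_simple_integral D (s n)) v] (bochner_integral D F).
  apply: xgetPex; exists w0; split => //; exists s0 => //.
  exact/cvg_L2P.
set w := bochner_integral D F => hw [s hs cw]; split => //.
have [F' [mF' FF' cv]] := bochner_approx_rep mD hs.
exists F'; split => //; first exact: (rep_nrm_lty mD mF' cv).
move=> g hg; apply: (simple_integral_le mD mF' cv hw hg).
exact/cvg_L2P.
Qed.

Lemma bochner_integral_ip_le D F g (h : R -> R) : measurable D -> bochner_integrable D F -> L2 g ->
  measurable_fun D h -> (forall t, 0 <= h t) ->
  {ae leb, forall t, D t -> `|ip (F t) g| <= h t} ->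
  (`|ip (bochner_integral D F) g|%:E <= \int[leb]_(t in D) (h t)%:E)%E.
Proof.
move=> mD bF hg mh h0 hle; have [_ [F' [mF' FF' _ H]]] := bochner_integral_ip mD bF.
apply: (le_trans (H g hg)); apply: ae_ge0_le_integral => //.
- by apply/measurable_EFinP/measurable_funTS; apply: measurableT_comp => //; exact: L2meas_ip_cst.
- by move=> t _; rewrite lee_fin.
- exact/measurable_EFinP.
- by apply: (@filterS2 _ (almost_everywhere leb) _ _ _ _ _ FF' hle) => t FF hl Dt; rewrite lee_fin -FF// hl.
Qed.

End bochner.

(** * Mild solutions *)

Section gronwall.
Context {R : realType}.
Local Notation leb := (@lebesgue_measure R).

Lemma integral_pk_exp (al sg : R) : 0 < al -> 0 < sg ->
  (\int[leb]_r (pk al r * expR (- (sg * r)))%:E = (Gamma al * sg `^ (- al))%:E)%E.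
Proof.
move=> al0 sg0.
have mf : measurable_fun setT (fun t : R => (pk al t * expR (- t))%:E).
  apply/measurable_EFinP; apply: measurable_funM; first exact: measurable_pk.
  exact: measurable_expN.
have f0 (t : R) : (0 <= (pk al t * expR (- t))%:E)%E by rewrite lee_fin mulr_ge0 ?pk_ge0 ?expR_ge0.
have := ge0_integral_scale sg0 mf f0; rewrite GammaE//.
have -> : (\int[leb]_x (pk al (sg * x) * expR (- (sg * x)))%:E =
    (sg `^ (al - 1))%:E * \int[leb]_r (pk al r * expR (- (sg * r)))%:E)%E.
  rewrite -ge0_integralZl//.
  - by apply: eq_integral => x _; rewrite pk_scale// -EFinM mulrA.
  - apply/measurable_EFinP; apply: measurable_funM; first exact: measurable_pk.
    by apply: (measurableT_comp (@measurable_expN R)); exact: measurable_funM.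
  - by move=> x _; rewrite lee_fin mulr_ge0 ?pk_ge0 ?expR_ge0.
  - by rewrite lee_fin powR_ge0.
move=> /(congr1 (fun z => (sg `^ (1 - al))%:E * z)%E); rewrite muleA -!EFinM.
rewrite -powRD ?(gt_eqF sg0) ?implybT// (_ : 1 - al + (al - 1) = 0); last by ring.
rewrite powRr0 mul1e => ->; congr EFin.
rewrite mulrA mulrC; congr (_ * _); rewrite -[X in _ * X](powR_inv1 (ltW sg0)).
by rewrite -powRD ?(gt_eqF sg0) ?implybT//; congr (_ `^ _); ring.
Qed.

(** In the weighted norm with weight exp(-sg t), convolution with the kernel has norm at most 1/2
    once [sg] is large. The weighted integral [I] is finite and at most I/2, hence 0. *)
Lemma singular_gronwall (al C : R) (n : R -> R) : 0 < al -> 0 <= C ->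
  measurable_fun setT n -> (forall t, 0 <= n t) -> (forall t, t <= 0 -> n t = 0) ->
  (\int[leb]_t (n t)%:E < +oo)%E ->
  {ae leb, forall t, ((n t)%:E <= C%:E * \int[leb]_s (pk al (t - s) * n s)%:E)%E} ->
  {ae leb, forall t, n t = 0}.
Proof.
move=> al0 C0 mn n0 nneg nfin Hn.
have Ga0 := Gamma_gt0 al0.
have b0 : 0 < 2 * C * Gamma al + 1 by rewrite ltr_wpDl// !mulr_ge0// ltW.
(* Makes C Gamma(al) sg^(-al) at most 1/2; the added 1 keeps the rate positive when [C = 0]. *)
pose sg := (2 * C * Gamma al + 1) `^ al^-1.
have sg0 : 0 < sg by exact: powR_gt0.
have sgE : sg `^ (- al) = (2 * C * Gamma al + 1)^-1.
  by rewrite /sg -powRrM mulrN mulVf ?gt_eqF// powR_inv1// ltW.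
pose m t := expR (- (sg * t)) * n t.
pose k r := pk al r * expR (- (sg * r)).
have mexp : measurable_fun setT (fun r : R => expR (- (sg * r))).
  by apply: (measurableT_comp (@measurable_expN R)); exact: measurable_funM.
have mm : measurable_fun setT m by apply: measurable_funM.
have mk : measurable_fun setT k by apply: measurable_funM => //; exact: measurable_pk.
have m0 t : 0 <= m t by rewrite mulr_ge0 ?expR_ge0.
have k0 t : 0 <= k t by rewrite mulr_ge0 ?expR_ge0 ?pk_ge0.
have mn_le t : m t <= n t.
  have [t0|t0] := ltP 0 t; last by rewrite /m nneg// mulr0.
  by rewrite /m ler_piMl// -expR0 ler_expR oppr_le0 mulr_ge0// ltW.
pose I := (\int[leb]_t (m t)%:E)%E.
have I0 : (0 <= I)%E by apply: integral_ge0 => t _; rewrite lee_fin.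
have Ifin : (I < +oo)%E.
  apply: le_lt_trans nfin; apply: ge0_le_integral => //.
  - by move=> t _; rewrite lee_fin.
  - exact/measurable_EFinP.
  - exact/measurable_EFinP.
  - by move=> t _; rewrite lee_fin.
have mkm : measurable_fun setT (fun z : R * R => k (z.1 - z.2) * m z.2).
  apply: measurable_funM; last exact: (measurableT_comp mm measurable_snd).
  apply: (measurableT_comp mk); apply: measurable_funB; [exact: measurable_fst|exact: measurable_snd].
have mkt (t : R) : measurable_fun setT (fun s : R => (k (t - s) * m s)%:E).
  apply/measurable_EFinP; apply: measurable_funM => //; apply: (measurableT_comp mk).
  exact: measurable_funB.
have mks (s : R) : measurable_fun setT (fun t : R => (k (t - s))%:E).
  apply/measurable_EFinP; apply: (measurableT_comp mk); exact: measurable_funB.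
have mJ : measurable_fun setT (fun t : R => \int[leb]_s (k (t - s) * m s)%:E)%E.
  have := @measurable_param_integral _ _ _ _ _ leb (fun z : R * R => (k (z.1 - z.2) * m z.2)%:E).
  by apply; apply/measurable_EFinP.
have km0 z : (0 <= (k (z.1 - z.2) * m z.2)%:E)%E by rewrite lee_fin mulr_ge0.
have : (I <= (C * (Gamma al * sg `^ (- al)))%:E * I)%E.
  apply: (@le_trans _ _ (\int[leb]_t (C%:E * \int[leb]_s (k (t - s) * m s)%:E))%E).
    apply: ae_ge0_le_integral => //.
    - by move=> t _; rewrite lee_fin.
    - exact/measurable_EFinP.
    - move=> t _; apply: mule_ge0; first by rewrite lee_fin.
      by apply: integral_ge0 => s _; exact: (km0 (t, s)).
    - exact: measurable_funeM.
    - apply: (@filterS _ (almost_everywhere leb) _ _ _ _ Hn) => t Ht _; rewrite /m EFinM.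
      apply: (@le_trans _ _ ((expR (- (sg * t)))%:E * (C%:E * \int[leb]_s (pk al (t - s) * n s)%:E))%E).
        by apply: lee_wpmul2l; rewrite ?lee_fin ?expR_ge0.
      rewrite muleCA lee_wpmul2l ?lee_fin// -ge0_integralZl//; last 2 first.
      + apply/measurable_EFinP; apply: measurable_funM => //.
        by apply: (measurableT_comp (@measurable_pk _ al)); exact: measurable_funB.
      + by move=> s _; rewrite lee_fin mulr_ge0 ?pk_ge0.
      rewrite le_eqVlt; apply/orP; left; apply/eqP; apply: eq_integral => s _.
      rewrite -EFinM; congr EFin; rewrite /k /m.
      rewrite (_ : - (sg * t) = - (sg * (t - s)) + - (sg * s)); last by ring.
      by rewrite expRD; ring.
  rewrite ge0_integralZl//; last by move=> t _; apply: integral_ge0 => s _; exact: (km0 (t, s)).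
  (* Young's inequality by hand: after Tonelli and a shift, the inner integral is the Laplace
     transform of the kernel at [sg]. *)
  rewrite [X in (_ <= X * _)%E]EFinM -muleA lee_wpmul2l ?lee_fin//.
  have -> : (\int[leb]_t \int[leb]_s (k (t - s) * m s)%:E =
      \int[leb]_s \int[leb]_t (k (t - s) * m s)%:E)%E.
    apply: (@fubini_tonelli _ _ _ _ _ leb leb (fun z : R * R => (k (z.1 - z.2) * m z.2)%:E)) => //.
    exact/measurable_EFinP.
  rewrite /I -ge0_integralZl//; last 3 first.
  - exact/measurable_EFinP.
  - by move=> t _; rewrite lee_fin.
  - by rewrite lee_fin mulr_ge0 ?powR_ge0// ltW.
  rewrite le_eqVlt; apply/orP; left; apply/eqP; apply: eq_integral => s _.
  under eq_integral do rewrite EFinM muleC.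
  rewrite (ge0_integralZl leb measurableT (mks s)); [|by move=> t _; rewrite lee_fin|by rewrite lee_fin].
  rewrite muleC; congr (_ * _)%E.
  have mk' : measurable_fun setT (fun r : R => (k r)%:E) by exact/measurable_EFinP.
  by have := ge0_integral_shift (- s) mk'; rewrite integral_pk_exp// => ->.
have Ir : I \is a fin_num by rewrite ge0_fin_numE.
rewrite -(fineK Ir) -EFinM lee_fin sgE => HI.
have fI0 : 0 <= fine I by exact: fine_ge0.
have q : C * (Gamma al * (2 * C * Gamma al + 1)^-1) <= 2^-1.
  rewrite mulrA ler_pdivrMr//; have : 0 <= C * Gamma al by rewrite mulr_ge0// ltW.
  by move: (C * Gamma al) (mulrA 2 C (Gamma al)) => x <- x0; lra.
have : fine I = 0.
  apply/eqP; rewrite eq_le fI0 andbT.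
  have := le_trans HI (ler_wpM2r fI0 q); move: (fine I) => x; lra.
move=> fI; have I00 : I = 0%E by rewrite -(fineK Ir) fI.
have AE : ae_eq leb setT (fun t => (m t)%:E) (cst 0%E).
  apply/(ae_eq_integral_abs leb measurableT); first exact/measurable_EFinP.
  by rewrite -I00; apply: eq_integral => t _; rewrite gee0_abs// lee_fin.
apply: (@filterS _ (almost_everywhere leb) _ _ _ _ AE) => t /(_ Logic.I); rewrite /m => -[] /eqP.
by rewrite mulf_eq0 gt_eqF ?expR_gt0//= => /eqP.
Qed.

End gronwall.

(** * The potential, pairings and the origin in R^d *)

Section space.
Context {R : realType} {d : nat}.
Local Notation mu := (lebesgue_Rd d : {sigma_finite_measure set (Rd R d) -> \bar R}).
Local Notation fct := (Rd R d -> R[i]).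

(** Clamping to [-M, M] yields a version bounded at every point, as the lemmas on multiplication by
    a bounded function require. *)
Lemma Linfty_trunc (p : Rd R d -> R) : p \in Lfun (lebesgue_Rd d) +oo%E ->
  measurable_fun setT p /\ exists (q : Rd R d -> R) (M : R),
    [/\ 0 <= M, measurable_fun setT q, forall x, `|q x| <= M & {ae mu, forall x, p x = q x}].
Proof.
move=> /andP[]; rewrite !inE => mp; rewrite /finite_norm => np; split => //.
have [M [M0 pM]] : exists M, 0 <= M /\ {ae mu, forall x, `|p x| <= M}.
  (* The norm is 0 by convention when the whole space has measure 0; the space is then itself the
     exceptional set. *)
  move: np; rewrite /= unlock; case: ifPn => [mu0|].
    set e := ess_sup_inf.ess_sup _ _ => eoo; exists `|fine e|; split => //.
    have := ess_sup_inf.ess_sup_ge mu (abse \o (EFin \o p)).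
    apply: filterS => x /=; rewrite -/e; move: eoo; case: e => [r||]//= _.
    by rewrite lee_fin => /le_trans; apply; exact: ler_norm.
  rewrite -leNgt => mu0 _; exists 0; split => //.
  exists setT; split => //; apply/eqP; rewrite eq_le mu0/=; exact: measure_ge0.
exists (fun x => Num.min M (Num.max (- M) (p x))), M; split => //.
- by apply: measurable_minr => //; exact: measurable_maxr.
- move=> x; rewrite ler_norml; apply/andP; split.
    by rewrite le_min le_max lexx/= andbT (le_trans _ M0)// oppr_le0.
  by rewrite ge_min lexx.
- apply: filterS pM => x; rewrite ler_norml => /andP[h1 h2].
  by rewrite (max_idPr h1) (min_idPr h2).
Qed.

(** Cauchy-Schwarz with the absolute value inside the integral: multiplying [f] by the sign [m] of
    the integrand removes that absolute value and does not increase the norm. *)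
Lemma integral_abs_cdot_le (f g : fct) : L2 f -> L2 g ->
  (\int[mu]_x `|cdot (f x) (g x)|%:E <= (nrm f * nrm g)%:E)%E.
Proof.
move=> hf hg; have mc := measurable_cdot (L2_cmeas hf) (L2_cmeas hg).
pose A := [set x | 0 <= cdot (f x) (g x)].
have mA : measurable A.
  rewrite (_ : A = setT `&` (fun x => cdot (f x) (g x)) @^-1` `[0, +oo[%classic).
    by apply: mc => //; exact: measurable_itv.
  by apply/seteqP; split => x /=; rewrite /A /= in_itv/= andbT // => -[].
pose m x : R := 2 * \1_A x - 1.
have mm : measurable_fun setT m.
  by apply: measurable_funB => //; apply: measurable_funM => //; exact: measurable_indic.
have mE x : m x * cdot (f x) (g x) = `|cdot (f x) (g x)|.
  rewrite /m indicE; case: (boolP (x \in A)) => [|]; rewrite ?inE ?notin_setE /A /= => h.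
    by rewrite ger0_norm// mulr1 (_ : 2 - 1 = 1 :> R) ?mul1r//; ring.
  by rewrite ltr0_norm ?mulr0 ?sub0r ?mulN1r// ltNge; exact/negP.
have m1 x : `|m x| <= 1.
  rewrite /m indicE; case: (x \in A); rewrite ?mulr1 ?mulr0.
    by rewrite (_ : 2 - 1 = 1 :> R) ?normr1//; ring.
  by rewrite sub0r normrN normr1.
have hmf := L2_bounded mm m1 hf.
rewrite (_ : (fun x => _) = fun x => (cdot ((m x)%:C%C * f x) (g x))%:E); last first.
  by apply/funext => x; rewrite cdotZl mE.
rewrite -ipE// lee_fin (le_trans (ler_norm _))// (le_trans (ip_CS hmf hg))//.
by rewrite ler_wpM2r ?nrm_ge0// (le_trans (nrm_bounded mm m1 hf))// mul1r.
Qed.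

Lemma measurable_normRd : measurable_fun setT (fun x : Rd R d => normRd x).
Proof.
apply: (measurableT_comp (@measurable_sqrt R)); apply: measurable_sum => i.
by apply: measurable_funM; exact: measurable_tnth.
Qed.

Lemma normRd_ge0 (x : Rd R d) : 0 <= normRd x. Proof. exact: sqrtr_ge0. Qed.

(** The origin lies in the hyperplane where one coordinate vanishes, a product set with one factor
    of measure 0; such a coordinate exists because [0 < d]. *)
Lemma normRd_gt0_ae : (0 < d)%N -> {ae mu, forall x, 0 < normRd x}.
Proof.
move=> d0; pose i0 := Ordinal d0.
pose A (i : 'I_d) : set (measurableTypeR R) := if i == i0 then [set 0%R] else setT.
have mA i : measurable (A i) by rewrite /A; case: ifP.
exists [set v | forall i, A i (tnth v i)]; split.
- rewrite (_ : [set v | _] = \bigcap_(i in [set: 'I_d]) ((fun v : Rd R d => tnth v i) @^-1` A i)).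
    apply: fin_bigcap_measurable => [|i _]; first exact: finite_finset.
    by rewrite -[X in measurable X]setTI; exact: measurable_tnth.
  by apply/seteqP; split=> v /= vA i; [move=> _|]; exact: vA.
- rewrite lebesgue_Rd_box// (bigD1 i0)//= /A eqxx lebesgue_measure_set1 mul0e//.
- move=> x /= /negP; rewrite -leNgt => x0 i; rewrite /A; case: ifP => // /eqP->.
  have : dotRd x x <= 0 by rewrite -sqrtr_eq0 -/(normRd x) eq_le x0 normRd_ge0.
  rewrite /dotRd (bigD1 i0)//= => h.
  have s0 : 0 <= \sum_(i < d | i != i0) tnth x i * tnth x i by apply: sumr_ge0 => j _; rewrite -expr2 sqr_ge0.
  have : tnth x i0 ^+ 2 <= 0 by rewrite expr2 (le_trans _ h)// lerDl.
  by rewrite le_eqVlt ltNge sqr_ge0 orbF sqrf_eq0 => /eqP.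
Qed.

End space.

(** * The operators K(s) and their total mass in time *)

Section resolvent.
Context {R : realType} {d : nat}.
Local Notation mu := (lebesgue_Rd d : {sigma_finite_measure set (Rd R d) -> \bar R}).
Local Notation fct := (Rd R d -> R[i]).
Local Notation leb := (@lebesgue_measure R).
Variables al be : R.
Hypothesis al01 : 0 < al < 1.

Let al0 : 0 < al. Proof. by case/andP: al01. Qed.

Let lam (xi : Rd R d) := normRd xi `^ be.
Let lam0 xi : 0 <= lam xi. Proof. exact: powR_ge0. Qed.

Lemma measurable_lam : measurable_fun setT (fun xi : Rd R d => normRd xi `^ be).
Proof. by apply: (measurableT_comp (@measurable_powR R be)); exact: measurable_normRd. Qed.

(* The multiplier of [Kop al be s], extended by 0 to [s <= 0]. *)
Definition mK (s : R) (xi : Rd R d) : R := mlk al al (normRd xi `^ be) s.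

Lemma mK_ge0 s xi : 0 <= mK s xi.
Proof. by apply: mlk_ge0 => //; exact: powR_ge0. Qed.

Lemma measurable_mK2 : measurable_fun setT (fun z : R * Rd R d => mK z.1 z.2).
Proof.
rewrite (_ : (fun z => _) = fun z : R * Rd R d =>
    pk al z.1 * mittag_leffler al al (- (normRd z.2 `^ be * z.1 `^ al))).
  apply: measurable_funM; first exact: (measurableT_comp (@measurable_pk _ al) measurable_fst).
  apply: (measurableT_comp (measurable_ml al0 al0)); apply: measurable_funN.
  apply: measurable_funM; first exact: (measurableT_comp measurable_lam measurable_snd).
  exact: (measurableT_comp (@measurable_powR R al) measurable_fst).
by apply/funext => z; rewrite /mK mlkE.
Qed.

Lemma measurable_mK s : measurable_fun setT (mK s).
Proof.
have mp : measurable_fun setT (fun xi : Rd R d => (s, xi)).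
  by apply/measurable_fun_pairP; split; [exact: measurable_cst|exact: measurable_id].
exact: (measurableT_comp measurable_mK2 mp).
Qed.

Lemma mK_le s xi : `|mK s xi| <= pk al s / Gamma al.
Proof. by rewrite ger0_norm ?mK_ge0//; apply: mlk_le => //; exact: powR_ge0. Qed.

Definition Km s : fct -> fct := fourier_multiplier (mK s).

Lemma KopE s : 0 < s -> Kop al be s = Km s :> (fct -> fct).
Proof.
move=> s0; rewrite /Kop /Km; congr fourier_multiplier.
by apply/funext => xi; rewrite /mK mlkE pkE.
Qed.

Lemma L2_Km s g : L2 g -> L2 (Km s g).
Proof. by move=> hg; have [] := fourier_multiplierP (measurable_mK s) (mK_le s) hg. Qed.

Lemma ip_Km s f g : L2 f -> L2 g ->
  ip f (Km s g) = \int[mu]_xi (mK s xi * cdot (fourier g xi) (fourier f xi)).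
Proof.
move=> hf hg; rewrite ipC (ip_fourier_multiplier (measurable_mK s) (mK_le s) hg hf) /ip.
by apply: eq_Rintegral => xi _; rewrite cdotZl.
Qed.

(** Weak measurability in time, read off on the Fourier side, where the pairing is a parametric
    integral of a jointly measurable function. *)
Lemma measurable_ip_Km f g : L2 f -> L2 g -> measurable_fun setT (fun s => ip f (Km s g)).
Proof.
move=> hf hg; rewrite (_ : (fun s => _) = fun s => fine (\int[mu]_xi (mK s xi * cdot (fourier g xi) (fourier f xi))%:E)%E).
  apply: measurableT_comp => //.
  have := @measurable_param_integral _ _ _ _ _ mu (fun z : R * Rd R d => (mK z.1 z.2 * cdot (fourier g z.2) (fourier f z.2))%:E).
  apply; apply/measurable_EFinP; apply: measurable_funM; first exact: measurable_mK2.
  have mc := measurable_cdot (L2_cmeas (L2_fourier hg)) (L2_cmeas (L2_fourier hf)).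
  exact: (measurableT_comp mc measurable_snd).
by apply/funext => s; rewrite ip_Km.
Qed.

Lemma nrm_Km s g : L2 g -> nrm (Km s g) <= pk al s / Gamma al * nrm g.
Proof. by move=> hg; exact: (nrm_fourier_multiplier (measurable_mK s) (mK_le s) hg). Qed.

(* The frequency cut-off of the test function that the solution is paired with. *)
Definition lowpass (xi : Rd R d) : R := Num.min (normRd xi `^ be) 1.

Lemma lowpass_ge0 xi : 0 <= lowpass xi. Proof. by rewrite le_min powR_ge0 ler01. Qed.
Lemma lowpass_le1 xi : `|lowpass xi| <= 1.
Proof. by rewrite ger0_norm ?lowpass_ge0// ge_min lexx orbT. Qed.
Lemma measurable_lowpass : measurable_fun setT lowpass.
Proof. by apply: measurable_minr => //; exact: measurable_lam. Qed.

(** On the Fourier side Tonelli moves the time integral inside, where min(lam, 1) times the integral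
    of the resolvent is at most 1 by [integral_mlk_itv]. The absolute value of the integrand is
    taken beforehand, so the bound has no cancellation and is uniform in [T]. *)
Lemma integral_ip_Km (a w : fct) T : 0 < T -> L2 a -> L2 w ->
  (\int[leb]_(s in `]0%R, T[) `|ip w (Km s (fourier_multiplier lowpass a))|%:E <= (nrm a * nrm w)%:E)%E.
Proof.
move=> T0 ha hw; have [hphi phiE] := fourier_multiplierP measurable_lowpass lowpass_le1 ha.
set phi := fourier_multiplier lowpass a in hphi phiE *.
pose c xi := `|cdot (fourier a xi) (fourier w xi)|.
have mc : measurable_fun setT c.
  by apply: measurableT_comp => //; apply: measurable_cdot; apply: L2_cmeas; exact: L2_fourier.
have c0 xi : 0 <= c xi by exact: normr_ge0.
have hFa := L2_fourier ha; have hFw := L2_fourier hw.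
pose h (z : R * Rd R d) : R := \1_(`]0%R, T[%classic : set R) z.1 * (mK z.1 z.2 * (lowpass z.2 * c z.2)).
have mh : measurable_fun setT h.
  apply: measurable_funM; first exact: (measurableT_comp (measurable_indic _) measurable_fst).
  apply: measurable_funM; first exact: measurable_mK2.
  by apply: measurable_funM; [exact: (measurableT_comp measurable_lowpass measurable_snd)|exact: (measurableT_comp mc measurable_snd)].
have h0 z : 0 <= h z.
  rewrite /h indicE; apply: mulr_ge0; first exact: ler0n.
  apply: mulr_ge0; first exact: mK_ge0.
  by apply: mulr_ge0; [exact: lowpass_ge0|exact: c0].
apply: (@le_trans _ _ (\int[leb]_s \int[mu]_xi (h (s, xi))%:E)%E).
  rewrite integral_mkcond; apply: ge0_le_integral => //.
  - by move=> s _; rewrite /patch; case: ifPn => // _; rewrite lee_fin.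
  - apply/(measurable_restrictT _ _).1 => //; apply/measurable_funTS/measurable_EFinP.
    by apply: measurableT_comp => //; exact: measurable_ip_Km.
  - have := @measurable_param_integral _ _ _ _ _ mu (fun z : R * Rd R d => (h z)%:E).
    by apply; exact/measurable_EFinP.
  move=> s _; rewrite /patch; case: ifPn => sT; last first.
    by apply: integral_ge0 => xi _; rewrite lee_fin.
  rewrite ipC (ip_fourier_multiplier (measurable_mK s) (mK_le s) hphi hw).
  have hmm := L2_bounded (measurable_mK s) (mK_le s) (L2_bounded measurable_lowpass lowpass_le1 hFa).
  rewrite (@ae_ip _ _ _ (fun xi => (mK s xi)%:C%C * ((lowpass xi)%:C%C * fourier a xi))).
  - rewrite -abse_EFin ipE//; apply: (le_trans (le_abse_integral mu measurableT _)).
      by apply/measurable_EFinP; apply: measurable_cdot; exact: L2_cmeas.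
    apply: ge0_le_integral => //.
    + apply: measurableT_comp => //; apply/measurable_EFinP.
      by apply: measurable_cdot; exact: L2_cmeas.
    + have mp : measurable_fun setT (fun xi : Rd R d => (s, xi)).
        by apply/measurable_fun_pairP; split; [exact: measurable_cst|exact: measurable_id].
      by apply/measurable_EFinP; exact: (measurableT_comp mh mp).
    + move=> xi _ /=; rewrite lee_fin !cdotZl (normrM (mK s xi)) (normrM (lowpass xi)).
      by rewrite (ger0_norm (mK_ge0 s xi)) (ger0_norm (lowpass_ge0 xi)) /h /= indicE sT mul1r.
  - by apply: L2_cmeas; apply: (L2_bounded (measurable_mK s) (mK_le s)); exact: L2_fourier.
  - exact: L2_cmeas.
  - exact: L2_cmeas.
  - by apply: filterS phiE => xi ->.
have -> : (\int[leb]_s \int[mu]_xi (h (s, xi))%:E = \int[mu]_xi \int[leb]_s (h (s, xi))%:E)%E.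
  apply: (@fubini_tonelli _ _ _ _ _ leb mu (fun z : R * Rd R d => (h z)%:E)).
    exact/measurable_EFinP.
  by move=> z; rewrite lee_fin.
apply: (@le_trans _ _ (\int[mu]_xi (c xi)%:E)%E); last first.
  by rewrite -(nrm_fourier ha) -(nrm_fourier hw); exact: integral_abs_cdot_le.
apply: ge0_le_integral => //.
- by move=> xi _; apply: integral_ge0 => s _; rewrite lee_fin.
- have msw : measurable_fun setT (fun z : Rd R d * R => (z.2, z.1)).
    by apply/measurable_fun_pairP; split; [exact: measurable_snd|exact: measurable_fst].
  have := @measurable_param_integral _ _ _ _ _ leb (fun z : Rd R d * R => (h (z.2, z.1))%:E).
  by apply; apply/measurable_EFinP; exact: (measurableT_comp mh msw).
- exact/measurable_EFinP.
- move=> xi _.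
  have -> : (\int[leb]_s (h (s, xi))%:E = (lowpass xi * c xi)%:E * \int[leb]_(s in `]0%R, T[) (mlk al al (lam xi) s)%:E)%E.
    rewrite -ge0_integralZl//.
    + rewrite [RHS]integral_mkcond; apply: eq_integral => s _; rewrite /h /patch /= indicE.
      by case: ifPn => sT; rewrite ?mule0 ?mul0r// mul1r -EFinM mulrC.
    + by apply/measurable_EFinP/measurable_funTS; exact: measurable_mlk.
    + by move=> s _; rewrite lee_fin mlk_ge0.
    + by rewrite lee_fin mulr_ge0 ?lowpass_ge0.
  apply: (@le_trans _ _ ((c xi)%:E * (((lam xi)%:E * \int[leb]_(s in `]0%R, T[) (mlk al al (lam xi) s)%:E)))%E).
    rewrite mulrC EFinM -muleA lee_wpmul2l ?lee_fin// lee_wpmul2r//.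
      by apply: integral_ge0 => s _; rewrite lee_fin mlk_ge0.
    by rewrite lee_fin ge_min lexx.
  rewrite -[leRHS]mule1 lee_wpmul2l ?lee_fin//; exact: integral_mlk_itv.
Qed.

End resolvent.

Section quadratic.
Context {R : realType} {d : nat}.
Local Notation mu := (lebesgue_Rd d : {sigma_finite_measure set (Rd R d) -> \bar R}).
Local Notation fct := (Rd R d -> R[i]).

Lemma ip_mult_le (m1 m2 : Rd R d -> R) (M1 M2 : R) (f : fct) :
  measurable_fun setT m1 -> (forall x, `|m1 x| <= M1) ->
  measurable_fun setT m2 -> (forall x, `|m2 x| <= M2) -> L2 f ->
  (forall x, m1 x <= m2 x) ->
  ip (fun x => (m1 x)%:C%C * f x) f <= ip (fun x => (m2 x)%:C%C * f x) f.
Proof.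
move=> mm1 b1 mm2 b2 hf le12; have h1 := L2_bounded mm1 b1 hf; have h2 := L2_bounded mm2 b2 hf.
rewrite -subr_ge0 -ipBl//; apply: Rintegral_ge0 => x _ /=.
by rewrite cdotBl !cdotZl -mulrBl mulr_ge0 ?cdot_ge0// subr_ge0.
Qed.

(** The weight is at least 1, so the decay assumption reaches the L^2 norm; an infinite Sobolev norm
    is covered trivially. *)
Lemma sobolev_norm_ge (gam : R) (f : fct) : 0 <= gam -> L2 f ->
  ((nrm f)%:E <= sobolev_norm gam f)%E.
Proof.
move=> g0 hf; have hF := L2_fourier hf.
pose w (xi : Rd R d) := (1 + normRd xi ^+ 2) `^ (gam / 2).
have mw : measurable_fun setT w.
  apply: (measurableT_comp (@measurable_powR R _)); apply: measurable_funD => //.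
  by apply: measurable_funX; exact: measurable_normRd.
have w1 xi : 1 <= w xi.
  rewrite -(powRr0 (1 + normRd xi ^+ 2)) /w; apply: ler_powR; first by rewrite lerDl sqr_ge0.
  by rewrite divr_ge0.
rewrite /sobolev_norm -/(w _).
have [lty|] := ltP (cLnorm 2%:E (fun xi => (w xi)%:C%C * fourier f xi)) +oo%E; last first.
  by rewrite leye_eq => /eqP->; rewrite leey.
have [mr mi] := cmeasZ mw (L2_cmeas hF).
have hw : L2 (fun xi => (w xi)%:C%C * fourier f xi) by split.
rewrite cLnorm_nrm// lee_fin -(nrm_fourier hf) ler_sqrt ?ip_ge0//.
rewrite -lee_fin !ipE//; apply: ge0_le_integral => //.
- by move=> x _; rewrite lee_fin cdot_ge0.
- by apply/measurable_EFinP; apply: measurable_cdot; exact: L2_cmeas.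
- by apply/measurable_EFinP; apply: measurable_cdot; exact: L2_cmeas.
- move=> x _; rewrite lee_fin cdotZl cdotC cdotZl mulrA ler_peMl ?cdot_ge0//.
  by apply: mulr_ege1; exact: w1.
Qed.

End quadratic.

(** * The mild solution: growth of its time integral, and vanishing *)

Section mild.
Context {R : realType} {d : nat}.
Local Notation mu := (lebesgue_Rd d : {sigma_finite_measure set (Rd R d) -> \bar R}).
Local Notation fct := (Rd R d -> R[i]).
Local Notation leb := (@lebesgue_measure R).
Variables (al be : R) (a : fct) (p q : Rd R d -> R) (M : R) (u : R -> fct).
Hypotheses (al01 : 0 < al < 1) (ha : L2 a) (mp : measurable_fun setT p).
Hypotheses (M0 : 0 <= M) (mq : measurable_fun setT q) (qM : forall x, `|q x| <= M).
Hypothesis pq : {ae mu, forall x, p x = q x}.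
Hypothesis hu : mild_solution al be p a u.

Let al0 : 0 < al. Proof. by case/andP: al01. Qed.
Let al1 : al < 1. Proof. by case/andP: al01. Qed.
Let Ga0 : 0 < Gamma al. Proof. exact: Gamma_gt0. Qed.

Let L2u t : 0 < t -> L2 (u t). Proof. by have [h _ _ _] := hu; exact: h. Qed.

Let qu t : fct := fun x => (q x)%:C%C * u t x.
Let pu t : fct := fun x => (p x)%:C%C * u t x.

Let L2qu t : 0 < t -> L2 (qu t).
Proof. by move=> t0; exact: (L2_bounded mq qM (L2u t0)). Qed.

Let pu_qu t : {ae mu, forall x, qu t x = pu t x}.
Proof. by apply: filterS pq => x; rewrite /qu /pu => ->. Qed.

Let L2pu t : 0 < t -> L2 (pu t).
Proof.
move=> t0; apply: (ae_L2 (L2qu t0) _ (pu_qu t)).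
by apply: cmeasZ => //; exact: L2_cmeas (L2u t0).
Qed.

Let mS t (xi : Rd R d) : R := mittag_leffler al 1 (- (normRd xi `^ be * t `^ al)).

Let mmS t : measurable_fun setT (mS t).
Proof.
apply: (measurableT_comp (measurable_ml al0 (@ltr01 R))); apply: measurable_funN.
by apply: measurable_funM => //; exact: measurable_lam.
Qed.

Let mS_le1 t xi : 0 < t -> `|mS t xi| <= 1.
Proof.
move=> t0; rewrite ger0_norm; first by apply: ml1_le1 => //; exact: powR_ge0.
by apply: ml1_ge0 => //; [exact: powR_ge0|exact: ltW].
Qed.

Let L2S t (f : fct) : 0 < t -> L2 f -> L2 (Sop al be t f).
Proof. by move=> t0 hf; have [] := fourier_multiplierP (mmS t) (fun xi => @mS_le1 t xi t0) hf. Qed.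

Let B t : fct := bochner_integral `]0, t[ (mild_integrand al be p u t).

Let bochB t : 0 < t -> bochner_integrable `]0, t[ (mild_integrand al be p u t).
Proof. by have [_ _ h _] := hu; exact: h. Qed.

Let L2B' t : 0 < t -> L2 (B t).
Proof. by move=> t0; have [] := bochner_integral_ip (measurable_itv _) (bochB t0). Qed.

Lemma mild_ip t g : 0 < t -> L2 g -> ip (u t) g = ip (Sop al be t a) g + ip (B t) g.
Proof.
move=> t0 hg; have [_ _ _ /(_ t t0) h] := hu.
rewrite -ipDl//; [|exact: L2S|exact: L2B'].
apply: ae_ip => //; apply: L2_cmeas => //; first exact: L2u.
by apply: L2D; [exact: L2S|exact: L2B'].
Qed.

Let G1 : 0 < Gamma (1 - al). Proof. by apply: Gamma_gt0; rewrite subr_gt0. Qed.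

(** For 0 < t < T and T >= 1, [ml1_lower] bounds the multiplier of [Sop] below by T^(-al) / (1 +
    Gamma(1-al) lam). This is that bound without T^(-al), times the cut-off. *)
Definition weight (xi : Rd R d) : R := lowpass be xi / (1 + Gamma (1 - al) * normRd xi `^ be).

Let den_ge1 (xi : Rd R d) : 1 <= 1 + Gamma (1 - al) * normRd xi `^ be.
Proof. by rewrite lerDl; exact: mulr_ge0 (ltW G1) (powR_ge0 _ _). Qed.

Lemma weight_ge0 xi : 0 <= weight xi.
Proof. by rewrite divr_ge0 ?lowpass_ge0// (le_trans _ (den_ge1 xi)). Qed.

Lemma weight_le1 xi : `|weight xi| <= 1.
Proof.
rewrite ger0_norm ?weight_ge0// ler_pdivrMr ?(lt_le_trans _ (den_ge1 xi))// mul1r.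
by rewrite (le_trans _ (den_ge1 xi))// (le_trans (ler_norm _))// lowpass_le1.
Qed.

Lemma measurable_weight : measurable_fun setT weight.
Proof.
rewrite (_ : weight = fun xi => lowpass be xi * (1 + Gamma (1 - al) * normRd xi `^ be) `^ (-1)).
  apply: measurable_funM; first exact: measurable_lowpass.
  apply: (measurableT_comp (@measurable_powR R _)); apply: measurable_funD => //.
  by apply: measurable_funM => //; exact: measurable_lam.
by apply/funext => xi; rewrite powR_inv1// (le_trans _ (den_ge1 xi)).
Qed.

Let c0 := ip (fun xi => (weight xi)%:C%C * fourier a xi) (fourier a).
Let phi := fourier_multiplier (lowpass be) a.

Let hphi : L2 phi.
Proof. by have [] := fourier_multiplierP (measurable_lowpass be) (lowpass_le1 be) ha. Qed.

Let c0_ge0 : 0 <= c0.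
Proof. by apply: Rintegral_ge0 => xi _; rewrite /= cdotZl mulr_ge0 ?weight_ge0 ?cdot_ge0. Qed.

(** The solution has a strongly measurable representative only up to a null set of times, and
    integrability is assumed on each bounded interval separately, hence the dependence on [T]. *)
Definition version T (v : R -> fct) : Prop :=
  [/\ L2meas v, {ae leb, forall t, (`]0, T[%classic : set R) t -> u t = v t} &
    (\int[leb]_(t in `]0%R, T[) (nrm (v t))%:E < +oo)%E].

Lemma exists_version T : 0 < T -> exists v, version T v.
Proof.
move=> T0; have [_ /(_ T T0) h _ _] := hu.
by have [_ [v [h1 h2 h3 _]]] := bochner_integral_ip (measurable_itv _) h; exists v.
Qed.

Section with_version.
Variables (T : R) (v : R -> fct).
Hypotheses (T0 : 0 < T) (hv : version T v).
Let D : set R := `]0, T[%classic.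

Let mD : measurable D. Proof. exact: measurable_itv. Qed.
Let mv : L2meas v. Proof. by case: hv. Qed.
Let L2v t : L2 (v t). Proof. by have [h _] := mv; exact: h. Qed.
Let uv : {ae leb, forall t, D t -> u t = v t}. Proof. by case: hv. Qed.

Lemma measurable_nrm_version : measurable_fun setT (fun t => nrm (v t)).
Proof. exact: L2meas_nrm. Qed.

(** The time of the solution and the time of the kernel are kept as independent variables, which
    makes joint measurability and Tonelli available before substituting t - s. *)
Let pair g (z : R * R) : R := `|ip (fun x => (q x)%:C%C * v z.1 x) (Km al be z.2 g)|.

Let mpair g : L2 g -> measurable_fun setT (pair g).
Proof.
move=> hg; apply: measurableT_comp => //.
apply: (@L2meas_ip R d _ _ _ _ (fun t x => (q x)%:C%C * v t x) (fun s => Km al be s g)).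
- exact: (L2meas_scale mq qM mv).
- by move=> s; exact: L2_Km.
- by move=> f hf; exact: measurable_ip_Km.
Qed.

Let msub t : measurable_fun setT (fun s : R => (s, t - s)).
Proof. by apply/measurable_fun_pairP; split => /=; [exact: measurable_id|exact: measurable_funB]. Qed.

(** The kernel passes to the test function by self-adjointness, and the potential is replaced by its
    bounded version. Only the solution remains on the left of the pairing. *)
Let integrand_ip t s g : 0 < s -> s < t -> L2 g ->
  ip (mild_integrand al be p u t s) g = ip (qu s) (Km al be (t - s) g).
Proof.
move=> s0 st hg; have ts0 : 0 < t - s by rewrite subr_gt0.
rewrite /mild_integrand KopE// -/(pu s).
rewrite (fourier_multiplier_adj (measurable_mK be al01 _) (mK_le be al01 _) (L2pu s0) hg).
symmetry; apply: ae_ip.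
- exact: L2_cmeas (L2qu s0).
- exact: L2_cmeas (L2pu s0).
- by apply: L2_cmeas; exact: L2_Km.
- exact: pu_qu.
Qed.

Lemma mild_integral_le t g : 0 < t -> t <= T -> L2 g ->
  (`|ip (B t) g|%:E <= \int[leb]_(s in `]0%R, t[) (pair g (s, t - s))%:E)%E.
Proof.
move=> t0 tT hg; apply: (bochner_integral_ip_le (measurable_itv _) (bochB t0) hg).
- by apply: measurable_funTS; exact: (measurableT_comp (mpair hg) (msub t)).
- by move=> s; exact: normr_ge0.
- apply: (@filterS _ (almost_everywhere leb) _ _ _ _ uv) => s us.
  rewrite /= in_itv/= => /andP[s0 st]; rewrite integrand_ip// /pair /qu us//=.
  by rewrite /D /= in_itv/= s0/= (lt_le_trans st).
Qed.

(** Keeps the singular kernel explicit, in the form that Gronwall's inequality takes as input. *)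
Lemma mild_nrm_le t g : 0 < t -> t <= T -> L2 g ->
  (`|ip (B t) g|%:E <= (M / Gamma al * nrm g)%:E *
    \int[leb]_(s in `]0%R, t[) (pk al (t - s) * nrm (v s))%:E)%E.
Proof.
move=> t0 tT hg; apply: (le_trans (mild_integral_le t0 tT hg)).
have mpk : measurable_fun setT (fun s : R => pk al (t - s) * nrm (v s)).
  apply: measurable_funM; last exact: measurable_nrm_version.
  by apply: (measurableT_comp (@measurable_pk _ al)); exact: measurable_funB.
rewrite -ge0_integralZl//.
- apply: ge0_le_integral => //.
  + by move=> s _; rewrite lee_fin normr_ge0.
  + by apply/measurable_EFinP/measurable_funTS; exact: (measurableT_comp (mpair hg) (msub t)).
  + by apply: measurable_funeM; apply/measurable_EFinP/measurable_funTS.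
  + move=> s _; rewrite -EFinM lee_fin /pair /=.
    have hqv : L2 (fun x => (q x)%:C%C * v s x) by exact: (L2_bounded mq qM).
    apply: (le_trans (ip_CS hqv (L2_Km be al01 _ hg))).
    apply: (@le_trans _ _ ((M * nrm (v s)) * (pk al (t - s) / Gamma al * nrm g))).
      by apply: ler_pM; rewrite ?nrm_ge0//; [exact: nrm_bounded|exact: nrm_Km].
    by rewrite le_eqVlt; apply/orP; left; apply/eqP; ring.
- by apply/measurable_EFinP/measurable_funTS.
- by move=> s _; rewrite lee_fin mulr_ge0 ?pk_ge0 ?nrm_ge0.
- by rewrite lee_fin; exact: mulr_ge0 (divr_ge0 M0 (ltW Ga0)) (nrm_ge0 g).
Qed.

(** On the Fourier side both members are quadratic forms in the transform of [a], so a comparison of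
    multipliers suffices. The hypothesis 1 <= T lets T^al dominate the constant 1 in the denominator
    of [ml1_lower]. *)
Lemma Sop_lower t : 1 <= T -> 0 < t -> t < T -> T `^ (- al) * c0 <= ip (Sop al be t a) phi.
Proof.
move=> T1 t0 tT; have hFa := L2_fourier ha.
have [_ phiE] := fourier_multiplierP (measurable_lowpass be) (lowpass_le1 be) ha.
have hSa := L2_bounded (mmS t) (fun xi => @mS_le1 t xi t0) hFa.
have hla := L2_bounded (measurable_lowpass be) (lowpass_le1 be) hFa.
rewrite (ip_fourier_multiplier (mmS t) (fun xi => @mS_le1 t xi t0) ha hphi) ipC.
rewrite (ae_ip _ _ _ phiE); try (by apply: L2_cmeas); last by apply: L2_cmeas; exact: L2_fourier.
rewrite -[leRHS]ipMl.
have mwT : measurable_fun setT (fun xi => T `^ (- al) * weight xi).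
  by apply: measurable_funM => //; exact: measurable_weight.
have wT xi : `|T `^ (- al) * weight xi| <= T `^ (- al).
  by rewrite normrM ger0_norm ?powR_ge0// ler_piMr ?powR_ge0// weight_le1.
have mSl : measurable_fun setT (fun xi => mS t xi * lowpass be xi).
  by apply: measurable_funM; [exact: mmS|exact: measurable_lowpass].
have Sl1 xi : `|mS t xi * lowpass be xi| <= 1.
  by rewrite normrM mulr_ile1 ?mS_le1 ?lowpass_le1.
have -> : T `^ (- al) * c0 = ip (fun xi => (T `^ (- al) * weight xi)%:C%C * fourier a xi) (fourier a).
  rewrite /c0 -ipZl//; last by exact: (L2_bounded measurable_weight weight_le1).
  by congr ip; apply/funext => xi; rewrite mulrA -rmorphM.
rewrite (_ : (fun x => (mS t x)%:C%C * _) = (fun xi => (mS t xi * lowpass be xi)%:C%C * fourier a xi)); last first.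
  by apply/funext => xi; rewrite mulrA -rmorphM.
apply: (ip_mult_le mwT wT mSl Sl1 hFa) => xi.
have lam0 : 0 <= normRd xi `^ be by exact: powR_ge0.
have T0' : 0 < T `^ al by exact: powR_gt0.
rewrite /weight mulrCA mulrC ler_wpM2r ?lowpass_ge0// powRN.
rewrite -invfM -[X in X <= _]mul1r ler_pdivrMr; last first.
  by rewrite mulr_gt0// (lt_le_trans _ (den_ge1 xi)).
have mS0 : 0 <= mS t xi by apply: ml1_ge0 => //; exact: ltW.
apply: (le_trans (ml1_lower al01 lam0 t0)); rewrite mulrC ler_wpM2l//.
have tTa : t `^ al <= T `^ al by apply: ge0_ler_powR; rewrite ?nnegrE ltW.
have Ta1 : 1 <= T `^ al by rewrite -(powRr0 T); apply: ler_powR => //; exact: ltW.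
by rewrite mulrDr mulr1 lerD// mulrC; exact: ler_wpM2r (mulr_ge0 (ltW G1) lam0) _ _ tTa.
Qed.

Let ind (t : R) : R := \1_D t.
Let ind_ge0 t : 0 <= ind t. Proof. by rewrite /ind indicE ler0n. Qed.
Let mind : measurable_fun setT ind. Proof. exact: measurable_indic. Qed.

(** The triangle 0 < s < t < T is enlarged to the parallelogram where [s] and [t - s] both lie in
    ]0, T[. The integrand is nonnegative, and a shift turns this domain into a square. *)
Let kern (t s : R) : R := ind s * (ind (t - s) * pair phi (s, t - s)).

Let kern_ge0 t s : 0 <= kern t s.
Proof. by rewrite /kern mulr_ge0// mulr_ge0// normr_ge0. Qed.

Let mkern : measurable_fun setT (fun z : R * R => kern z.1 z.2).
Proof.
have ms : measurable_fun setT (fun z : R * R => (z.2, z.1 - z.2)).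
  apply/measurable_fun_pairP; split => /=; first exact: measurable_snd.
  by apply: measurable_funB; [exact: measurable_fst|exact: measurable_snd].
apply: measurable_funM; first exact: (measurableT_comp mind measurable_snd).
apply: measurable_funM; last exact: (measurableT_comp (mpair hphi) ms).
apply: (measurableT_comp mind).
by apply: measurable_funB; [exact: measurable_fst|exact: measurable_snd].
Qed.

Let J t : \bar R := (\int[leb]_s (kern t s)%:E)%E.

Let mJ : measurable_fun setT J.
Proof.
have := @measurable_param_integral _ _ _ _ _ leb (fun z : R * R => (kern z.1 z.2)%:E).
by apply; exact/measurable_EFinP.
Qed.

Let J_ge0 t : (0 <= J t)%E.
Proof. by apply: integral_ge0 => s _; rewrite lee_fin. Qed.

Let mild_le_J t : D t -> (`|ip (B t) phi|%:E <= J t)%E.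
Proof.
rewrite /D /= in_itv/= => /andP[t0 tT].
apply: (le_trans (mild_integral_le t0 (ltW tT) hphi)).
rewrite integral_mkcond; apply: ge0_le_integral_sup => s; rewrite /patch; case: ifPn => //.
- by move=> _; rewrite lee_fin normr_ge0.
- rewrite inE /= in_itv/= => /andP[s0 st]; rewrite lee_fin /kern /ind !indicE !mem_set ?mul1r//.
    by rewrite /D /= in_itv/= subr_gt0 st/= (le_lt_trans _ tT)// gerBl ltW.
  by rewrite /D /= in_itv/= s0/= (lt_trans st).
- by rewrite lee_fin.
Qed.

Let integral_ind_nrm : (\int[leb]_s ((ind s)%:E * (nrm (v s))%:E) = \int[leb]_(t in D) (nrm (v t))%:E)%E.
Proof.
rewrite [RHS]integral_mkcond; apply: eq_integral => s _; rewrite /patch /ind indicE.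
by case: ifPn => _; rewrite ?mul1e ?mul0e.
Qed.

(** After Tonelli and the substitution r = t - s, the inner integral over the time of the kernel is
    bounded by [integral_ip_Km], uniformly in [T]. *)
Let integral_J_le : (\int[leb]_t J t <= (M * nrm a)%:E * \int[leb]_(t in D) (nrm (v t))%:E)%E.
Proof.
have -> : (\int[leb]_t J t = \int[leb]_s \int[leb]_t (kern t s)%:E)%E.
  apply: (@fubini_tonelli _ _ _ _ _ leb leb (fun z : R * R => (kern z.1 z.2)%:E)).
    exact/measurable_EFinP.
  by move=> z; rewrite lee_fin.
have Ma0 : 0 <= M * nrm a by rewrite mulr_ge0 ?nrm_ge0.
have mnv := measurable_nrm_version.
rewrite -integral_ind_nrm -ge0_integralZl//; last 2 first.
- by apply/measurable_EFinP; exact: measurable_funM.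
- by move=> s _; rewrite -EFinM lee_fin mulr_ge0 ?nrm_ge0.
apply: ge0_le_integral_sup => s.
  by apply: integral_ge0 => t _; rewrite lee_fin.
have mP : measurable_fun setT (fun r : R => (ind r * pair phi (s, r))%:E).
  apply/measurable_EFinP; apply: measurable_funM => //.
  have ms : measurable_fun setT (fun r : R => (s, r)).
    by apply/measurable_fun_pairP; split => /=; [exact: measurable_cst|exact: measurable_id].
  exact: (measurableT_comp (mpair hphi) ms).
have P0 r : (0 <= (ind r * pair phi (s, r))%:E)%E by rewrite lee_fin mulr_ge0// normr_ge0.
have mPs : measurable_fun setT (fun t : R => (ind (t - s) * pair phi (s, t - s))%:E).
  by apply: (measurableT_comp mP); exact: measurable_funB.
have -> : (\int[leb]_t (kern t s)%:E = (ind s)%:E * \int[leb]_t (ind (t - s) * pair phi (s, t - s))%:E)%E.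
  rewrite -(ge0_integralZl leb measurableT mPs); [by []|by move=> t _; exact: P0|by rewrite lee_fin].
have -> : (\int[leb]_t (ind (t - s) * pair phi (s, t - s))%:E = \int[leb]_(r in D) (pair phi (s, r))%:E)%E.
  have -> := ge0_integral_shift (- s) mP P0.
  rewrite [RHS]integral_mkcond; apply: eq_integral => r _; rewrite /patch /ind indicE.
  by case: ifPn => _; rewrite ?mul1r ?mul0r.
rewrite muleCA lee_wpmul2l ?lee_fin//.
have hqv : L2 (fun x => (q x)%:C%C * v s x) by exact: (L2_bounded mq qM).
apply: (le_trans (integral_ip_Km be al01 T0 ha hqv)).
rewrite -EFinM lee_fin [M * _]mulrC -mulrA ler_wpM2l ?nrm_ge0//.
exact: nrm_bounded.
Qed.

(** The mild equation paired with [phi] and integrated over ]0, T[: the constant lower bound T^(-al)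
    c0 integrates to the left-hand side. *)
Lemma test_bound : 1 <= T ->
  ((T `^ (1 - al) * c0)%:E <= (nrm phi + M * nrm a)%:E * \int[leb]_(t in `]0%R, T[) (nrm (v t))%:E)%E.
Proof.
rewrite -/D => T1; have mnv := measurable_nrm_version.
have mnv' : measurable_fun D (fun t => (nrm (v t))%:E) by apply/measurable_EFinP/measurable_funTS.
have nv0 t : D t -> (0 <= (nrm (v t))%:E)%E by rewrite lee_fin nrm_ge0.
have Tc0 : 0 <= T `^ (- al) * c0 by rewrite mulr_ge0 ?powR_ge0.
have -> : ((T `^ (1 - al) * c0)%:E = \int[leb]_(t in D) (T `^ (- al) * c0)%:E)%E.
  rewrite integral_cst//= /D lebesgue_measure_itv/= lte_fin T0 -EFinD subr0 -EFinM; congr EFin.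
  rewrite mulrAC -[X in _ = _ * X * _](powRr1 (ltW T0)) -powRD ?(gt_eqF T0) ?implybT//.
  by rewrite [- al + 1]addrC.
apply: (@le_trans _ _ (\int[leb]_(t in D) ((nrm phi)%:E * (nrm (v t))%:E + J t))%E).
  apply: ae_ge0_le_integral => //.
  - by move=> t _; rewrite -EFinM adde_ge0// lee_fin mulr_ge0 ?nrm_ge0.
  - by apply: emeasurable_funD; [exact: measurable_funeM|exact: measurable_funTS].
  - apply: (@filterS _ (almost_everywhere leb) _ _ _ _ uv) => t ut Dt.
    have := Dt; rewrite /D /= in_itv/= => /andP[t0 tT].
    have := mild_ip t0 hphi; have := Sop_lower T1 t0 tT.
    move=> h1 h2; have h3 : T `^ (- al) * c0 <= nrm phi * nrm (v t) + `|ip (B t) phi|.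
      apply: (le_trans h1); rewrite -(ut Dt) -lerBlDr.
      apply: (@le_trans _ _ (`|ip (u t) phi|)); last by rewrite mulrC ip_CS//; exact: L2u.
      rewrite h2 lerBlDr; apply: le_trans (ler_norm _) _.
      by rewrite -[X in `|X| <= _](addrK (ip (B t) phi)) (le_trans (ler_normB _ _)).
    apply: (@le_trans _ _ (nrm phi * nrm (v t) + `|ip (B t) phi|)%:E); first by rewrite lee_fin.
    by rewrite EFinD EFinM leeD2l// mild_le_J.
rewrite ge0_integralD//; last 3 first.
- by move=> t _; rewrite -EFinM lee_fin mulr_ge0 ?nrm_ge0.
- exact: measurable_funeM.
- exact: measurable_funTS.
rewrite (ge0_integralZl leb mD mnv' nv0); last by rewrite lee_fin nrm_ge0.
rewrite EFinD ge0_muleDl ?lee_fin ?nrm_ge0 ?mulr_ge0 ?nrm_ge0//.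
apply: leeD2l; apply: le_trans integral_J_le.
rewrite integral_mkcond; apply: ge0_le_integral_sup => t; rewrite /patch; case: ifPn => // _.
Qed.

(** With zero initial data only the convolution term remains; it is tested against [u t] itself, and
    one factor of the norm is divided out. *)
Lemma nrm_u_le t : 0 < t -> t <= T -> nrm a = 0 ->
  ((nrm (u t))%:E <= (M / Gamma al)%:E * \int[leb]_(s in `]0%R, t[) (pk al (t - s) * nrm (v s))%:E)%E.
Proof.
move=> t0 tT a0; set X := (\int[leb]_(s in _) _)%E.
have X0 : (0 <= X)%E by apply: integral_ge0 => s _; rewrite lee_fin mulr_ge0 ?pk_ge0 ?nrm_ge0.
have MG : 0 <= M / Gamma al by exact: divr_ge0 M0 (ltW Ga0).
have := nrm_ge0 (u t); rewrite le_eqVlt => /orP[/eqP<-|up]; first by apply: mule_ge0; rewrite ?lee_fin.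
have hut := L2u t0; have := mild_nrm_le t0 tT hut; rewrite -/X => hX.
have S0 : ip (Sop al be t a) (u t) = 0.
  apply/eqP; rewrite -normr_le0; apply: (le_trans (ip_CS (L2S t0 ha) hut)).
  have := nrm_fourier_multiplier (mmS t) (fun xi => @mS_le1 t xi t0) ha; rewrite a0 mulr0 => h.
  by rewrite (le_trans (ler_wpM2r (nrm_ge0 _) h))// mul0r.
have h : ((nrm (u t) ^+ 2)%:E <= (M / Gamma al * nrm (u t))%:E * X)%E.
  apply: le_trans hX; rewrite nrm_sq (mild_ip t0 hut) S0 add0r lee_fin; exact: ler_norm.
have up' : (0 <= ((nrm (u t))^-1)%:E)%E by rewrite lee_fin invr_ge0 ltW.
have := lee_wpmul2l up' h; rewrite muleA -!EFinM expr2 mulKf ?gt_eqF//.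
by rewrite mulrCA mulVf ?mulr1 ?gt_eqF.
Qed.

End with_version.

Lemma nrm_u_eq0 t : 0 < t -> nrm a = 0 -> nrm (u t) = 0.
Proof.
move=> t0 a0; have [v hv] := exists_version t0; have [mv uv fin] := hv.
pose D : set R := `]0, t[%classic.
pose n (s : R) : R := \1_D s * nrm (v s).
have mnv := measurable_nrm_version hv.
have mn : measurable_fun setT n.
  by apply: measurable_funM => //; apply: measurable_indic; exact: measurable_itv.
have MG : 0 <= M / Gamma al by exact: divr_ge0 M0 (ltW Ga0).
have nE r : r <= t -> (\int[leb]_(s in `]0%R, r[) (pk al (r - s) * nrm (v s))%:E =
    \int[leb]_s (pk al (r - s) * n s)%:E)%E.
  move=> rt; rewrite integral_mkcond; apply: eq_integral => s _; rewrite /patch /n indicE.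
  case: ifPn => [|].
    rewrite inE /= in_itv/= => /andP[s0 sr]; rewrite mem_set ?mul1r//.
    by rewrite /D /= in_itv/= s0/= (lt_le_trans sr).
  rewrite notin_setE /= in_itv/= => /negP; rewrite negb_and -!leNgt => /orP[s0|rs].
    rewrite memNset ?mul0r ?mulr0// /D /= in_itv/= => /andP[]; by rewrite ltNge s0.
  by rewrite pk0 ?mul0r// subr_le0.
have n_ae : {ae leb, forall s, n s = 0}.
  apply: (@singular_gronwall _ al (M / Gamma al)) => //.
  - by move=> s; rewrite mulr_ge0 ?nrm_ge0// indicE ler0n.
  - move=> s s0; rewrite /n indicE memNset ?mul0r// /D /= in_itv/= => /andP[]; by rewrite ltNge s0.
  - apply: le_lt_trans fin; rewrite [leRHS]integral_mkcond le_eqVlt; apply/orP; left; apply/eqP.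
    apply: eq_integral => s _; rewrite /patch /n indicE.
    by case: ifPn => _; rewrite ?mul1r ?mul0r.
  - apply: (@filterS _ (almost_everywhere leb) _ _ _ _ uv) => r ur.
    rewrite /n indicE; case: (boolP (r \in D)) => [|_]; last first.
      rewrite mul0r; apply: mule_ge0; rewrite ?lee_fin//.
      by apply: integral_ge0 => s _; rewrite lee_fin mulr_ge0 ?pk_ge0// mulr_ge0 ?nrm_ge0// indicE ler0n.
    rewrite inE => Dr; rewrite mul1r -(ur Dr); move: Dr; rewrite /D /= in_itv/= => /andP[r0 rt].
    have := nrm_u_le hv r0 (ltW rt) a0; rewrite nE//; exact: ltW.
(* Gronwall gives vanishing at almost every time before [t]; inserting this into the inequality at
   [t] itself gives it at the chosen time. *)
have := nrm_u_le hv t0 (lexx t) a0; rewrite nE//.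
have -> : (\int[leb]_s (pk al (t - s) * n s)%:E = 0)%E.
  rewrite (ae_eq_integral (cst 0%E)) ?integral0//.
  - apply/measurable_EFinP; apply: measurable_funM => //.
    by apply: (measurableT_comp (@measurable_pk _ al)); exact: measurable_funB.
  - by apply: (@filterS _ (almost_everywhere leb) _ _ _ _ n_ae) => s -> _; rewrite mulr0.
by rewrite mule0 lee_fin => h; apply/eqP; rewrite eq_le h nrm_ge0.
Qed.

(** Up to the time [T0] from which the decay holds, the integral is a constant independent of [T]
    and of the version. Beyond it the integrand is at most e s^(-al), integrated by the Beta formula
    with the kernel [pk 1]; the Gamma quotient equals 1/(1-al). *)
Lemma version_growth (Hdec : forall e, 0 < e -> exists2 T0, 0 < T0 & forall t, T0 <= t -> nrm (u t) <= e * t `^ (- al)) e :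
  0 < e -> exists2 C, 0 <= C & forall T v, 0 < T -> version T v ->
  (\int[leb]_(t in `]0%R, T[) (nrm (v t))%:E <=
    (C + e * (Gamma 1 * Gamma (1 - al) / Gamma (1 + (1 - al))) * T `^ (1 - al))%:E)%E.
Proof.
move=> e0; have [T0 T00 HT0] := Hdec e e0; have [v0 hv0] := exists_version T00.
have [mv0 uv0 fin0] := hv0; have mnv0 := measurable_nrm_version hv0.
set I0 := (\int[leb]_(t in _) _)%E in fin0; have I00 : (0 <= I0)%E by apply: integral_ge0 => t _; rewrite lee_fin nrm_ge0.
exists (fine I0); first exact: fine_ge0.
move=> T v T1 hv; have [mv uv fin] := hv; have mnv := measurable_nrm_version hv.
have a10 : 0 < 1 - al by rewrite subr_gt0.
have mpk : measurable_fun setT (fun s : R => pk 1 (T - s) * pk (1 - al) s).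
  apply: measurable_funM; last exact: measurable_pk.
  by apply: (measurableT_comp (@measurable_pk _ 1)); exact: measurable_funB.
have pk0 s : 0 <= pk 1 (T - s) * pk (1 - al) s by rewrite mulr_ge0 ?pk_ge0.
have If : I0 \is a fin_num by rewrite (ge0_fin_numE I00); exact: fin0.
have -> : forall r, ((fine I0 + r)%:E = I0 + r%:E)%E by move=> r; rewrite EFinD (fineK If).
have -> : (I0 + (e * (Gamma 1 * Gamma (1 - al) / Gamma (1 + (1 - al))) * T `^ (1 - al))%:E =
    \int[leb]_s ((\1_(`]0%R, T0[%classic : set R) s * nrm (v0 s))%:E + (e * (pk 1 (T - s) * pk (1 - al) s))%:E))%E.
  rewrite ge0_integralD//; last 4 first.
  - by move=> s _; rewrite lee_fin mulr_ge0 ?nrm_ge0// indicE ler0n.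
  - by apply/measurable_EFinP; apply: measurable_funM => //; exact: measurable_indic.
  - by move=> s _; rewrite lee_fin mulr_ge0 ?pk0// ltW.
  - by apply/measurable_EFinP; exact: measurable_funM.
  congr (_ + _)%E.
    rewrite /I0 [LHS]integral_mkcond; apply: eq_integral => s _; rewrite /patch indicE.
    by case: ifPn => _; rewrite ?mul1r ?mul0r.
  under [RHS]eq_integral do rewrite EFinM.
  rewrite ge0_integralZl//; last 3 first.
  - exact/measurable_EFinP.
  - by move=> s _; rewrite lee_fin.
  - by rewrite lee_fin ltW.
  rewrite conv_pk// -EFinM -mulrA; congr (_ * (_ * (_ `^ _)))%:E; ring.
rewrite integral_mkcond; apply: ae_ge0_le_integral => //.
- by move=> s _; apply: erestrict_ge0 => t _; rewrite lee_fin nrm_ge0.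
- by apply/(measurable_restrictT _ _).1 => //; apply/measurable_EFinP/measurable_funTS.
- move=> s _; rewrite -EFinD lee_fin addr_ge0// ?mulr_ge0 ?nrm_ge0 ?pk_ge0 ?(ltW e0)// indicE ler0n//.
- apply: emeasurable_funD; apply/measurable_EFinP; last exact: measurable_funM.
  by apply: measurable_funM => //; exact: measurable_indic.
- apply: (@filterS2 _ (almost_everywhere leb) _ _ _ _ _ uv uv0) => s us us0 _; rewrite -EFinD.
  have e2 : 0 <= e * (pk 1 (T - s) * pk (1 - al) s) by rewrite mulr_ge0 ?pk0// ltW.
  rewrite /patch; case: ifPn => [|_]; last first.
    by rewrite lee_fin addr_ge0// mulr_ge0 ?nrm_ge0// indicE ler0n.
  rewrite inE => sT; rewrite -(us sT) lee_fin; move: sT; rewrite /= in_itv/= => /andP[s0 sT].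
  have [sT0|Ts] := ltP s T0.
    rewrite indicE mem_set ?mul1r; last by rewrite /= in_itv/= s0.
    by rewrite -us0 ?lerDl//= in_itv/= s0.
  apply: (le_trans (HT0 s Ts)); rewrite pk1E ?subr_gt0// mul1r pkE// (_ : 1 - al - 1 = - al); last by ring.
  by rewrite lerDr mulr_ge0 ?nrm_ge0// indicE ler0n.
Qed.

(** Both sides of [test_bound] grow like T^(1-al), the right-hand side with an arbitrarily small
    factor and a constant remainder. Hence c0 = 0, and the weight is positive off the origin, so the
    transform of [a] vanishes almost everywhere. *)
Lemma amplitude_eq0 : (0 < d)%N ->
  (forall e, 0 < e -> exists2 T0, 0 < T0 & forall t, T0 <= t -> nrm (u t) <= e * t `^ (- al)) ->
  nrm a = 0.
Proof.
move=> d0 Hdec; have a10 : 0 < 1 - al by rewrite subr_gt0.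
pose Q := nrm phi + M * nrm a.
pose K := Gamma 1 * Gamma (1 - al) / Gamma (1 + (1 - al)).
have Q0 : 0 <= Q by rewrite addr_ge0 ?mulr_ge0 ?nrm_ge0.
have K0 : 0 <= K.
  have g1 := Gamma_gt0 (@ltr01 R); have g2 := Gamma_gt0 (addr_gt0 (@ltr01 R) a10).
  by apply: divr_ge0 (ltW g2); exact: mulr_ge0 (ltW g1) (ltW G1).
have key e : 0 < e -> c0 <= e * (1 + Q * K).
  move=> e0; have [C C0 HC] := version_growth Hdec e0.
  (* Large enough for the remainder Q C, which depends on [e], to be absorbed into e T^(1-al). *)
  pose T := Num.max 1 ((Q * C / e) `^ (1 - al)^-1).
  have T1 : 1 <= T by rewrite le_max lexx.
  have T0 : 0 < T by exact: lt_le_trans T1.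
  have QC0 : 0 <= Q * C / e by apply: divr_ge0 (ltW e0); exact: mulr_ge0.
  have QCT : Q * C <= e * T `^ (1 - al).
    rewrite [leRHS]mulrC -ler_pdivrMr// [leLHS](_ : _ = ((Q * C / e) `^ (1 - al)^-1) `^ (1 - al)); last first.
      by rewrite -powRrM mulVf ?gt_eqF// powRr1.
    by apply: ge0_ler_powR; rewrite ?nnegrE ?powR_ge0 ?(ltW a10) ?(ltW T0)// le_max lexx orbT.
  have [v hv] := exists_version T0.
  have H1 := test_bound T0 hv T1; have H2 := HC T v T0 hv.
  have QE0 : (0 <= Q%:E)%E by rewrite lee_fin.
  have := le_trans H1 (lee_wpmul2l QE0 H2); rewrite -EFinM lee_fin -/K => H.
  have Tb : 0 < T `^ (1 - al) by exact: powR_gt0.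
  rewrite -(ler_pM2l Tb); apply: (le_trans H).
  rewrite mulrDr (_ : T `^ (1 - al) * (e * (1 + Q * K)) = e * T `^ (1 - al) + Q * (e * K * T `^ (1 - al))); last by ring.
  exact: lerD.
have QK0 : 0 < 1 + Q * K by rewrite ltr_wpDr// mulr_ge0.
have c00 : c0 = 0.
  apply/eqP; rewrite eq_le c0_ge0 andbT leNgt; apply/negP => cp.
  have e0 : 0 < c0 / (2 * (1 + Q * K)) by apply: divr_gt0 => //; exact: mulr_gt0.
  have := key _ e0; rewrite invfM mulrA mulfVK ?gt_eqF// leNgt; apply/negP; rewrite negbK.
  by rewrite ltr_pdivrMr// mulr_natr mulr2n ltrDl.
(* The square root of the weight presents [c0] as a squared L^2 norm, so its vanishing yields a
   statement almost everywhere. *)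
pose w (xi : Rd R d) := Num.sqrt (weight xi).
have mw : measurable_fun setT w by apply: (measurableT_comp (@measurable_sqrt R)); exact: measurable_weight.
have w1 xi : `|w xi| <= 1.
  by rewrite ger0_norm ?sqrtr_ge0// -sqrtr1 ler_wsqrtr// (le_trans (ler_norm _))// weight_le1.
have hFa := L2_fourier ha; have hw := L2_bounded mw w1 hFa.
have : ip (fun xi => (w xi)%:C%C * fourier a xi) (fun xi => (w xi)%:C%C * fourier a xi) = 0.
  rewrite -c00 /c0 /ip; apply: eq_Rintegral => xi _.
  rewrite !cdotZl cdotC cdotZl mulrA -expr2 sqr_sqrtr ?weight_ge0//.
move=> /(ip0_ae hw) h.
rewrite -(nrm_fourier ha) (ae_nrm (L2_cmeas hFa) (L2_cmeas L20)) ?nrm_cst0//.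
apply: filterS2 h (normRd_gt0_ae d0) => xi h x0; apply: contrapT => /eqP an0.
move: h => /eqP; rewrite mulf_eq0 (negbTE an0) orbF eq_complex /= => /andP[+ _].
apply/negP; rewrite gt_eqF// sqrtr_gt0 /weight; apply: divr_gt0; last exact: lt_le_trans (den_ge1 xi).
by rewrite lt_min powR_gt0 ?ltr01.
Qed.

End mild.

Theorem corollary1p2 (R : realType) (d : nat) (hd : (1 <= d)%N)
  (alpha beta : R)
  (halpha : 0 < alpha < 1) (hbeta : 0 < beta <= 2)
  (a : Rd R d -> R[i]) (ha1 : cLfun 1%:E a) (ha2 : cLfun 2%:E a)
  (p : Rd R d -> R) (hp : p \in Lfun (lebesgue_Rd d) +oo%E)
  (hp_neg : exists2 delta0 : R, 0 < delta0 &
     {ae lebesgue_Rd d, forall x, p x < - delta0})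
  (u : R -> Rd R d -> R[i]) (hu : mild_solution alpha beta p a u)
  (hdecay : forall e : R, 0 < e -> \forall t \near +oo,
     (sobolev_norm (beta / 2) (u t) <= (e * t `^ (- alpha))%:E)%E) :
  forall t : R, 0 < t -> {ae lebesgue_Rd d, forall x, u t x = 0}.
Proof.
have [mp [q [M [M0 mq qM pq]]]] := Linfty_trunc hp.
have [L2u _ _ _] := hu.
have Hdec e : 0 < e -> exists2 T0, 0 < T0 & forall t, T0 <= t -> nrm (u t) <= e * t `^ (- alpha).
  (* The neighbourhood of infinity gives t > T0 strictly, whence T0 + 1 for a closed half-line; the
     maximum with 1 makes the threshold positive. *)
  move=> /hdecay[T0 [_ HT0]]; exists (Num.max 1 (T0 + 1)).
    by rewrite lt_max ltr01.
  move=> t; rewrite ge_max => /andP[t1 tT]; rewrite -lee_fin.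
  have t0 : 0 < t by exact: lt_le_trans t1.
  apply: le_trans (HT0 t _); last by rewrite (lt_le_trans _ tT)// ltrDl.
  apply: sobolev_norm_ge; last exact: L2u.
  by rewrite divr_ge0//; case/andP: hbeta => /ltW.
have a0 := amplitude_eq0 halpha ha2 mp M0 mq qM pq hu hd Hdec.
move=> t t0; have ut := L2u t t0.
apply: (ip0_ae ut); rewrite -nrm_sq.
by rewrite (nrm_u_eq0 halpha ha2 mp M0 mq qM pq hu t0 a0) expr0n.
Qed.
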